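(* Let $p_1,p_2,q$ be distinct primes with $p_1\equiv p_2\equiv -q\equiv 1\pmod 4$, and put $k=\mathbb{Q}(\sqrt{p_1p_2q},\sqrt{-1})$. Let $\mathrm{Am}_s(k/\mathbb{Q}(i))$ denote the group of strongly ambiguous classes of $k/\mathbb{Q}(i)$ and let $k^{( * )}$ be the absolute genus field of $k$. If $\mathbb{K}$ is an unramified quadratic extension of $k$ that is abelian over $\mathbb{Q}$, then: 1. $|\kappa_{\mathbb{K}}|\in\{2,4,8\}$; 2. $\kappa_{\mathbb{K}}\subset \mathrm{Am}_s(k/\mathbb{Q}(i))$; 3. $\mathrm{Am}_s(k/\mathbb{Q}(i))\subseteq \kappa_{k^{( * )}}$.
   Context: $i=\sqrt{-1}$. For a finite extension $L/k$, the capitulation kernel $\kappa_L$ is the kernel of the homomorphism $\mathrm{Cl}(k)\to\mathrm{Cl}(L)$ induced by extension of ideals $\mathfrak a\mapsto \mathfrak a\mathcal O_L$. A class of $k$ is ambiguous for $k/\mathbb{Q}(i)$ if it is fixed by $\mathrm{Gal}(k/\mathbb{Q}(i))$; it is strongly ambiguous if it contains an ideal invariant under $\mathrm{Gal}(k/\mathbb{Q}(i))$; $\mathrm{Am}_s(k/\mathbb{Q}(i))$ is the subgroup of the class group generated by the strongly ambiguous classes. The absolute genus field $k^{( * )}$ is the maximal unramified extension of $k$ that is abelian over $\mathbb{Q}$. *)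

(* Defs.v *)
From HB Require Import structures.
From mathcomp Require Import all_boot all_order all_algebra all_fingroup.
From mathcomp Require Import all_solvable all_field.
From mathcomp Require Import boolp classical_sets functions cardinality.

Set Implicit Arguments.
Unset Strict Implicit.
Unset Printing Implicit Defensive.

Import Order.TTheory GRing.Theory Num.Theory.
Local Open Scope classical_set_scope.
Local Open Scope ring_scope.

(* Number fields are the subfields of an ambient finite normal extension L
   of the rationals; since L is arbitrary it can be taken as large as needed.
   Ideals are subsets of L, and an ideal class is the set of its members. *)

Section Ideals.
Variable L : splittingFieldType rat.
Implicit Types (E F K k : {subfield L}) (I J P : set L).

Definition ring_of_integers E : set L :=
  [set x | x \in E /\ integralOver (intr : int -> L) x].

(* Nonzero fractional ideals of E. *)
Definition fractional_ideal E I : Prop :=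
  [/\ I `<=` [set x | x \in E],
      exists2 x, I x & x != 0,
      forall x y, I x -> I y -> I (x + y),
      forall a x, ring_of_integers E a -> I x -> I (a * x)
    & exists d, [/\ ring_of_integers E d, d != 0
                  & forall x, I x -> ring_of_integers E (d * x)]].

Definition ideal_mul I J : set L :=
  [set x | exists s : seq (L * L),
     (forall ab, ab \in s -> I ab.1 /\ J ab.2) /\
     x = \sum_(ab <- s) ab.1 * ab.2].

Definition ideal_exp E I (n : nat) : set L :=
  iter n (ideal_mul I) (ring_of_integers E).

Definition principal_ideal E (x : L) : set L :=
  [set x * a | a in ring_of_integers E].

(* The ideal I O_K generated in K by an ideal I of a subfield. *)
Definition ideal_ext K I : set L := ideal_mul I (ring_of_integers K).

(* The coset of I modulo the nonzero principal fractional ideals. *)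
Definition ideal_class E I : set (set L) :=
  [set ideal_mul (principal_ideal E x) I | x in [set x | x \in E /\ x != 0]].

Definition class_group E : set (set (set L)) :=
  [set ideal_class E I | I in fractional_ideal E].

Definition class_one E : set (set L) := ideal_class E (ring_of_integers E).

(* The product of two classes is their product as cosets. *)
Definition class_mul (c d : set (set L)) : set (set L) :=
  [set ideal_mul I J | I in c & J in d].

Definition class_subgroup E (H : set (set (set L))) : Prop :=
  [/\ H `<=` class_group E,
      H (class_one E),
      forall c d, H c -> H d -> H (class_mul c d)
    & forall c d, H c -> class_group E d -> class_mul c d = class_one E -> H d].

(* The class of K containing I O_K for one (equivalently every) I in c. *)
Definition class_ext K (c : set (set L)) : set (set L) :=
  \bigcup_(I in c) ideal_class K (ideal_ext K I).

Definition capitulation_kernel k K : set (set (set L)) :=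
  [set c | class_group k c /\ class_ext K c = class_one K].

Definition invariant_ideal F k I : Prop :=
  forall g : gal_of k, g \in 'Gal(k / F)%g -> [set g x | x in I] = I.

Definition strongly_ambiguous F k (c : set (set L)) : Prop :=
  class_group k c /\ exists2 I, c I & invariant_ideal F k I.

Definition Am_s F k : set (set (set L)) :=
  smallest (class_subgroup k) (strongly_ambiguous F k).

(* Nonzero prime ideals of the ring of integers of E. *)
Definition prime_ideal E P : Prop :=
  [/\ fractional_ideal E P, P `<=` ring_of_integers E, ~ P 1
    & forall x y, ring_of_integers E x -> ring_of_integers E y ->
        P (x * y) -> P x \/ P y].

(* e is the exponent of P in (P :&: O_k) O_K, i.e. the largest n such that
   P ^ n contains that ideal. *)
Definition ramification_index k K P (e : nat) : Prop :=
  let pK := ideal_ext K (P `&` ring_of_integers k) in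
  pK `<=` ideal_exp K P e /\ ~ (pK `<=` ideal_exp K P e.+1).

Definition unramified_finite k K : Prop :=
  forall P, prime_ideal K P -> ramification_index k K P 1.

(* No real place of k becomes complex in K; the embeddings of K are the
   restrictions of those of L. *)
Definition unramified_infinite k K : Prop :=
  forall f : {rmorphism L -> algC},
    (forall x, x \in k -> f x \is Num.real) ->
    forall x, x \in K -> f x \is Num.real.

Definition unramified_ext k K : Prop :=
  [/\ (k <= K)%VS, unramified_finite k K & unramified_infinite k K].

Definition abelian_over_Q K : Prop :=
  galois 1%AS K /\ abelian 'Gal(K / 1%AS)%g.

End Ideals.

(* G contains every extension of k that is unramified over k and abelian over
   the rationals, including those that only exist in some larger ambient
   field L'. *)
Definition absolute_genus_field (L : splittingFieldType rat)
    (k G : {subfield L}) : Prop :=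
  [/\ unramified_ext k G, abelian_over_Q G
    & forall (L' : splittingFieldType rat) (f : 'AHom(L, L'))
             (M : {subfield L'}),
        unramified_ext (f @: k)%AS M -> abelian_over_Q M ->
        (M <= f @: G)%VS].

(* Main.v *)
(** Let d = p1 p2 q, s = sqrt d, and let rho generate Gal(k / Q(i)).  The prime
    factors of d in Z[i] are pi1, pi1', pi2, pi2' and q; each is the square of
    an ideal of k, and for v in F_2^5 the product r_v of the selected primes is
    the square of an ideal J_v.  Since Z[i] is principal and O_k is reduced
    modulo every Gaussian prime not dividing d, the strongly ambiguous classes
    are exactly the classes of the J_v.  The class of J_v becomes trivial in an
    extension E of k if and only if r_v is a unit times a square in E.

    Ramification forces K = k(sqrt m) with m one of p1, p2, p1 p2.  If I O_K is
    generated by alpha, the ideal I rho(I) by r in Q(i), and sigma generates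
    Gal(K / k), then A = alpha rho(alpha) / r is a unit of Q(i, sqrt m) with
    A sigma(A) = 1 or -1, the values i and -i being excluded because 2 is
    unramified in Q(sqrt m); Hilbert 90 then makes I strongly ambiguous up to a
    principal ideal.

    Hence the kernel is S / R, where S and R are the subgroups of those v for
    which r_v is a unit times a square in K and in k.  R contains (1,1,1,1,1)
    because s^2 = d.  S is larger than R: a solution of v^2 + 1 = m u^2, or of
    p1 u^2 - p2 v^2 = 1 up to order when the former has none, produces an
    element of S, and comparison with the units of Q(sqrt d), whose norms are
    all 1 because q is 3 modulo 4, shows that some such element is not in R.  S is
    not everything: it misses a Gaussian prime over p2 if m = p1, and one over
    p1 otherwise.  As |F_2^5| = 32, the index is 2, 4 or 8.  Finally,
    k(sqrt p1) and k(sqrt p2) are unramified, so that the genus field contains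
    sqrt p1, sqrt p2 and sqrt q, and there every r_v is a unit times a square. *)

Require Import Defs.
From HB Require Import structures.
From mathcomp Require Import all_boot all_order all_algebra all_fingroup.
From mathcomp Require Import all_solvable all_field.
From mathcomp Require Import boolp classical_sets functions cardinality.
From mathcomp Require Import ring lra zify.

Set Implicit Arguments.
Unset Strict Implicit.
Unset Printing Implicit Defensive.

Import Order.TTheory GRing.Theory Num.Theory.
Local Open Scope classical_set_scope.
Local Open Scope card_scope.
Local Open Scope ring_scope.

(** Dedekind theory enters through invertibility of fractional ideals, lifted from Z[i] along each
    quadratic step by the relative norm. Squares carry the argument: an element with integral square
    is integral, so an ideal with square (r) is the set of x with x^2 / r integral, and its fate in
    an extension depends only on r up to units and squares. The obstacle is to show that certain
    elements are not units times squares in fields of degree 4 and 8 whose unit groups are not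
    determined. Two facts suffice. Norms of a hypothetical solution to imaginary quadratic subfields
    yield units there, and these are 1 or -1 because a prime at least 5 divides the radicand exactly
    once; this controls the conjugates of the solution up to sign and moves the question into a
    quadratic field, where a prime occurring to the first power decides it. In Q(sqrt d), the Pell
    solutions are generated up to sign by one element, so of two solutions and their product at
    least one is a square up to sign. *)

Ltac mem := repeat first [ assumption | solve [trivial] |
  lazymatch goal with
  | |- is_true (_ \in _) => first [ exact: rpred0 | exact: rpred1 | exact: rpred_nat
      | exact: rpred_int | exact: mem0v | exact: mem1v ]
  | |- _ => fail end |
  lazymatch goal with
  | |- is_true (_ - _ \in _) => apply: rpredB
  | |- is_true (_ + _ \in _) => apply: rpredD
  | |- is_true (- _ \in _) => rewrite rpredN
  | |- is_true (_ * _ \in _) => apply: rpredM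
  | |- is_true (_ ^+ _ \in _) => apply: rpredX
  | |- is_true (_ ^-1 \in _) => rewrite rpredV
  end ].

(** A one-hypothesis certificate: exhibiting [a - b] as a multiple of [x - y] leaves a goal for
    [ring]. Chained uses combine several hypotheses. *)
Lemma lin_comb (R : comNzRingType) (c x y a b : R) :
  x = y -> a - b = c * (x - y) -> a = b.
Proof. by move=> ->; rewrite subrr mulr0 => /eqP; rewrite subr_eq0 => /eqP. Qed.

Definition QQ (L : splittingFieldType rat) : {subfield L} := 1%AS.

(** * Quadratic extensions and sign-changing automorphisms *)

Section Quadratic.
Variable L : splittingFieldType rat.
Implicit Types (E F K M : {subfield L}) (g h : 'AEnd(L)) (x y z : L).

Lemma pchar0 : [pchar L] =i pred0.
Proof.
move=> p; rewrite (fmorph_pchar (in_alg L)).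
by rewrite (pchar_num rat).
Qed.

Lemma natL_eq0 (n : nat) : (n%:R == 0 :> L) = (n == 0)%N.
Proof. by rewrite (pcharf0P L).1 //; exact: pchar0. Qed.

Lemma intL_inj : injective (intr : int -> L).
Proof.
move=> a b ab; apply: (@intr_inj rat); apply: (fmorph_inj (in_alg L)).
by rewrite !rmorph_int.
Qed.

Lemma intL_eq0 (n : int) : (n%:~R == 0 :> L) = (n == 0).
Proof. by rewrite -(inj_eq intL_inj). Qed.

Lemma two_neq0 : 2%:R != 0 :> L. Proof. by rewrite natL_eq0. Qed.

Lemma quad_coord E y z : y ^+ 2 \in E -> z \in <<E; y>>%VS ->
  exists a b, [/\ a \in E, b \in E & z = a + b * y].
Proof.
move=> yy /Fadjoin_polyP[p pE ->].
elim/poly_ind: p pE => [|p c IH] pE.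
  by exists 0, 0; rewrite !mem0v horner0 mul0r addr0.
have pE' : p \is a polyOver E.
  by apply/polyOverP=> j; have := polyOverP pE j.+1; rewrite coefD coefMX coefC addr0.
have cE : c \in E.
  by have := polyOverP pE 0%N; rewrite coefD coefMX coefC add0r.
have [a [b [aE bE e]]] := IH pE'.
exists (c + b * y ^+ 2), a; split=> //; first by mem.
by rewrite hornerD hornerMX hornerC e; ring.
Qed.

(** Write [z = a + b * y]. The mixed term [2 a b y] of [z ^+ 2] lies in [E], so [a = 0], or [b = 0],
    or [y] itself lies in [E]. This is Kummer theory in degree two; it decides later which product
    of radicals is rational. *)
Lemma quad_mem E y z : y ^+ 2 \in E -> z ^+ 2 \in E -> z \in <<E; y>>%VS ->
  z \in E \/ z * y \in E.
Proof.
move=> yy zz /(quad_coord yy)[a [b [aE bE e]]].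
have [yE|yE] := boolP (y \in E); first by left; rewrite e rpredD ?rpredM.
have ab : 2%:R * a * b * y \in E.
  have -> : 2%:R * a * b * y = z ^+ 2 - a ^+ 2 - b ^+ 2 * y ^+ 2 by rewrite e; ring.
  by mem.
have [a0|a0] := eqVneq a 0; first by right; rewrite e a0 add0r -mulrA -expr2 rpredM.
have [b0|b0] := eqVneq b 0; first by left; rewrite e b0 mul0r addr0.
case/negP: yE.
have c0 : 2%:R * a * b != 0 by rewrite !mulf_neq0 ?two_neq0.
by rewrite -(mulKf c0 y) rpredM // rpredV !rpredM ?rpred_nat.
Qed.

Lemma sqr_opp_or x y : x ^+ 2 = y ^+ 2 -> x = y \/ x = - y.
Proof. by move/eqP; rewrite eqf_sqr => /orP[]/eqP->; [left|right]. Qed.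

(** [L] is normal over [E], so some automorphism moves [x], necessarily to the other root [- x]. It
    acts on the whole ambient field, so its effect on further radicals can be compared across
    subfields. *)
Lemma quad_aut E x : x ^+ 2 \in E -> x \notin E ->
  exists g : 'AEnd(L), (forall y, y \in E -> g y = y) /\ g x = - x.
Proof.
move=> xx xE.
have gal : galois E {:L}.
  rewrite /galois subvf /= normalFieldf andbT.
  apply/separableP=> y _; by apply: pcharf0_separable; exact: pchar0.
have [g gE gx] : exists2 g : gal_of {:L}, g \in 'Gal({:L} / E)%g & g x != x.
  apply: contrapT => H; case/negP: xE; rewrite -(galois_fixedField gal).
  apply/fixedFieldP; first exact: memvf.
  by move=> g gE; apply/eqP; apply: contrapT => /negP gx; apply: H; exists g.
have fixg y : y \in E -> g y = y by move=> yE; apply: (fixed_gal _ gE) => //; exact: subvf.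
exists g; split=> //.
have : (g x) ^+ 2 = x ^+ 2 by rewrite -rmorphXn /= fixg.
by case/sqr_opp_or => // e; rewrite e eqxx in gx.
Qed.

Lemma aut_stable M g x : galois (QQ L) M -> x \in M -> g x \in M.
Proof.
case/and3P=> _ _ /forall_inP /(_ g) H xM.
have /eqP <- : (g @: M == M)%VS.
  by apply: H; rewrite inE kAutfE k1AHom.
exact: memv_img.
Qed.

Lemma aut_adjoin E g y : (forall x, x \in E -> g x \in E) -> y ^+ 2 \in E ->
  g y = y \/ g y = - y -> forall x, x \in <<E; y>>%VS -> g x \in <<E; y>>%VS.
Proof.
move=> gE yy gy x /(quad_coord yy)[a [b [aE bE ->]]].
rewrite rmorphD rmorphM /= rpredD ?rpredM ?memv_adjoin //; try exact: (subvP (subv_adjoin _ _) _ (gE _ _)).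
by case: gy => ->; rewrite ?rpredN memv_adjoin.
Qed.

(** Descent to a fixed field: this is how a norm from a biquadratic field is placed in a chosen
    quadratic subfield. *)
Lemma quad_fixed E g y : y ^+ 2 \in E -> (forall x, x \in E -> g x = x) ->
  g y = - y -> forall x, x \in <<E; y>>%VS -> g x = x -> x \in E.
Proof.
move=> yy gE gy x /(quad_coord yy)[a [b [aE bE ->]]].
rewrite rmorphD rmorphM /= gy !gE // => /addrI.
move/eqP; rewrite mulrN eq_sym -subr_eq0 opprK -mulr2n -mulr_natl mulf_eq0.
by rewrite (negbTE two_neq0) /= => /eqP->; rewrite addr0.
Qed.

Lemma mem1P x : reflect (exists a : rat, x = a%:A) (x \in QQ L).
Proof. exact: vlineP. Qed.

Lemma aut_rat g (a : rat) : g a%:A = a%:A.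
Proof. by rewrite linearZ /= rmorph1. Qed.

End Quadratic.

Notation isint x := (integralOver (intr : int -> _) x).

(** * Algebraic integers and units *)

Section Integers.
Variable L : splittingFieldType rat.
Implicit Types (E F K M : {subfield L}) (g h : 'AEnd(L)) (x y z u w : L).

Lemma isintD x y : isint x -> isint y -> isint (x + y).
Proof. exact: integral_add. Qed.
Lemma isintB x y : isint x -> isint y -> isint (x - y).
Proof. exact: integral_sub. Qed.
Lemma isintM x y : isint x -> isint y -> isint (x * y).
Proof. exact: integral_mul. Qed.
Lemma isintN x : isint x -> isint (- x).
Proof. exact: integral_opp. Qed.
Lemma isint_int (n : int) : isint (n%:~R : L).
Proof. exact: integral_id. Qed.
Lemma isint_nat (n : nat) : isint (n%:R : L).
Proof. exact: isint_int n. Qed.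
Lemma isint0 : isint (0 : L). Proof. exact: isint_nat 0. Qed.
Lemma isint1 : isint (1 : L). Proof. exact: isint_nat 1. Qed.
Lemma isintX x n : isint x -> isint (x ^+ n).
Proof.
move=> ix; elim: n => [|n IH]; first exact: isint1.
by rewrite exprS; apply: isintM.
Qed.

Lemma isint_quad t n w : isint t -> isint n -> w ^+ 2 - t * w + n = 0 -> isint w.
Proof.
move=> it jn e; pose p := 'X^2 - t *: 'X + n%:P : {poly L}.
have pc j : isint p`_j.
  rewrite /p !coefE; case: j => [|[|[|j]]] /=; rewrite ?(mulr0, mulr1, subr0, addr0, add0r, sub0r, oppr0).
  - exact: jn.
  - exact: isintN.
  - exact: isint1.
  - exact: isint0.
apply: (@integral_root_monic _ _ _ _ p).
- have sp : size p = 3%N.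
    rewrite /p -addrA size_polyDl size_polyXn //.
    apply: leq_ltn_trans (size_polyD _ _) _.
    rewrite size_polyN gtn_max (leq_ltn_trans (size_scale_leq _ _)) ?size_polyX //.
    by rewrite (leq_ltn_trans (size_polyC_leq1 _)).
  by rewrite monicE lead_coefE sp /p !coefE /= mulr0 subr0 addr0.
- by rewrite /root /p !hornerE e.
- by move=> c /(nthP 0)[j _ <-].
Qed.

Lemma isint_sqr x : isint (x ^+ 2) -> isint x.
Proof. by move=> ix; apply: (isint_quad isint0 (isintN ix)); ring. Qed.

Lemma isint_aut g x : isint x -> isint (g x).
Proof.
case=> p pm rp; exists p => //.
have -> : map_poly intr p = map_poly g (map_poly intr p).
  by rewrite -map_poly_comp; apply: eq_map_poly => n /=; rewrite rmorph_int.
exact: rmorph_root.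
Qed.

(** The integral equation is carried to the algebraic numbers, where a rational algebraic integer is
    an integer. *)
Lemma isint_rat x : x \in QQ L -> isint x -> exists n : int, x = n%:~R.
Proof.
move=> /mem1P[a ->] [p pm rp].
have rp' : root (map_poly (intr : int -> algC) p) (ratr a).
  have rq : root (map_poly (intr : int -> rat) p) a.
    rewrite -(fmorph_root (in_alg L)) -map_poly_comp /=.
    by rewrite (eq_map_poly (g := intr)) // => n /=; rewrite scaler_int.
  rewrite -(fmorph_root (ratr : {rmorphism rat -> algC})) -map_poly_comp in rq.
  by rewrite (eq_map_poly (g := intr)) // in rq => n /=; rewrite rmorph_int.
have : ratr a \in Aint.
  apply: root_monic_Aint rp' _ _; first by rewrite monic_map.
  by apply/polyOverP=> j; rewrite coef_map /= intr_int.
move=> /(Cint_rat_Aint (Crat_rat a)); rewrite Cint_rat => /intrP[n ->].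
by exists n; rewrite scaler_int.
Qed.

Lemma isint_denom x : exists n : int, n != 0 /\ isint (n%:~R * x).
Proof.
have [q q0 rq] : exists2 q : {poly int}, q != 0 & root (map_poly intr q) x.
  have [p pE] : exists p : {poly rat}, minPoly (QQ L) x = map_poly (in_alg L) p.
    have /polyOver1P[p ->] := minPolyOver (QQ L) x; by exists p.
  have [q [a a0 pq]] := rat_poly_scale p; exists q.
    apply: contra_eq_neq pE => q0; rewrite pq q0 rmorph0 scaler0 rmorph0.
    by rewrite monic_neq0 // monic_minPoly.
  have rx := root_minPoly (QQ L) x; move: rx.
  rewrite pE pq map_polyZ -map_poly_comp /root hornerZ mulf_eq0 fmorph_eq0 invr_eq0.
  rewrite intr_eq0 (negbTE a0) /= (eq_map_poly (g := intr)) // => n /=.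
  by rewrite scaler_int.
set c := lead_coef q; exists c; split; first by rewrite lead_coef_eq0.
set n := (size q).-1.
have sq : size q = n.+1 by rewrite prednK // size_poly_gt0.
have [n0|n0] := posnP n.
  exfalso; move: rq; rewrite (size1_polyC (eq_leq (etrans sq (congr1 S n0)))).
  rewrite map_polyC /root hornerC intL_eq0 => c0; case/negP: q0.
  by rewrite (size1_polyC (eq_leq (etrans sq (congr1 S n0)))) (eqP c0).
(* With [c] the leading coefficient of [q], multiplying the equation of [x] by [c ^+ n.-1] gives a
   monic integral equation for [c x]. *)
pose r := 'X^n + \poly_(j < n) (q`_j * c ^+ (n.-1 - j)).
exists r.
  by rewrite monicE lead_coefDl ?lead_coefXn // size_polyXn ltnS size_poly.
rewrite /root rmorphD /= map_polyXn hornerD hornerXn.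
have -> : map_poly intr (\poly_(j < n) (q`_j * c ^+ (n.-1 - j))) =
    \poly_(j < n) (q`_j * c ^+ (n.-1 - j))%:~R :> {poly L}.
  by apply/polyP=> j; rewrite coef_map !coef_poly; case: ifP.
rewrite horner_poly.
have : c%:~R ^+ n.-1 * (map_poly intr q).[x] = 0 by rewrite (eqP rq) mulr0.
rewrite (horner_coef_wide _ (n := n.+1)) ?size_map_poly_leq //; last first.
  by rewrite -sq; apply: size_poly.
rewrite big_ord_recr /= mulrDr addrC => /eqP; congr (_ == 0); congr (_ + _).
  rewrite coef_map /= -[q`_n]/(lead_coef q) -/c exprMn mulrA -exprSr prednK //.
rewrite mulr_sumr; apply: eq_bigr => j _; rewrite coef_map /= rmorphM rmorphXn /=.
have jn : (j <= n.-1)%N by rewrite -ltnS prednK.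
by rewrite -{1}(subnK jn) exprMn exprD; ring.
Qed.

Lemma rat_sqr_int z (N : int) : z \in QQ L -> z ^+ 2 = N%:~R ->
  exists c : int, N = c ^+ 2.
Proof.
move=> z1 zN; have [|c zc] := isint_rat z1.
  by apply: isint_sqr; rewrite zN; apply: isint_int.
by exists c; apply: (@intL_inj L); rewrite -zN zc rmorphXn.
Qed.

Lemma rat_sqr_prime z (n : nat) (M : int) : prime n -> ~~ (n %| M)%Z ->
  z \in QQ L -> z ^+ 2 = (n%:Z * M)%:~R -> False.
Proof.
move=> pn nM z1 /(rat_sqr_int z1)[c e].
have nc : (n %| c)%Z.
  have : (n %| c ^+ 2)%Z by rewrite -e dvdz_mulr.
  by rewrite !dvdzE abszX Euclid_dvdX // andbT.
case/dvdzP: nc => b cb; case/negP: nM; apply/dvdzP; exists (b ^+ 2).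
have n0 : n%:Z != 0 by have := prime_gt0 pn; lia.
by apply: (mulfI n0); rewrite e cb; ring.
Qed.

Definition iunit x := [/\ x != 0, isint x & isint x^-1].

Lemma iunit_neq0 u : iunit u -> u != 0. Proof. by case. Qed.
Lemma iunit_int u : iunit u -> isint u. Proof. by case. Qed.
Lemma iunitV u : iunit u -> iunit u^-1.
Proof. by case=> u0 i1 i2; split; rewrite ?invr_eq0 ?invrK. Qed.
Lemma iunitM u w : iunit u -> iunit w -> iunit (u * w).
Proof.
case=> u0 i1 i2 [w0 j1 j2]; split; first by rewrite mulf_neq0.
  exact: isintM.
by rewrite invfM; apply: isintM.
Qed.
Lemma iunit1 : iunit 1.
Proof. by split; rewrite ?oner_eq0 ?invr1 //; apply: isint1. Qed.
Lemma iunitN u : iunit u -> iunit (- u).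
Proof. by case=> u0 i1 i2; split; rewrite ?oppr_eq0 ?invrN //; apply: isintN. Qed.
Lemma iunit_aut g u : iunit u -> iunit (g u).
Proof.
by case=> u0 i1 i2; split; rewrite ?fmorph_eq0 // -?fmorphV //; apply: isint_aut.
Qed.
Lemma iunit_sqr u : iunit (u ^+ 2) -> iunit u.
Proof.
case=> u0 i1 i2; split; first by move: u0; rewrite expf_eq0.
  exact: isint_sqr.
by apply: isint_sqr; rewrite exprVn.
Qed.
Lemma iunit_mul1 u w : isint u -> isint w -> u * w = 1 -> iunit u.
Proof.
move=> iu iw e; have u0 : u != 0.
  by apply: contra_eq_neq e => ->; rewrite mul0r eq_sym oner_eq0.
by split=> //; rewrite -(mulKf u0 w) e mulr1 in iw.
Qed.

Lemma iunit_rat u : u \in QQ L -> iunit u -> u = 1 \/ u = -1.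
Proof.
move=> u1 [u0 iu iv].
have [n nE] := isint_rat u1 iu; have [|m mE] := isint_rat _ iv; first by rewrite memvV.
have : n * m = 1 by apply: (@intL_inj L); rewrite rmorphM /= -nE -mE mulfV.
move=> /(congr1 absz); rewrite abszM => /eqP; rewrite muln_eq1 => /andP[/eqP n1 _].
have {n1}[n1|n1] : n = 1 \/ n = -1 by lia.
  by left; rewrite nE n1.
by right; rewrite nE n1 rmorphN1.
Qed.

(* The norm of a unit of an imaginary quadratic field is 1, and a prime factor
   at least 5 of the discriminant rules out nonreal roots of unity. *)
Lemma iunit_imag y u (n n' p : nat) : prime p -> (4 < p)%N -> n = (p * n')%N ->
  ~~ (p %| n')%N -> y ^+ 2 = - n%:R -> u \in <<QQ L; y>>%VS -> iunit u ->
  u = 1 \/ u = -1.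
Proof.
move=> pp p4 ne pn' yy uy iu.
have yy1 : y ^+ 2 \in QQ L by rewrite yy; mem.
have n'0 : (0 < n')%N by case: n' ne pn' => //; rewrite dvdn0.
have n0 : (0 < n)%N by rewrite ne muln_gt0 prime_gt0.
have y1 : y \notin QQ L.
  apply/negP=> y1; have : y ^+ 2 = (- n%:Z)%:~R by rewrite yy rmorphN.
  by move/(rat_sqr_int y1)=> [c]; have := sqr_ge0 c; lia.
have [g [g1 gy]] := quad_aut yy1 y1.
have [a [b [a1 b1 ue]]] := quad_coord yy1 uy.
have gu : g u = a - b * y by rewrite ue rmorphD rmorphM /= gy !g1 // mulrN.
have [t tE] : exists t : int, 2%:R * a = t%:~R.
  apply: isint_rat; first by mem.
  have -> : 2%:R * a = u + g u by rewrite gu ue; ring.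
  by apply: isintD; [exact: iunit_int|apply: isint_aut; exact: iunit_int].
have Ne : u * g u = a ^+ 2 + n%:R * b ^+ 2.
  have -> : u * g u = a ^+ 2 - b ^+ 2 * y ^+ 2 by rewrite gu ue; ring.
  by rewrite yy; ring.
have N1 : u * g u = 1.
  have [||//|e] := @iunit_rat (u * g u).
  - by rewrite Ne; mem.
  - by apply: iunitM => //; apply: iunit_aut.
  (* The norm [a ^+ 2 + n b ^+ 2] is nonnegative, so it is not -1. *)
  exfalso; move/mem1P: a1 Ne => [qa ->]; move/mem1P: b1 => [qb ->].
  have -> : qa%:A ^+ 2 + n%:R * qb%:A ^+ 2 = (qa ^+ 2 + n%:R * qb ^+ 2)%:A :> L.
    by rewrite -!in_algE rmorphD rmorphM !rmorphXn rmorph_nat.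
  rewrite e => /(congr1 -%R); rewrite opprK -scaleNr -{1}(scale1r 1) => /eqP.
  rewrite -!in_algE (inj_eq (fmorph_inj _)) => /eqP.
  have := sqr_ge0 qa; have := sqr_ge0 qb; have : 0 <= n%:R :> rat by rewrite ler0n.
  nra.
(* With norm 1 and integral trace [t], the rational number [2 b n] has square [(4 - t^2) n], whence
   [t^2 <= 4]. For [t^2] equal to 1 or 0 the value is [3 n] or [4 n], which contains the prime
   [p > 4] exactly once and is no square. *)
have zE : (2%:R * b * n%:R) ^+ 2 = ((4 - t ^+ 2) * n%:Z)%:~R.
  rewrite Ne in N1.
  have -> : (2%:R * b * n%:R) ^+ 2 = 4%:R * n%:R * (n%:R * b ^+ 2) by ring.
  have -> : n%:R * b ^+ 2 = 1 - a ^+ 2 by apply: (lin_comb (c := 1) N1); ring.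
  have -> : 4%:R * n%:R * (1 - a ^+ 2) = (4%:R - (2%:R * a) ^+ 2) * n%:R by ring.
  by rewrite tE rmorphM rmorphB rmorphXn.
have z1 : 2%:R * b * n%:R \in QQ L by mem.
have t4 : t ^+ 2 <= 4.
  have [c cE] := rat_sqr_int z1 zE; have := sqr_ge0 c; rewrite -cE.
  by rewrite pmulr_lge0 ?subr_ge0 //; lia.
have tt : (t == 2) || (t == 1) || (t == 0) || (t == -1) || (t == -2) by nia.
have [t2|t2] : t ^+ 2 = 4 \/ t ^+ 2 = 1 \/ t ^+ 2 = 0.
  by case/orP: tt => [/orP[/orP[/orP[]|]|]|] /eqP->;
    first [by left|by right; left|by right; right].
- have b0 : b = 0.
    move/eqP: zE; rewrite t2 subrr mul0r expf_eq0 /= mulf_eq0 natL_eq0.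
    by rewrite -[n == 0%N]negbK -lt0n n0 orbF mulf_eq0 (negbTE (two_neq0 L)) => /eqP.
  have ua : u = a by rewrite ue b0 mul0r addr0.
  by apply: iunit_rat; rewrite ua // -ua.
exfalso; have [M [pM ME]] : exists M : int, ~~ (p %| M)%Z /\ (4 - t ^+ 2) * n%:Z = p%:Z * M.
  case: t2 => ->; rewrite ne.
    exists (3 * n'%:Z); split; last by rewrite PoszM; ring.
    rewrite dvdzE abszM absz_nat Euclid_dvdM // negb_or pn' andbT.
    by apply/negP=> /dvdn_leq; lia.
  exists (4 * n'%:Z); split; last by rewrite PoszM; ring.
  rewrite dvdzE abszM absz_nat Euclid_dvdM // negb_or pn' andbT.
  by apply/negP=> /dvdn_leq; lia.
rewrite ME in zE; exact: (rat_sqr_prime pp pM z1 zE).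
Qed.

End Integers.

Ltac isi := repeat first [ assumption | exact: isint0 | exact: isint1 | exact: isint_nat | exact: isint_int |
  lazymatch goal with
  | |- integralOver _ (_ - _) => apply: isintB
  | |- integralOver _ (_ + _) => apply: isintD
  | |- integralOver _ (- _) => apply: isintN
  | |- integralOver _ (_ * _) => apply: isintM
  | |- integralOver _ (_ ^+ _) => apply: isintX
  | |- integralOver _ (fun_of_lfun _ _) => apply: isint_aut
  end ].

(** * Ideals and ideal classes *)

Section IdealArithmetic.
Variable L : splittingFieldType rat.
Implicit Types (E F K k : {subfield L}) (g h : 'AEnd(L)) (x y z u w a b : L).
Implicit Types (I J M N : set L).
Local Notation OO := ring_of_integers.

(** Fractional ideals without nonvanishing and bounded denominators: the formal arithmetic of
    products, scalings and classes lives at this level and so applies to extended ideals and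
    products as they arise. *)
Definition emodule E I := [/\ I 0, forall x y, I x -> I y -> I (x + y)
  & forall a x, OO E a -> I x -> I (a * x)].

Lemma OO1 E : OO E 1. Proof. by split; [exact: rpred1|exact: isint1]. Qed.
Lemma OO0 E : OO E 0. Proof. by split; [exact: rpred0|exact: isint0]. Qed.
Lemma OOD E x y : OO E x -> OO E y -> OO E (x + y).
Proof. by move=> [? ?] [? ?]; split; [mem|isi]. Qed.
Lemma OON E x : OO E x -> OO E (- x).
Proof. by move=> [? ?]; split; [mem|isi]. Qed.
Lemma OOM E x y : OO E x -> OO E y -> OO E (x * y).
Proof. by move=> [? ?] [? ?]; split; [mem|isi]. Qed.
Lemma OOX E x n : OO E x -> OO E (x ^+ n).
Proof. by move=> [? ?]; split; [mem|isi]. Qed.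
Lemma OOS E F x : (E <= F)%VS -> OO E x -> OO F x.
Proof. by move=> /subvP EF [/EF]. Qed.

Lemma emodule_O E : emodule E (OO E).
Proof. by split; [exact: OO0|exact: OOD|exact: OOM]. Qed.

Lemma fractional_emodule E I : fractional_ideal E I -> emodule E I.
Proof.
case=> _ [x xI _] ID IM _; split=> //.
by rewrite -(mul0r x); apply: IM => //; apply: OO0.
Qed.

Lemma emoduleN E I x : emodule E I -> I x -> I (- x).
Proof. by case=> _ _ IM xI; rewrite -mulN1r; apply: IM => //; apply/OON/OO1. Qed.

Lemma im_mem I J a b : I a -> J b -> ideal_mul I J (a * b).
Proof.
move=> aI bJ; exists [:: (a, b)]; split; last by rewrite big_seq1.
by move=> ab; rewrite inE => /eqP->.
Qed.

Lemma im0 I J : ideal_mul I J 0.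
Proof. by exists [::]; rewrite big_nil. Qed.

Lemma imD I J x y : ideal_mul I J x -> ideal_mul I J y -> ideal_mul I J (x + y).
Proof.
move=> [s [sP ->]] [t [tP ->]]; exists (s ++ t); split; last by rewrite big_cat.
by move=> ab; rewrite mem_cat => /orP[/sP|/tP].
Qed.

Lemma im_ind I J (M : set L) : M 0 -> (forall x y, M x -> M y -> M (x + y)) ->
  (forall a b, I a -> J b -> M (a * b)) -> ideal_mul I J `<=` M.
Proof.
move=> M0 MD MM x [s [sP ->]]; elim: s sP => [|[a b] s IH] sP.
  by rewrite big_nil.
rewrite big_cons; apply: MD.
  by have [] := sP (a, b) (mem_head _ _); apply: MM.
by apply: IH => ab abs; apply: sP; rewrite inE abs orbT.
Qed.

Lemma imS I I' J J' : I `<=` I' -> J `<=` J' -> ideal_mul I J `<=` ideal_mul I' J'.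
Proof.
move=> II' JJ'; apply: im_ind; [exact: im0|exact: imD|].
by move=> a b /II' aI /JJ' bJ; apply: im_mem.
Qed.

Lemma imC I J : ideal_mul I J = ideal_mul J I.
Proof.
wlog suff: I J / ideal_mul I J `<=` ideal_mul J I.
  by move=> H; apply/seteqP; split; apply: H.
apply: im_ind; [exact: im0|exact: imD|].
by move=> a b aI bJ; rewrite mulrC; apply: im_mem.
Qed.

Lemma imA I J M : ideal_mul I (ideal_mul J M) = ideal_mul (ideal_mul I J) M.
Proof.
apply/seteqP; split.
  apply: im_ind; [exact: im0|exact: imD|].
  move=> a b aI; move: b; apply: im_ind.
  - by rewrite mulr0; exact: im0.
  - by move=> x y hx hy; rewrite mulrDr; apply: imD.
  - by move=> b c bJ cM; rewrite mulrA; apply: im_mem => //; apply: im_mem.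
apply: im_ind; [exact: im0|exact: imD|].
move=> a b + bM; move: a; apply: im_ind.
- by rewrite mul0r; exact: im0.
- by move=> x y hx hy; rewrite mulrDl; apply: imD.
- by move=> a c aI cJ; rewrite -mulrA; apply: im_mem => //; apply: im_mem.
Qed.

Lemma imAC I J M : ideal_mul (ideal_mul I J) M = ideal_mul (ideal_mul I M) J.
Proof. by rewrite -!imA (imC J). Qed.

Lemma imACA I J M N : ideal_mul (ideal_mul I J) (ideal_mul M N) =
  ideal_mul (ideal_mul I M) (ideal_mul J N).
Proof. by rewrite -!imA (imA J) (imC J) -(imA M). Qed.

Lemma im_emodule E I J : emodule E I -> emodule E (ideal_mul I J).
Proof.
move=> [I0 ID IM]; split; [exact: im0|exact: imD|] => a + aE; apply: im_ind.
- by rewrite mulr0; exact: im0.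
- by move=> x y hx hy; rewrite mulrDr; apply: imD.
- by move=> b c bI cJ; rewrite mulrA; apply: im_mem => //; apply: IM.
Qed.

Lemma im_O E I : emodule E I -> ideal_mul I (OO E) = I.
Proof.
move=> [I0 ID IM]; apply/seteqP; split.
  by apply: im_ind => // a b aI bE; rewrite mulrC; apply: IM.
by move=> x xI; rewrite -(mulr1 x); apply: im_mem => //; exact: OO1.
Qed.

(** Scaling without reference to a field, so that it commutes with extension of ideals and with
    automorphisms. *)
Definition iscale x I : set L := [set x * y | y in I].

Lemma iscaleP x I y : x != 0 -> iscale x I y <-> I (x^-1 * y).
Proof.
move=> x0; split; first by move=> [z zI <-]; rewrite mulKf.
by move=> zI; exists (x^-1 * y) => //; rewrite mulVKf.
Qed.

Lemma iscale1 I : iscale 1 I = I.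
Proof.
by apply/seteqP; split=> x; [case=> y yI <-; rewrite mul1r|exists x; rewrite ?mul1r].
Qed.

Lemma iscaleM x y I : iscale x (iscale y I) = iscale (x * y) I.
Proof.
apply/seteqP; split=> z.
  by move=> [_ [w wI <-] <-]; exists w; rewrite ?mulrA.
by move=> [w wI <-]; rewrite -mulrA; exists (y * w) => //; exists w.
Qed.

Lemma iscaleK x I : x != 0 -> iscale x^-1 (iscale x I) = I.
Proof. by move=> x0; rewrite iscaleM mulVf // iscale1. Qed.

Lemma iscale_im x I J : ideal_mul (iscale x I) J = iscale x (ideal_mul I J).
Proof.
apply/seteqP; split.
  apply: im_ind.
  - by exists 0; [exact: im0|rewrite mulr0].
  - by move=> _ _ [y hy <-] [z hz <-]; exists (y + z); [exact: imD|rewrite mulrDr].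
  - move=> _ b [a aI <-] bJ; exists (a * b); [exact: im_mem|by rewrite mulrA].
move=> _ [y + <-]; move: y; apply: im_ind.
- by rewrite mulr0; exact: im0.
- by move=> y z hy hz; rewrite mulrDr; apply: imD.
- by move=> a b aI bJ; rewrite mulrA; apply: im_mem => //; exists a.
Qed.

Lemma iscale_imr x I J : ideal_mul I (iscale x J) = iscale x (ideal_mul I J).
Proof. by rewrite imC iscale_im imC. Qed.

Lemma iscale_emodule E x I : emodule E I -> emodule E (iscale x I).
Proof.
move=> [I0 ID IM]; split.
- by exists 0; rewrite ?mulr0.
- by move=> _ _ [y hy <-] [z hz <-]; exists (y + z); [exact: ID|rewrite mulrDr].
- by move=> a _ aE [y hy <-]; rewrite mulrCA; exists (a * y) => //; apply: IM.
Qed.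

Lemma iscale_fractional E x I : x \in E -> x != 0 -> fractional_ideal E I ->
  fractional_ideal E (iscale x I).
Proof.
move=> xE x0 fI; have [I0 ID IM] := iscale_emodule x (fractional_emodule fI).
case: fI => IE [y yI y0] _ _ [d [dE d0 dI]]; split=> //.
- by move=> _ [z /IE /= zE <-] /=; mem.
- by exists (x * y); [exists y|rewrite mulf_neq0].
have [n [n0 nx]] := isint_denom x.
exists (d * n%:~R); split.
- by apply: OOM => //; split; [mem|isi].
- by rewrite mulf_neq0 // intL_eq0.
- move=> _ [z /dI zI <-]; have -> : d * n%:~R * (x * z) = n%:~R * x * (d * z) by ring.
  by apply: OOM => //; split; [mem|].
Qed.

Lemma im_fractional E I J : fractional_ideal E I -> fractional_ideal E J ->
  fractional_ideal E (ideal_mul I J).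
Proof.
move=> fI fJ; have [I0 ID IM] := im_emodule J (fractional_emodule fI).
case: fI => IE [x xI x0] _ _ [d [dE d0 dI]].
case: fJ => JE [y yI y0] _ _ [e [eE e0 eI]]; split=> //.
- apply: im_ind => /=; [mem|by move=> *; mem|] => a b /IE /= aE /JE /= bE; mem.
- by exists (x * y); [exact: im_mem|rewrite mulf_neq0].
exists (d * e); split; [exact: OOM|by rewrite mulf_neq0|].
apply: im_ind => /=; [by rewrite mulr0; exact: OO0|by move=> a b ? ?; rewrite mulrDr; apply: OOD|].
move=> a b /dI aE /eI bE; have -> : d * e * (a * b) = (d * a) * (e * b) by ring.
exact: OOM.
Qed.

Lemma fractional_O E : fractional_ideal E (OO E).
Proof.
have [O0 OD OM] := emodule_O E; split=> //.
- by move=> x [].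
- by exists 1; [exact: OO1|rewrite oner_eq0].
- by exists 1; split; [exact: OO1|rewrite oner_eq0|move=> x; rewrite mul1r].
Qed.

Lemma principalE E x : principal_ideal E x = iscale x (OO E).
Proof. by []. Qed.

Lemma im_principal E x I : emodule E I ->
  ideal_mul (principal_ideal E x) I = iscale x I.
Proof. by move=> mI; rewrite principalE iscale_im imC im_O. Qed.

Lemma principalM E x y : ideal_mul (principal_ideal E x) (principal_ideal E y) =
  principal_ideal E (x * y).
Proof.
rewrite im_principal ?principalE ?iscaleM //.
exact/iscale_emodule/emodule_O.
Qed.

Lemma fractional_principal E x : x \in E -> x != 0 ->
  fractional_ideal E (principal_ideal E x).
Proof. by move=> xE x0; apply: iscale_fractional => //; exact: fractional_O. Qed.

Lemma principal_id E x : principal_ideal E x x.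
Proof. by exists 1; [exact: OO1|rewrite mulr1]. Qed.

Lemma principalP E x y : x != 0 -> principal_ideal E x y <-> OO E (x^-1 * y).
Proof. exact: iscaleP. Qed.

Lemma principal_eqP E x y : x != 0 -> x \in E -> y \in E ->
  principal_ideal E x = principal_ideal E y <-> iunit (y / x).
Proof.
move=> x0 xE yE; split.
  move=> e; have := principal_id E y; rewrite -e => /(principalP _ _ x0)[_ i1].
  have y0 : y != 0.
    apply: contra_neq x0 => y0; have := principal_id E x.
    by rewrite e y0 => -[b _ <-]; rewrite mul0r.
  have := principal_id E x; rewrite e => /(principalP _ _ y0)[_ i2].
  by split; [rewrite mulf_neq0 ?invr_eq0|rewrite mulrC|rewrite invfM invrK].
case=> yx0 i1 i2; have y0 : y != 0 by apply: contra_neq yx0 => ->; rewrite mul0r.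
apply/seteqP; split=> z /iscaleP zE; apply/iscaleP => //.
  have -> : y^-1 * z = (y / x)^-1 * (x^-1 * z) by field; rewrite ?x0 ?y0.
  by apply: OOM; [split; [mem|]|apply: zE].
have -> : x^-1 * z = (y / x) * (y^-1 * z) by field; rewrite ?x0 ?y0.
by apply: OOM; [split; [mem|]|apply: zE].
Qed.

Lemma ext_emodule K I : emodule K (ideal_ext K I).
Proof. by rewrite /ideal_ext imC; apply/im_emodule/emodule_O. Qed.

Lemma im_OO E : ideal_mul (OO E) (OO E) = OO E.
Proof. exact/im_O/emodule_O. Qed.

Lemma ext_mul K I J : ideal_ext K (ideal_mul I J) = ideal_mul (ideal_ext K I) (ideal_ext K J).
Proof. by rewrite /ideal_ext imACA im_OO. Qed.

Lemma ext_sub K I : I `<=` ideal_ext K I.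
Proof. by move=> x xI; rewrite -(mulr1 x); apply: im_mem => //; exact: OO1. Qed.

Lemma extO k K : (k <= K)%VS -> ideal_ext K (OO k) = OO K.
Proof.
move=> kK; apply/seteqP; split.
  by apply: im_ind; [exact: OO0|exact: OOD|move=> a b /(OOS kK) aK bK; apply: OOM].
by move=> x xK; rewrite -(mul1r x); apply: im_mem => //; exact: OO1.
Qed.

Lemma ext_scale K x I : ideal_ext K (iscale x I) = iscale x (ideal_ext K I).
Proof. exact: iscale_im. Qed.

Lemma ext_principal k K x : (k <= K)%VS ->
  ideal_ext K (principal_ideal k x) = principal_ideal K x.
Proof. by move=> kK; rewrite !principalE ext_scale extO. Qed.

Lemma ideal_classE E I : emodule E I ->
  ideal_class E I = [set iscale x I | x in [set x | x \in E /\ x != 0]].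
Proof.
by move=> mI; apply/seteqP; split=> J [x xE <-]; exists x => //; rewrite im_principal.
Qed.

Lemma class_self E I : emodule E I -> ideal_class E I I.
Proof.
move=> mI; rewrite ideal_classE //; exists 1; last exact: iscale1.
by split; [exact: rpred1|rewrite oner_eq0].
Qed.

Lemma class_scale E I x : emodule E I -> x \in E -> x != 0 ->
  ideal_class E (iscale x I) = ideal_class E I.
Proof.
move=> mI xE x0; rewrite !ideal_classE //; last exact: iscale_emodule.
apply/seteqP; split=> J [y [yE y0] <-].
  by rewrite iscaleM; exists (y * x) => //; split; [mem|rewrite mulf_neq0].
exists (y / x); first by split; [mem|rewrite mulf_neq0 ?invr_eq0].
by rewrite iscaleM divfK.
Qed.

Lemma class_memP E I J : emodule E I -> ideal_class E I J ->
  exists x, [/\ x \in E, x != 0 & J = iscale x I].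
Proof. by move=> mI; rewrite ideal_classE // => -[x [xE x0] <-]; exists x. Qed.

Lemma class_mem_eq E I J : emodule E I -> ideal_class E I J ->
  ideal_class E J = ideal_class E I.
Proof. by move=> mI /(class_memP mI)[x [xE x0 ->]]; apply: class_scale. Qed.

Lemma ideal_class_eqP E I J : emodule E I -> emodule E J ->
  ideal_class E I = ideal_class E J <-> exists x, [/\ x \in E, x != 0 & J = iscale x I].
Proof.
move=> mI mJ; split; last by move=> [x [xE x0 ->]]; rewrite class_scale.
by move=> e; apply: class_memP => //; rewrite e; apply: class_self.
Qed.

Lemma class_mulE E I J : emodule E I -> emodule E J ->
  class_mul (ideal_class E I) (ideal_class E J) = ideal_class E (ideal_mul I J).
Proof.
move=> mI mJ; have mIJ := im_emodule J mI.
apply/seteqP; split=> M.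
  move=> [A /(class_memP mI)[x [xE x0 ->]]] [B /(class_memP mJ)[y [yE y0 ->]] <-].
  rewrite iscale_im iscale_imr iscaleM ideal_classE //.
  by exists (x * y) => //; split; [mem|rewrite mulf_neq0].
move=> /(class_memP mIJ)[x [xE x0 ->]]; rewrite -iscale_im.
exists (iscale x I); first by rewrite ideal_classE //; exists x.
by exists J => //; apply: class_self.
Qed.

Lemma class_extE k K I : (k <= K)%VS -> emodule k I ->
  class_ext K (ideal_class k I) = ideal_class K (ideal_ext K I).
Proof.
move=> kK mI; apply/seteqP; split=> J.
  move=> [A /(class_memP mI)[x [xE x0 ->]]]; rewrite ext_scale class_scale //.
    exact: ext_emodule.
  exact: (subvP kK).
by move=> h; exists I => //; apply: class_self.
Qed.

Lemma class_oneP K I : emodule K I ->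
  ideal_class K I = class_one K <->
  exists x, [/\ x \in K, x != 0 & I = principal_ideal K x].
Proof.
move=> mI; have mO := emodule_O K.
by split=> [/esym/(ideal_class_eqP mO mI)|/(ideal_class_eqP mO mI)/esym].
Qed.

Lemma capitulationP k K I : (k <= K)%VS -> fractional_ideal k I ->
  capitulation_kernel k K (ideal_class k I) <->
  exists x, [/\ x \in K, x != 0 & ideal_ext K I = principal_ideal K x].
Proof.
move=> kK fI; rewrite /capitulation_kernel /= class_extE //; last exact: fractional_emodule.
split; first by case=> _ /class_oneP; apply; apply: ext_emodule.
by move=> h; split; [exists I|apply/class_oneP => //; apply: ext_emodule].
Qed.

End IdealArithmetic.

(** * Ideals in quadratic extensions *)

Section QuadraticIdeals.
Variable L : splittingFieldType rat.
Implicit Types (E F K k : {subfield L}) (g h : 'AEnd(L)) (x y z u w a b : L).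
Implicit Types (I J M N P : set L).
Local Notation OO := ring_of_integers.

(** The form in which the Dedekind property is used: it holds for Z[i] by division with remainder
    and passes up quadratic steps. *)
Definition invertible_ideals E := forall I, fractional_ideal E I ->
  exists J, fractional_ideal E J /\ ideal_mul I J = OO E.

(** Stands for the generator of Gal(F/E), taken as an automorphism of the ambient field whose
    restriction to [F] is an involution with fixed field [E]. *)
Definition quad_inv E F g := [/\ (E <= F)%VS, forall x, x \in F -> g x \in F,
  forall x, x \in E -> g x = x, forall x, x \in F -> g (g x) = x
  & forall x, x \in F -> g x = x -> x \in E].

Lemma img_im g I J : [set g x | x in ideal_mul I J] =
  ideal_mul [set g x | x in I] [set g x | x in J].
Proof.
apply/seteqP; split.
  move=> _ [x + <-]; move: x; apply: im_ind => /=.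
  - by rewrite rmorph0; exact: im0.
  - by move=> x y hx hy; rewrite rmorphD; apply: imD.
  - by move=> a b aI bJ; rewrite rmorphM; apply: im_mem; [exists a|exists b].
apply: im_ind.
- by exists 0; [exact: im0|rewrite rmorph0].
- by move=> _ _ [x hx <-] [y hy <-]; exists (x + y); [exact: imD|rewrite rmorphD].
- by move=> _ _ [a aI <-] [b bJ <-]; exists (a * b); [exact: im_mem|rewrite rmorphM].
Qed.

Lemma img_scale g x I : [set g y | y in iscale x I] = iscale (g x) [set g y | y in I].
Proof.
apply/seteqP; split.
  by move=> _ [_ [y yI <-] <-]; rewrite rmorphM; exists (g y) => //; exists y.
move=> _ [_ [y yI <-] <-]; exists (x * y); last by rewrite rmorphM.
by exists y.
Qed.

Lemma img_O F g : (forall x, x \in F -> g x \in F) -> (forall x, x \in F -> g (g x) = x) ->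
  [set g x | x in OO F] = OO F.
Proof.
move=> gF gg; apply/seteqP; split; first by move=> _ [x [xF xi] <-]; split; [exact: gF|isi].
by move=> x [xF xi]; exists (g x); [split; [exact: gF|isi]|exact: gg].
Qed.

(** For [x] in [E] and in [I O_F], the products of [x] with [J] are integral and lie in [E], hence
    in [O_E]; so [x] lies in [x I J], which is contained in [I]. *)
Lemma contraction E F I J x : (E <= F)%VS -> emodule E I -> ideal_mul I J = OO E ->
  J `<=` [set x | x \in E] -> x \in E -> ideal_ext F I x -> I x.
Proof.
move=> EF [I0 ID IM] IJ JE xE xI.
have xJ y : J y -> OO E (y * x).
  move=> yJ; split; first by have := JE _ yJ; rewrite /= => ?; mem.
  suff [] : OO F (y * x) by [].
  move: x xI {xE}; apply: im_ind => /=.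
  - by rewrite mulr0; exact: OO0.
  - by move=> a b ? ?; rewrite mulrDr; apply: OOD.
  - move=> a b aI bF; rewrite mulrA; apply: OOM => //; apply: (OOS EF).
    by rewrite -IJ mulrC; apply: im_mem.
have : ideal_mul I J 1 by rewrite IJ; exact: OO1.
suff H : ideal_mul I J `<=` [set z | I (z * x)] by move/H => /=; rewrite mul1r.
apply: im_ind => /=; first by rewrite mul0r.
  by move=> a b ? ?; rewrite mulrDl; apply: ID.
by move=> a b aI bJ; rewrite -mulrA mulrC; apply: IM => //; apply: xJ.
Qed.

Lemma im_cancel E I J M N : emodule E M -> emodule E N -> ideal_mul I J = OO E ->
  ideal_mul I M `<=` ideal_mul I N -> M `<=` N.
Proof.
move=> mM mN IJ H; rewrite -(im_O mM) -(im_O mN) -IJ !(imC M) !(imC N).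
by rewrite (imC I) -!imA; apply: imS.
Qed.

Section Step.
Variables (E F : {subfield L}) (g : 'AEnd(L)).
Hypothesis qg : quad_inv E F g.

Let EF : (E <= F)%VS. Proof. by case: qg. Qed.
Let gF x : x \in F -> g x \in F. Proof. by case: qg => _ H *; apply: H. Qed.
Let gE x : x \in E -> g x = x. Proof. by case: qg => _ _ H *; apply: H. Qed.
Let gg x : x \in F -> g (g x) = x. Proof. by case: qg => _ _ _ H *; apply: H. Qed.
Let gfix x : x \in F -> g x = x -> x \in E. Proof. by case: qg => _ _ _ _ H *; apply: H. Qed.

Lemma quad_trace x : x \in F -> x + g x \in E.
Proof.
move=> xF; apply: gfix; first by have := gF xF => ?; mem.
by rewrite rmorphD /= gg // addrC.
Qed.

Lemma quad_norm x : x \in F -> x * g x \in E.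
Proof.
move=> xF; apply: gfix; first by have := gF xF => ?; mem.
by rewrite rmorphM /= gg // mulrC.
Qed.

Lemma img_emodule I : emodule F I -> emodule F [set g x | x in I].
Proof.
move=> [I0 ID IM]; split.
- by exists 0; rewrite ?rmorph0.
- by move=> _ _ [x xI <-] [y yI <-]; exists (x + y); [exact: ID|rewrite rmorphD].
- move=> a _ [aF ai] [y yI <-]; exists (g a * y); last by rewrite rmorphM /= gg.
  by apply: IM => //; split; [exact: gF|isi].
Qed.

Lemma img_fractional I : fractional_ideal F I -> fractional_ideal F [set g x | x in I].
Proof.
move=> fI; have [I0 ID IM] := img_emodule (fractional_emodule fI).
case: fI => IF [y yI y0] _ _ [d [[dF di] d0 dI]]; split=> //.
- by move=> _ [x /IF xF <-]; apply: gF.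
- by exists (g y); [exists y|rewrite fmorph_eq0].
exists (g d); split; [by split; [exact: gF|isi]|by rewrite fmorph_eq0|].
move=> _ [x /dI [dx di'] <-]; rewrite -rmorphM; split; [exact: gF|exact: isint_aut].
Qed.

(** The relative norm, obtained by intersecting with [E]; that it generates the product of [I] and
    its conjugate over [O_F] is the content of [norm_idealE]. *)
Definition norm_ideal I : set L := ideal_mul I [set g x | x in I] `&` [set x | x \in E].

Lemma norm_ideal_fractional I : fractional_ideal F I -> fractional_ideal E (norm_ideal I).
Proof.
move=> fI; have fg := img_fractional fI; have fII := im_fractional fI fg.
have mII := fractional_emodule fII.
have [IF _ _ _ _] := fI; case: fI => _ [y yI y0] _ _ [d [[dF di] d0 dI]].
have [_ ID IM] := mII; split.
- by move=> x [].
- exists (y * g y); last by rewrite mulf_neq0 ?fmorph_eq0.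
  by split; [apply: im_mem => //; exists y|apply: quad_norm; exact: IF].
- by move=> x z [x1 x2] [z1 z2]; split; [exact: ID|rewrite /= in x2 z2 *; mem].
- move=> a x aE [x1 x2]; split; first by apply: IM => //; exact: OOS aE.
  by case: aE => aE _; rewrite /= in x2 *; mem.
exists (d * g d); split.
- by split; [exact: quad_norm|isi].
- by rewrite mulf_neq0 ?fmorph_eq0.
move=> x [xI xE]; rewrite /= in xE; split; first by have := quad_norm dF => ?; mem.
suff [] : OO F (d * g d * x) by [].
move: x xI {xE}; apply: im_ind => /=.
- by rewrite mulr0; exact: OO0.
- by move=> a b ? ?; rewrite mulrDr; apply: OOD.
- move=> a _ /dI aF [b /dI [bF bi] <-].
  have -> : d * g d * (a * g b) = (d * a) * g (d * b) by rewrite rmorphM /=; ring.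
  by apply: OOM => //; split; [exact: gF|isi].
Qed.

(* For a in I and b in gI and y in the inverse of the norm ideal, y a b is a
   root of a monic quadratic polynomial over the integers of E. *)
Lemma norm_idealE I : invertible_ideals E -> fractional_ideal F I ->
  ideal_mul I [set g x | x in I] = ideal_ext F (norm_ideal I).
Proof.
move=> invE fI; have fn := norm_ideal_fractional fI.
have [J [fJ nJ]] := invE _ fn.
have fII := im_fractional fI (img_fractional fI).
have mII := fractional_emodule fII; have [_ IID IIM] := mII.
apply/seteqP; split; last first.
  apply: im_ind; [exact: im0|exact: IID|].
  by move=> a b [aI _] bF; rewrite mulrC; apply: IIM.
have [IF _ _ _ _] := fI; have [JE _ _ _ _] := fJ.
have key a b y : I a -> I b -> J y -> OO F (y * (a * g b)).
  move=> aI bI yJ.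
  have aF : a \in F := IF _ aI; have bF : b \in F := IF _ bI.
  have yE : y \in E := JE _ yJ; have yF : y \in F := subvP EF _ yE.
  have gaF := gF aF; have gbF := gF bF.
  split; first by mem.
  have t1 : OO E (y * (a * g b + g (a * g b))).
    rewrite -nJ imC; apply: im_mem => //; split; last by apply: quad_trace; mem.
    apply: imD; first by apply: im_mem => //; exists b.
    by rewrite rmorphM /= gg // mulrC; apply: im_mem => //; exists a.
  have n1 c : I c -> OO E (y * (c * g c)).
    move=> cI; rewrite -nJ imC; apply: im_mem => //; split.
      by apply: im_mem => //; exists c.
    by apply: quad_norm; exact: IF.
  apply: (isint_quad (t := y * (a * g b + g (a * g b))) (n := (y * (a * g a)) * (y * (b * g b)))).
  - by case: t1.
  - by apply: isintM; [case: (n1 a aI)|case: (n1 b bI)].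
  - by rewrite rmorphM /= gg //; ring.
apply: im_ind; [exact: im0|exact: imD|] => a _ aI [b bI <-].
have : ideal_mul (norm_ideal I) J 1 by rewrite nJ; exact: OO1.
suff H : ideal_mul (norm_ideal I) J `<=` [set z | ideal_ext F (norm_ideal I) (z * (a * g b))].
  by move/H => /=; rewrite mul1r.
apply: im_ind => /=; first by rewrite mul0r; exact: im0.
  by move=> x z ? ?; rewrite mulrDl; apply: imD.
by move=> x y xn yJ; rewrite -mulrA; apply: im_mem => //; apply: key.
Qed.

(** The inverse of [I] is its conjugate times the extended inverse of its norm. *)
Lemma invertible_step : invertible_ideals E -> invertible_ideals F.
Proof.
move=> invE I fI; have fn := norm_ideal_fractional fI.
have [J [fJ nJ]] := invE _ fn.
have fg := img_fractional fI.
exists (ideal_mul [set g x | x in I] (ideal_ext F J)); split; last first.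
  by rewrite imA norm_idealE // -ext_mul nJ extO.
apply: im_fractional => //.
case: fJ => JE [y yJ y0] JD JM [d [dE d0 dJ]].
have [_ eD eM] := ext_emodule F J; split=> //.
- apply: im_ind => /=; [mem|by move=> *; mem|].
  by move=> a b /JE /= /(subvP EF) aF [bF _]; mem.
- by exists y => //; apply: ext_sub.
exists d; split=> //; first exact: OOS dE.
apply: im_ind => /=; [by rewrite mulr0; exact: OO0|by move=> a b ? ?; rewrite mulrDr; apply: OOD|].
by move=> a b /dJ /(OOS EF) aF bF; rewrite mulrA; apply: OOM.
Qed.

End Step.

Lemma quad_inv_adjoin E g y : y ^+ 2 \in E -> (forall x, x \in E -> g x = x) ->
  g y = - y -> quad_inv E <<E; y>>%AS g.
Proof.
move=> yy gE gy; split=> //.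
- exact: subv_adjoin.
- by apply: aut_adjoin => //; [move=> x xE; rewrite gE|right].
- move=> x /(quad_coord yy)[a [b [aE bE ->]]].
  rewrite rmorphD rmorphM /= gy (gE a) // (gE b) // rmorphD rmorphM rmorphN /= gy.
  by rewrite (gE a) // (gE b) // opprK.
- exact: quad_fixed.
Qed.

Definition proper_ideal E P := [/\ emodule E P, P `<=` OO E & ~ P 1].

Definition maximal_ideal E P := proper_ideal E P /\
  forall x, OO E x -> ~ P x -> exists y, OO E y /\ P (x * y - 1).

Lemma exists_maximal E I : proper_ideal E I ->
  exists P, maximal_ideal E P /\ I `<=` P.
Proof.
move=> [[I0 ID IM] IO I1].
(* Taking the union with [I] makes the empty chain admissible: its union is empty and yields [I]
   itself. *)
have [|A [pA Amax]] := @Zorn_bigcup L [set A | proper_ideal E (A `|` I)].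
  move=> F FP Ftot /=.
  have H x : (\bigcup_(X in F) X `|` I) x -> I x \/ exists2 X, F X & (X `|` I) x.
    by case=> [[X FX Xx]|]; [right; exists X => //; left|left].
  have H2 X x : F X -> (X `|` I) x -> (\bigcup_(X in F) X `|` I) x.
    by move=> FX [Xx|]; [left; exists X|right].
  split.
  - split; first by right.
      move=> x y /H[xI|[X FX Xx]] /H[yI|[Y FY Yy]].
      + by right; apply: ID.
      + have [[_ D _] _ _] := FP _ FY; apply: (H2 Y) => //; apply: D => //; by right.
      + have [[_ D _] _ _] := FP _ FX; apply: (H2 X) => //; apply: D => //; by right.
      + have [XY|YX] := Ftot _ _ FX FY.
          have [[_ D _] _ _] := FP _ FY; apply: (H2 Y) => //; apply: D => //.
          by case: Xx => [/XY|]; [left|right].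
        have [[_ D _] _ _] := FP _ FX; apply: (H2 X) => //; apply: D => //.
        by case: Yy => [/YX|]; [left|right].
    move=> a x aO /H[xI|[X FX Xx]]; first by right; apply: IM.
    by have [[_ _ M] _ _] := FP _ FX; apply: (H2 X) => //; apply: M.
  - by move=> x /H[/IO//|[X FX]]; have [_ XO _] := FP _ FX; apply: XO.
  - by move=> /H[//|[X FX]]; have [_ _ X1] := FP _ FX.
set P := A `|` I in pA; exists P; split; last by right.
split=> // x xO Px; have [[P0 PD PM] PO P1] := pA.
pose B : set L := [set z | exists2 p, P p & exists2 b, OO E b & z = p + x * b].
have PB : P `<=` B by move=> p Pp; exists p => //; exists 0; [exact: OO0|rewrite mulr0 addr0].
have Bx : B x by exists 0 => //; exists 1; [exact: OO1|rewrite mulr1 add0r].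
have [[p Pp [b bO e]]|B1] := pselect (B 1).
  exists b; split=> //; have -> : x * b - 1 = - p by rewrite e; ring.
  exact: (emoduleN (And3 P0 PD PM)).
exfalso; apply: (Amax B).
  split; first by move=> z Az; apply: PB; left.
  by move=> /(_ _ Bx) Ax; apply: Px; left.
rewrite /=; have -> : B `|` I = B by apply/setUidPl => z Iz; apply: PB; right.
split=> //; first split; first exact: PB.
- move=> _ _ [p Pp [b bO ->]] [r Pr [c cO ->]]; exists (p + r); first exact: PD.
  by exists (b + c); [exact: OOD|ring].
- move=> a _ aO [p Pp [b bO ->]]; exists (a * p); first exact: PM.
  by exists (a * b); [exact: OOM|ring].
- move=> _ [p Pp [b bO ->]]; apply: OOD; [exact: PO|exact: OOM].
Qed.

Lemma proper_fractional E P x : proper_ideal E P -> P x -> x != 0 -> fractional_ideal E P.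
Proof.
move=> [[P0 PD PM] PO P1] Px x0; split=> //.
- by move=> y /PO[].
- by exists x.
- by exists 1; split; [exact: OO1|rewrite oner_eq0|move=> y /PO; rewrite mul1r].
Qed.

Lemma maximal_prime E P x : maximal_ideal E P -> P x -> x != 0 -> prime_ideal E P.
Proof.
move=> [pP mP] Px x0; have fP := proper_fractional pP Px x0.
have [[P0 PD PM] PO P1] := pP; split=> // a b aO bO Pab.
have [Pa|Pa] := pselect (P a); [by left|right].
have [y [yO Py]] := mP _ aO Pa.
have -> : b = y * (a * b) + (- b) * (a * y - 1) by ring.
by apply: PD; apply: PM => //; apply: OON.
Qed.

Lemma exists_prime E x : OO E x -> x != 0 -> ~ iunit x ->
  exists P, prime_ideal E P /\ P x.
Proof.
move=> xO x0 xu; have pI : proper_ideal E (principal_ideal E x).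
  split; first exact/iscale_emodule/emodule_O.
    by move=> _ [y yO <-]; apply: OOM.
  move=> /(principalP _ _ x0); rewrite mulr1 => -[_ i]; apply: xu.
  by split=> //; case: xO.
have [P [mP IP]] := exists_maximal pI.
have Px : P x by apply: IP; exact: principal_id.
by exists P; split=> //; apply: maximal_prime x0.
Qed.

Lemma prime_proper E P : prime_ideal E P -> proper_ideal E P.
Proof. by case=> /fractional_emodule. Qed.

(** Let [M] be a maximal ideal containing [P] and [m] in [M] outside [P]. The ideal [P J], with [J]
    the inverse of [M], is integral and [m P J] lies in [P], so [P J] lies in [P] by primality;
    cancelling [P] gives 1 in [M]. *)
Lemma prime_maximal E P : invertible_ideals E -> prime_ideal E P -> maximal_ideal E P.
Proof.
move=> invE prP; have pP := prime_proper prP; split=> // x xO Px.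
have [M [[pM mM] PM]] := exists_maximal pP.
have [fP PO P1 Pprime] := prP; have [_ [p0 Pp0 p00] _ _ _] := fP.
have [mP _ _] := pP; have [mMo MO M1] := pM.
have fM := proper_fractional pM (PM _ Pp0) p00.
have [J [fJ MJ]] := invE _ fM; have [J' [fJ' PJ']] := invE _ fP.
suff MP : M `<=` P.
  have [|y [yO My]] := mM x xO; first by move=> /MP.
  by exists y; split=> //; apply: MP.
move=> m Mm; apply: contrapT => Pm; apply: M1.
have CO : ideal_mul P J `<=` OO E by rewrite -MJ; apply: imS.
have CP : ideal_mul P J `<=` P.
  move=> c Cc; have Oc := CO _ Cc; have Pmc : P (m * c).
    by rewrite -(im_O mP) -MJ imA imAC mulrC; apply: im_mem.
  by case: (Pprime _ _ (MO _ Mm) Oc Pmc).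
suff : OO E `<=` M by apply; exact: OO1.
apply: (im_cancel (emodule_O E) mMo PJ'); rewrite im_O // -{1}(im_O mP) -MJ (imC M) imA.
exact: imS.
Qed.

Section Ramification.
Variables (k K : {subfield L}) (g : 'AEnd(L)) (P : set L).
Hypotheses (qg : quad_inv k K g) (invk : invertible_ideals k) (prP : prime_ideal K P).

Let kK : (k <= K)%VS. Proof. by case: qg. Qed.
Let gK x : x \in K -> g x \in K. Proof. by case: qg => _ H *; apply: H. Qed.
Let gO x : OO K x -> OO K (g x).
Proof. by move=> [xK xi]; split; [exact: gK|isi]. Qed.
Let pK := ideal_ext K (P `&` OO k).
Let invK : invertible_ideals K. Proof. exact: invertible_step qg invk. Qed.
Let mP : emodule K P. Proof. by have [] := prime_proper prP. Qed.
Let PO : P `<=` OO K. Proof. by have [] := prime_proper prP. Qed.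
Let P1 : ~ P 1. Proof. by have [] := prime_proper prP. Qed.
Let PB x y : P x -> P y -> P (x - y).
Proof. by have [_ D _] := mP => Px Py; apply: D => //; apply: emoduleN mP _. Qed.

Lemma pK_sub : pK `<=` P.
Proof.
have [P0 PD PM] := mP; apply: im_ind => //.
by move=> a b [Pa _] bO; rewrite mulrC; apply: PM.
Qed.

Lemma exp2E : ideal_exp K P 2 = ideal_mul P P.
Proof. by rewrite /ideal_exp /= im_O. Qed.

(** Suppose [pK] lies in the square of [P]. If [x] and [g x] are in [P], the traces of [x] and [t x]
    are in [P :&: O_k], and [(t - g t) x] is a combination of them, hence in the square of [P]; as
    [t - g t] is invertible modulo [P], so is [x] in that square. Applied to products [a * g b] this
    gives [g P] inside [P], and then [P] inside its own square, which is absurd. *)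
Lemma unramified_different t : OO K t -> ~ P (t - g t) -> ramification_index k K P 1.
Proof.
move=> tO nP; rewrite /ramification_index; split.
  by rewrite /ideal_exp /= im_O //; exact: pK_sub.
rewrite exp2E -/pK => pK2.
have [_ mxP] := prime_maximal invK prP; have [P0 PD PM] := mP.
have [_ _ kfix gg gfix] := qg.
have [J [fJ PJ]] := invK (let: And4 f _ _ _ := prP in f).
have [mPP0 PPD PPM] := im_emodule P mP.
have [y [yO Py]] := mxP _ (OOD tO (OON (gO tO))) nP.
have tr x : P x -> P (g x) -> (P `&` OO k) (x + g x).
  move=> Px Pgx; split; first exact: PD.
  have [xK xi] := PO Px; split; first exact: (quad_trace qg).
  by isi.
have sub x : P x -> P (g x) -> ideal_mul P P x.
  move=> Px Pgx; have xO := PO Px.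
  have T0 := tr _ Px Pgx; have T1 : (P `&` OO k) (t * x + g (t * x)).
    by apply: tr; [apply: PM|rewrite rmorphM; apply: PM => //; apply: gO].
  have h : ideal_mul P P ((t - g t) * x).
    apply: pK2; have -> : (t - g t) * x = (t * x + g (t * x)) * 1 + (x + g x) * (- g t).
      by rewrite rmorphM /=; ring.
    by apply: imD; apply: im_mem => //; [exact: OO1|apply/OON/gO].
  have -> : x = y * ((t - g t) * x) + (- ((t - g t) * y - 1)) * x by ring.
  by apply: PPD; [apply: PPM|apply: im_mem => //; exact: emoduleN mP _].
have [mgP gPD gPM] := img_emodule qg mP.
have gP : [set g x | x in P] `<=` P.
  apply: (im_cancel _ mP PJ) => //.
  apply: im_ind => // a _ Pa [b Pb <-]; have bO := PO Pb; have aO := PO Pa.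
  apply: sub; first by rewrite mulrC; apply: PM => //; apply: gO.
  rewrite rmorphM /= gg; last by case: bO.
  by apply: PM => //; apply: gO.
apply: P1; suff : OO K `<=` P by apply; exact: OO1.
apply: (im_cancel (emodule_O K) mP PJ); rewrite im_O // => x Px.
by apply: sub => //; apply: gP; exists x.
Qed.

(* If K/k were unramified at P, then P would be generated by P :&: O_k, so that
   every w - g w would be divisible by P :&: O_k again and again. *)
Lemma ramified_inertia x : x \in K -> x != 0 -> g x = - x ->
  (forall w, OO K w -> P (w - g w)) ->
  (forall w, OO K w -> exists2 c, OO k c & P (w - c)) ->
  pK `<=` ideal_exp K P 2.
Proof.
move=> xK x0 gx Pin Pres; rewrite exp2E; apply: contrapT => npK.
have [_ mxP] := prime_maximal invK prP; have [P0 PD PM] := mP.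
have [_ _ kfix gg gfix] := qg.
have [fP _ _ Pprime] := prP.
have [J [fJ PJ]] := invK fP.
set M := ideal_mul pK J.
have mpK : emodule K pK := ext_emodule K _.
have mM : emodule K M := im_emodule J mpK.
have MO : M `<=` OO K by rewrite -PJ; apply: imS => //; exact: pK_sub.
have PM_E : ideal_mul P M = pK by rewrite /M imA imAC PJ imC im_O.
(* [M] is [pK] divided by [P], not inside [P] because [pK] is not inside the square of [P]. The norm
   [n] of such an [m] lies in [k] and is congruent to [m ^+ 2], so it is invertible modulo [P]. With
   an inverse [c] from [O_k], [n c - 1] lies in [P :&: O_k], and [P] is contained in [pK]. *)
have [m Mm nPm] : exists2 m, M m & ~ P m.
  apply: contrapT => H; apply: npK; rewrite -PM_E; apply: imS => // m Mm.
  by apply: contrapT => nPm; apply: H; exists m.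
have mO := MO _ Mm; have gmO := gO mO.
set n := m * g m.
have nP : ~ P n.
  move=> /(Pprime _ _ mO gmO)[//|Pgm]; apply: nPm.
  by rewrite -(subrK (g m) m); apply: PD => //; apply: Pin.
have nk : OO k n.
  by split; [apply: (quad_norm qg); case: mO|apply: isintM; [case: mO|case: gmO]].
have nM : M n by rewrite /n mulrC; have [_ _] := mM; apply.
have [y [yO Py]] := mxP _ (OOS kK nk) nP.
have [c ck Pyc] := Pres _ yO.
have nc : (P `&` OO k) (n * c - 1).
  split; last by apply: OOD; [exact: OOM|apply/OON/OO1].
  have -> : n * c - 1 = (n * y - 1) - n * (y - c) by ring.
  by apply: PB => //; apply: PM => //; exact: OOS nk.
have PpK : P `<=` pK.
  move=> z Pz; have [pK0 pKD pKM] := mpK.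
  have -> : z = c * (z * n) + (n * c - 1) * (- z) by ring.
  apply: pKD; last by apply: im_mem => //; apply/OON/PO.
  by apply: pKM; [exact: OOS ck|rewrite -PM_E; apply: im_mem].
(* [C] collects the coordinates along [x] of the differences [w - g w]. Each [w] is an element of
   [O_k] plus one of [pK], so [C] is contained in [C] times [P :&: O_k]; cancelling the invertible
   [C] puts 1 in [P]. *)
pose C : set L := [set c | exists2 w, OO K w & c * x = w - g w].
have Ck d : C d -> d \in k.
  move=> [w [wK _] e]; have -> : d = (w - g w) / x by rewrite -e mulfK.
  have gwK := gK wK; apply: gfix; first by mem.
  by rewrite fmorph_div rmorphB /= gx gg // invrN; ring.
have fC : fractional_ideal k C.
  split.
  - by move=> d /Ck.
  - have [r [r0 ri]] := isint_denom x; exists (2%:R * r%:~R).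
      by exists (r%:~R * x); [split; [mem|]|rewrite rmorphM rmorph_int /= gx; ring].
    by rewrite mulf_neq0 ?two_neq0 ?intL_eq0.
  - move=> d e [w wO we] [v vO ve]; exists (w + v); first exact: OOD.
    by rewrite rmorphD mulrDl we ve /=; ring.
  - move=> a d [ak ai] [w wO we]; exists (a * w); first exact: OOM (OOS kK (conj ak ai)) wO.
    by rewrite rmorphM /= kfix // -mulrA we; ring.
  - have [r [r0 ri]] := isint_denom x^-1; exists r%:~R; split.
    + by split; [mem|isi].
    + by rewrite intL_eq0.
    move=> d Cd; split; first by have := Ck _ Cd => ?; mem.
    case: Cd => w [wK wi] we; have -> : r%:~R * d = (r%:~R * x^-1) * (w - g w).
      by rewrite -we; field.
    by apply: isintM => //; isi.
have [J' [fJ' CJ']] := invk fC.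
have mC := fractional_emodule fC.
have mp : emodule k (P `&` OO k).
  split; first by split; [exact: P0|exact: OO0].
    by move=> a b [? ?] [? ?]; split; [exact: PD|exact: OOD].
  move=> a b ak [Pb bk]; split; last exact: OOM.
  by apply: PM => //; exact: OOS ak.
apply: P1; suff: OO k `<=` P `&` OO k by move/(_ _ (OO1 k)) => [].
apply: (im_cancel (emodule_O k) mp CJ'); rewrite im_O // => d [w wO we].
have [e ek Pwe] := Pres _ wO.
have : pK (w - e) by apply: PpK.
suff H : pK `<=` [set z | exists2 b, ideal_mul C (P `&` OO k) b & b * x = z - g z].
  move=> /H [b bC be]; suff -> : d = b by [].
  apply: (mulIf x0); rewrite we be rmorphB /= (kfix e); last by case: ek.
  by ring.
apply: im_ind => /=.
- by exists 0; [exact: im0|rewrite rmorph0 mul0r subrr].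
- move=> a b [a' ? ae] [b' ? be]; exists (a' + b'); first exact: imD.
  by rewrite mulrDl ae be rmorphD /=; ring.
move=> a b [Pa ak] bO.
exists ((b - g b) / x * a).
  apply: im_mem => //; exists b => //; first by rewrite divfK.
rewrite rmorphM /= (kfix a); last by case: ak.
by field.
Qed.

End Ramification.

(** [Am_s] is a generated subgroup, so its inclusion in a kernel may be tested on strongly ambiguous
    classes once the kernel is a subgroup. *)
Lemma capitulation_subgroup k K : (k <= K)%VS -> class_subgroup k (capitulation_kernel k K).
Proof.
move=> kK; split.
- by move=> c [].
- apply/capitulationP => //; first exact: fractional_O.
  exists 1; split; [exact: rpred1|by rewrite oner_eq0|].
  by rewrite extO // principalE iscale1.
- move=> c d [[I fI <-] cI] [[J fJ <-] cJ].
  have mI := fractional_emodule fI; have mJ := fractional_emodule fJ.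
  rewrite class_mulE //; apply/capitulationP => //; first exact: im_fractional.
  have /(capitulationP kK fI)[x [xK x0 xE]] : capitulation_kernel k K (ideal_class k I).
    by split=> //; exists I.
  have /(capitulationP kK fJ)[y [yK y0 yE]] : capitulation_kernel k K (ideal_class k J).
    by split=> //; exists J.
  exists (x * y); split; [mem|by rewrite mulf_neq0|].
  by rewrite ext_mul xE yE principalM.
- move=> c d [[I fI <-] cI] [J fJ <-] cd.
  have mI := fractional_emodule fI; have mJ := fractional_emodule fJ.
  apply/capitulationP => //.
  have /(capitulationP kK fI)[x [xK x0 xE]] : capitulation_kernel k K (ideal_class k I).
    by split=> //; exists I.
  rewrite class_mulE // in cd; have mIJ := im_emodule J mI.
  have [y [yk y0 yE]] := (class_oneP mIJ).1 cd.
  exists (y / x); split.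
  - by have := subvP kK _ yk => ?; mem.
  - by rewrite mulf_neq0 ?invr_eq0.
  have : ideal_ext K (ideal_mul I J) = principal_ideal K y by rewrite yE ext_principal.
  rewrite ext_mul xE im_principal; last exact: ext_emodule.
  move=> /(congr1 (iscale x^-1)); rewrite iscaleK // => ->.
  by rewrite !principalE iscaleM mulrC.
Qed.

End QuadraticIdeals.

(** * Pell equations *)

Section Pell.
Implicit Types (x y z w a b c : int) (m n : nat).

Lemma sqr_ltz a b : 0 <= b -> a ^+ 2 < b ^+ 2 -> a < b.
Proof. by move=> b0; rewrite !ltNge; apply: contra => ba; rewrite ler_sqr ?nnegrE //; lia. Qed.

(** The witness is [gcd(a, c)]: its square is the gcd of [a^2], [a c] and [c^2 = a b], that is [a]
    times a divisor of [gcd(a, b) = 1]. *)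
Lemma coprime_sqr (a b c : nat) : coprime a b -> (a * b = c ^ 2)%N -> exists u, (a = u ^ 2)%N.
Proof.
move=> ab e; exists (gcdn a c); rewrite expnS expn1 muln_gcdr !muln_gcdl.
have -> : (c * c = a * b)%N by rewrite e expnS expn1.
rewrite (mulnC c a) -gcdnA (gcdnA (a * c)) gcdnn -!muln_gcdr.
by rewrite gcdnCA [gcdn a b](eqP ab) gcdn1 muln1.
Qed.

(* Conway's river: the indefinite forms [a, b, -c] with a, c > 0 and b^2 + a c = m
   are finitely many, and walking along the river permutes them.  A state is a
   basis ((x, y), (z, w)) of Z^2, evaluated on the form X^2 - m Y^2. *)
Section River.
Variable m : nat.
Hypothesis nonsq : forall c : nat, m != (c * c)%N.

Definition state := (int * int * int * int)%type.
Definition fA (s : state) := let: (x, y, z, w) := s in x ^+ 2 - m%:Z * y ^+ 2.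
Definition fB (s : state) := let: (x, y, z, w) := s in x * z - m%:Z * y * w.
Definition fC (s : state) := let: (x, y, z, w) := s in m%:Z * w ^+ 2 - z ^+ 2.
Definition step (s : state) : state := let: (x, y, z, w) := s in
  if 0 < fA s + 2 * fB s - fC s then (x + z, y + w, z, w) else (x, y, x + z, y + w).

Definition river_inv (n : nat) (s : state) := let: (x, y, z, w) := s in
  [/\ [/\ 0 <= x, 0 <= y, 0 <= z & 0 <= w], x * w - y * z = 1,
      0 < fA s, 0 < fC s & n%:Z + 2 <= x + y + z + w].

Lemma river_disc n s : river_inv n s -> fB s ^+ 2 + fA s * fC s = m%:Z.
Proof.
case: s => [[[x y] z] w] [_ e _ _ _] /=.
have -> : (x * z - m%:Z * y * w) ^+ 2 + (x ^+ 2 - m%:Z * y ^+ 2) * (m%:Z * w ^+ 2 - z ^+ 2) =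
  m%:Z * (x * w - y * z) ^+ 2 by ring.
by rewrite e expr1n mulr1.
Qed.

(** The quantity is the value of the form at the sum of the basis vectors; if it vanished, the
    discriminant [m] would be the square of [fA s + fB s]. *)
Lemma river_t n s : river_inv n s -> fA s + 2 * fB s - fC s != 0.
Proof.
move=> ri; apply/negP=> /eqP t0; have := river_disc ri.
have -> : fC s = fA s + 2 * fB s by apply/eqP; rewrite eq_sym -subr_eq0 t0.
have -> : fB s ^+ 2 + fA s * (fA s + 2 * fB s) = (fA s + fB s) ^+ 2 by ring.
move/(congr1 absz); rewrite abszX absz_nat => e.
by have := nonsq `|fA s + fB s|; rewrite -e expnS expn1 eqxx.
Qed.

Lemma river_step n s : river_inv n s -> river_inv n.+1 (step s).
Proof.
move=> ri; have t0 := river_t ri; move: ri t0.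
case: s => [[[x y] z] w] [[x0 y0 z0 w0] e A C S] t0.
rewrite /step; set t := (X in 0 < X) in t0 *.
have tE : t = (x + z) ^+ 2 - m%:Z * (y + w) ^+ 2 by rewrite /t /=; ring.
have xy : 1 <= x + y.
  have : (x != 0) || (y != 0).
    by rewrite -negb_and; apply/negP=> /andP[/eqP xe /eqP ye]; move: A; rewrite /= xe ye; lia.
  by lia.
have zw : 1 <= z + w.
  have : (z != 0) || (w != 0).
    by rewrite -negb_and; apply/negP=> /andP[/eqP xe /eqP ye]; move: C; rewrite /= xe ye; lia.
  by lia.
case: ifP => tp.
  split=> //; [by split=> //; lia| |by rewrite /= -tE|by lia].
  by rewrite -e; ring.
split=> //; [by split=> //; lia|by rewrite -e; ring| |by lia].
rewrite /=.
have -> : m%:Z * (y + w) ^+ 2 - (x + z) ^+ 2 = - t by rewrite tE; ring.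
by move/eqP: t0; move: tp; lia.
Qed.

(** A step can be undone from the form alone: after it, [fA - 2 fB - fC] is the old [fA] in the
    first branch and minus the old [fC] in the second, so its sign reveals the branch. *)
Lemma river_back n n' s s' : river_inv n s -> river_inv n' s' ->
  fA (step s) = fA (step s') -> fB (step s) = fB (step s') -> fC (step s) = fC (step s') ->
  [/\ fA s = fA s', fB s = fB s' & fC s = fC s'].
Proof.
move=> ri ri'; have t0 := river_t ri; have t0' := river_t ri'.
have A : 0 < fA s by case: s ri {t0} => [[[x y] z] w] [].
have A' : 0 < fA s' by case: s' ri' {t0'} => [[[x y] z] w] [].
have C : 0 < fC s by case: s ri {t0 A} => [[[x y] z] w] [].
have C' : 0 < fC s' by case: s' ri' {t0' A'} => [[[x y] z] w] [].
have stA r : fA (step r) = if 0 < fA r + 2 * fB r - fC r then fA r + 2 * fB r - fC r else fA r.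
  by case: r => [[[x y] z] w]; rewrite /step; case: ifP => _ //=; ring.
have stB r : fB (step r) = if 0 < fA r + 2 * fB r - fC r then fB r - fC r else fB r + fA r.
  by case: r => [[[x y] z] w]; rewrite /step; case: ifP => _ //=; ring.
have stC r : fC (step r) = if 0 < fA r + 2 * fB r - fC r then fC r else - (fA r + 2 * fB r - fC r).
  by case: r => [[[x y] z] w]; rewrite /step; case: ifP => _ //=; ring.
rewrite !stA !stB !stC.
by case: ifP => h; case: ifP => h' e1 e2 e3; split; lia.
Qed.

Definition river (n : nat) : state := iter n step (1, 0, 0, 1).

Lemma riverP n : river_inv n (river n).
Proof.
elim: n => [|n IH]; last by rewrite /river iterS; apply: river_step.
have m0 : (0 < m)%N by have := nonsq 0; rewrite lt0n.
by split=> //=; lia.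
Qed.

(** By the pigeonhole principle two states carry the same form; undoing steps walks the coincidence
    back to the start, whose first vector has value 1. *)
Lemma pell_exists : exists x y : nat, (x ^ 2 = m * y ^ 2 + 1)%N /\ (0 < y)%N.
Proof.
pose N := (m.+1 * (2 * m).+1)%N.
(* [fB] ranges over [[-m, m]] and is shifted by [m] to be natural; [fC] is recovered from the
   discriminant. *)
pose h (j : 'I_N.+1) : 'I_m.+1 * 'I_(2 * m).+1 :=
  (inord `|fA (river j)|, inord `|fB (river j) + m%:Z|).
have bnd n : [/\ 0 < fA (river n), fA (river n) <= m%:Z, 0 < fC (river n) & - m%:Z <= fB (river n) <= m%:Z].
  have ri := riverP n; have D := river_disc ri.
  have A : 0 < fA (river n) by move: ri; case: (river n) => [[[x y] z] w] [].
  have C : 0 < fC (river n) by move: ri; case: (river n) => [[[x y] z] w] [].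
  split=> //; first by nia.
  have : fB (river n) ^+ 2 <= m%:Z by nia.
  by nia.
have [i [j [ij hij]]] : exists i j : 'I_N.+1, (i < j)%N /\ h i = h j.
  have /injectivePn[i [j ij hij]] : ~~ injectiveb h.
    apply/negP=> /injectiveP /leq_card; rewrite card_prod !card_ord.
    by rewrite ltnn.
  have : (i != j :> nat) by []; rewrite neq_ltn => /orP[lt|lt].
    by exists i, j.
  by exists j, i.
have [eA eB] : fA (river i) = fA (river j) /\ fB (river i) = fB (river j).
  have [A0 A1 _ /andP[B0 B1]] := bnd i; have [A0' A1' _ /andP[B0' B1']] := bnd j.
  case: hij => /(congr1 val) /= e1 /(congr1 val) /= e2.
  rewrite !inordK in e1 e2; try lia.
have eC : fC (river i) = fC (river j).
  have := river_disc (riverP i); have := river_disc (riverP j); rewrite eA eB => <-.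
  move/addrI; apply: mulfI; have [A0 _ _ _] := bnd j; lia.
have [l [l0 [lA lB lC]]] : exists l, (0 < l)%N /\
  [/\ fA (river 0) = fA (river l), fB (river 0) = fB (river l) & fC (river 0) = fC (river l)].
  exists (j - i)%N; split; first by rewrite subn_gt0.
  move: (nat_of_ord i) (nat_of_ord j) ij eA eB eC {hij} => {i j}.
  elim=> [|i IH] [|j] // ij eA eB eC.
  have [eA' eB' eC'] := river_back (riverP i) (riverP j) eA eB eC.
  by rewrite subSS; apply: IH.
have := riverP l; have [_ _ _ _] := bnd l.
move: lA lB lC; case: (river l) => [[[x y] z] w] /= lA lB lC [[x0 y0 z0 w0] e _ _ S].
exists `|x|%N, `|y|%N; split.
  apply/eqP; rewrite -eqz_nat PoszD PoszM -!abszX !gez0_abs ?sqr_ge0 //.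
  by apply/eqP; lia.
(* If [y] vanished, the basis would be the initial one with entry sum 2, against the growth bound in
   [river_inv]. *)
rewrite absz_gt0; apply/negP=> /eqP y1; move: lA lB e S; rewrite y1.
move=> lA lB e S.
have xw : x * w = 1 by lia.
have x1 : x = 1 by nia.
have w1 : w = 1 by move: xw; rewrite x1; lia.
by move: lB; rewrite x1 w1; lia.
Qed.

End River.

(** Solvability for a given [y] becomes a finite search, so that a least [y] can be taken. *)
Lemma pell_bound m (x y : nat) : (0 < m)%N -> (x ^ 2 = m * y ^ 2 + 1)%N -> (x < m * y + 2)%N.
Proof.
move=> m0 e; rewrite addn2 ltnS -leq_sqr e -[(m * y).+1]addn1 sqrnD exp1n.
have : (m * y ^ 2 <= (m * y) ^ 2)%N by rewrite expnMn leq_mul2r expnS expn1 leq_pmull ?orbT.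
by lia.
Qed.

(* A solution of x^2 - m y^2 = 1 with least y is split through
   (x + 1)/2 * (x - 1)/2 = m (y/2)^2. *)
Lemma pell_half m : (forall c : nat, m != (c * c)%N) -> (m %% 4 = 1)%N ->
  exists g h u v : nat, [/\ m = (g * h)%N, (1 < g)%N & (g * u ^ 2 = h * v ^ 2 + 1)%N].
Proof.
move=> nonsq m4.
have m0 : (0 < m)%N by case: m m4 {nonsq}.
have ex : exists y : nat, (0 < y)%N && [exists x : 'I_(m * y + 2), (x ^ 2 == m * y ^ 2 + 1)%N].
  have [x [y [e y0]]] := pell_exists nonsq; exists y; rewrite y0 /=.
  have xl := pell_bound m0 e.
  by apply/existsP; exists (Ordinal xl); rewrite /= e.
case: (ex_minnP ex) => y /andP[y0 /existsP[[x xl] /= /eqP xy]] ymin {ex}.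
have ymin' u v : (0 < v)%N -> (u ^ 2 = m * v ^ 2 + 1)%N -> (y <= v)%N.
  move=> v0 e; apply: ymin; rewrite v0 /=.
  have ul := pell_bound m0 e.
  by apply/existsP; exists (Ordinal ul); rewrite /= e.
(* Modulo 4, an odd [y] would give [x ^ 2 = 2]. *)
have [Y yY] : exists Y, y = (2 * Y)%N.
  exists y./2; rewrite mul2n; apply/esym/even_halfK.
  apply/negP => oy; have yo := odd_double_half y; rewrite oy -mul2n in yo.
  have xo := odd_double_half x; rewrite -mul2n in xo.
  have mo : m = (4 * (m %/ 4) + 1)%N by rewrite {1}(divn_eq m 4) m4 mulnC.
  move: xy; rewrite -xo -yo mo; case: (odd x) => /=; nia.
have [X xX] : exists X, x = (2 * X + 1)%N.
  exists x./2; have := odd_double_half x; rewrite -mul2n.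
  case ox: (odd x) => xo; first by rewrite -{1}xo addnC.
  by move: xy; rewrite yY -xo; nia.
have XY : (X.+1 * X = m * Y ^ 2)%N by move: xy; rewrite xX yY; nia.
have Y0 : (0 < Y)%N by lia.
have X0 : (0 < X)%N by case: X XY {xX} => // /eqP; rewrite muln0 eq_sym muln_eq0; nia.
pose g := gcdn X.+1 m; pose h := (m %/ g)%N; pose X' := (X.+1 %/ g)%N.
have g0 : (0 < g)%N by rewrite gcdn_gt0.
have mg : m = (g * h)%N by rewrite mulnC divnK ?dvdn_gcdr.
have Xg : X.+1 = (g * X')%N by rewrite mulnC divnK ?dvdn_gcdl.
have cop : coprime h X'.
  rewrite /coprime -(eqn_pmul2l g0) muln1 muln_gcdr -mg -Xg gcdnC.
  exact: eqxx.
have [X'' hX] : exists X'', X = (h * X'')%N.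
  have : (h %| X' * X)%N.
    by rewrite -(dvdn_pmul2l g0) mulnA -Xg -mg XY dvdn_mulr.
  by rewrite Gauss_dvdr // => /dvdnP[X'' ->]; exists X''; rewrite mulnC.
have XXY : (X' * X'' = Y ^ 2)%N.
  apply/eqP; rewrite -(eqn_pmul2l m0) -XY {1}mg Xg hX; apply/eqP.
  by rewrite mulnACA.
have cop2 : coprime X' X''.
  have c1 : coprime X.+1 X by rewrite coprime_sym coprimenS.
  by move: c1; rewrite Xg hX !coprimeMl !coprimeMr => /andP[/andP[_ _] /andP[_ ->]].
have [u uE] := coprime_sqr cop2 XXY.
have [v vE] : exists v, (X'' = v ^ 2)%N.
  by apply: (@coprime_sqr X'' X' Y); [rewrite coprime_sym|rewrite mulnC].
have gh : (g * u ^ 2 = h * v ^ 2 + 1)%N by rewrite -uE -vE -Xg -hX addn1.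
exists g, h, u, v; split=> //.
(* If [g = 1], then [(u, v)] solves the original equation with [v <= Y < y], against minimality. *)
rewrite ltn_neqAle g0 andbT; apply/negP=> /eqP g1.
have hm : h = m by rewrite mg -g1 mul1n.
have v0 : (0 < v)%N by case: v vE gh => // vE; rewrite hX vE muln0 in X0.
have := ymin' u v v0; rewrite -hm -gh -g1 mul1n => /(_ erefl).
have : (v ^ 2 <= Y ^ 2)%N by rewrite -vE -XXY leq_pmull //; case: X' Xg {cop XXY cop2 uE} => //; rewrite muln0.
by rewrite leq_sqr; lia.
Qed.

(** * The group of solutions of the Pell equation *)

Section PellUnits.
Variables (R : fieldType) (s : R) (d : nat).
Hypotheses (d0 : (0 < d)%N) (ss : s ^+ 2 = d%:R).

Definition psol (e : R) := exists x y : int,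
  e = x%:~R + y%:~R * s /\ x ^+ 2 - d%:Z * y ^+ 2 = 1.

Lemma psol_conj x y : x ^+ 2 - d%:Z * y ^+ 2 = 1 ->
  (x%:~R + y%:~R * s) * (x%:~R - y%:~R * s) = 1.
Proof.
move=> e; have -> : (x%:~R + y%:~R * s) * (x%:~R - y%:~R * s) =
    x%:~R ^+ 2 - s ^+ 2 * y%:~R ^+ 2 by ring.
rewrite ss; have := congr1 (intr : int -> R) e.
by rewrite rmorphB rmorphXn rmorphM rmorphXn.
Qed.

Lemma psol_neq0 e : psol e -> e != 0.
Proof.
move=> [x [y [-> /psol_conj e1]]]; apply: contra_eq_neq e1 => ->.
by rewrite mul0r eq_sym oner_eq0.
Qed.

(** [eps] is a solution with least positive [y], or 1 if there are only trivial solutions. Dividing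
    a natural solution [a + b s] with [b > 0] by [eps] gives natural coordinates with smaller [b];
    signs and conjugation, which is inversion here, account for the rest. *)
Lemma pell_cyclic : exists2 eps, psol eps & forall e, psol e ->
  exists n, exists2 r, r = eps ^+ n \/ r = eps ^- n & e = r \/ e = - r.
Proof.
have red x y : x ^+ 2 - d%:Z * y ^+ 2 = 1 -> exists a b : nat,
    a%:Z ^+ 2 - d%:Z * b%:Z ^+ 2 = 1 /\
    (exists2 r, r = a%:R + b%:R * s \/ r = (a%:R + b%:R * s)^-1 &
      x%:~R + y%:~R * s = r \/ x%:~R + y%:~R * s = - r).
  move=> e; exists `|x|%N, `|y|%N; have sq (z : int) : `|z|%N%:Z ^+ 2 = z ^+ 2.
    by rewrite abszE -normrX ger0_norm ?sqr_ge0.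
  have e' : `|x|%N%:Z ^+ 2 - d%:Z * `|y|%N%:Z ^+ 2 = 1 by rewrite !sq.
  split=> //.
  have inv : (`|x|%N%:R + `|y|%N%:R * s)^-1 = `|x|%N%:R - `|y|%N%:R * s.
    have h := psol_conj e'; have n0 : `|x|%N%:R + `|y|%N%:R * s != 0.
      by apply: contra_eq_neq h => h0; rewrite h0 mul0r eq_sym oner_eq0.
    by apply: (mulfI n0); rewrite mulfV.
  have hx : x%:~R = `|x|%N%:R :> R \/ x%:~R = - `|x|%N%:R :> R.
    case: (lerP 0 x) => x0; [left|right]; first by rewrite -{1}(gez0_abs x0).
    by rewrite -[x in LHS]opprK -(ltz0_abs x0) rmorphN.
  have hy : y%:~R = `|y|%N%:R :> R \/ y%:~R = - `|y|%N%:R :> R.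
    case: (lerP 0 y) => x0; [left|right]; first by rewrite -{1}(gez0_abs x0).
    by rewrite -[y in LHS]opprK -(ltz0_abs x0) rmorphN.
  case: hx => ->; case: hy => ->.
  - by exists (`|x|%N%:R + `|y|%N%:R * s); left.
  - by eexists; [right; reflexivity|left; rewrite inv mulNr].
  - by eexists; [right; reflexivity|right; rewrite inv; ring].
  - by eexists; [left; reflexivity|right; ring].
have [[a [b [ab b0]]]|none] := pselect (exists a b : nat, (a ^ 2 = d * b ^ 2 + 1)%N /\ (0 < b)%N).
- have ex : exists b : nat, (0 < b)%N && [exists a : 'I_(d * b + 2), (a ^ 2 == d * b ^ 2 + 1)%N].
    exists b; rewrite b0 /=; apply/existsP; exists (Ordinal (pell_bound d0 ab)).
    by rewrite /= ab.
  case: (ex_minnP ex) => y1 /andP[y10 /existsP[[x1 x1l] /= /eqP xy1]] ymin {ex a b ab b0}.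
  have {}ymin (a b : nat) : (0 < b)%N -> (a ^ 2 = d * b ^ 2 + 1)%N -> (y1 <= b)%N.
    move=> b0 ab; apply: ymin; rewrite b0 /=; apply/existsP.
    by exists (Ordinal (pell_bound d0 ab)); rewrite /= ab.
  have e1 : x1%:Z ^+ 2 - d%:Z * y1%:Z ^+ 2 = 1 by lia.
  set eps := x1%:R + y1%:R * s.
  have pe : psol eps by exists x1, y1.
  have pow (b a : nat) : (a ^ 2 = d * b ^ 2 + 1)%N -> exists n, a%:R + b%:R * s = eps ^+ n.
    elim/ltn_ind: b a => b IH a ab.
    have [b0|b0] := posnP b.
      exists 0%N; have -> : a = 1%N by move: ab; rewrite b0; nia.
      by rewrite b0 mul0r addr0 expr0.
    have yb := ymin a b b0 ab.
    have x10 : (0 < x1)%N by case: x1 xy1 {x1l e1 eps pe ymin IH} => //; lia.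
    have a0 : (0 < a)%N by case: a ab => //; lia.
    have E1 : x1%:Z ^+ 2 = d%:Z * y1%:Z ^+ 2 + 1 by lia.
    have E2 : a%:Z ^+ 2 = d%:Z * b%:Z ^+ 2 + 1 by lia.
    have D0 : 0 < d%:Z by lia.
    have Y0 : 0 < y1%:Z by lia.
    have B0 : y1%:Z <= b%:Z by lia.
    have xp : d%:Z * b%:Z * y1%:Z < a%:Z * x1%:Z.
      apply: sqr_ltz; first by lia.
      rewrite -subr_gt0; have -> : (a%:Z * x1%:Z) ^+ 2 - (d%:Z * b%:Z * y1%:Z) ^+ 2 =
        d%:Z * b%:Z ^+ 2 + d%:Z * y1%:Z ^+ 2 + 1.
        by rewrite [(a%:Z * x1%:Z) ^+ 2]exprMn E1 E2; ring.
      by apply: ltr_wpDl => //; apply: addr_ge0; apply: mulr_ge0; rewrite ?sqr_ge0 // ltW.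
    have yp : a%:Z * y1%:Z <= b%:Z * x1%:Z.
      rewrite leNgt; apply/negP=> H.
      have : (b%:Z * x1%:Z) ^+ 2 < (a%:Z * y1%:Z) ^+ 2 by rewrite ltr_sqr ?nnegrE; lia.
      rewrite !exprMn E1 E2 -subr_gt0.
      have -> : (d%:Z * b%:Z ^+ 2 + 1) * y1%:Z ^+ 2 - b%:Z ^+ 2 * (d%:Z * y1%:Z ^+ 2 + 1) =
        y1%:Z ^+ 2 - b%:Z ^+ 2 by ring.
      rewrite subr_gt0 ltr_sqr ?nnegrE; lia.
    have yl : b%:Z * x1%:Z - a%:Z * y1%:Z < b%:Z.
      rewrite ltrBlDr -ltrBlDl.
      have -> : b%:Z * x1%:Z - b%:Z = b%:Z * (x1%:Z - 1) by ring.
      apply: sqr_ltz; first by lia.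
      rewrite !exprMn E2 -subr_gt0.
      have -> : (d%:Z * b%:Z ^+ 2 + 1) * y1%:Z ^+ 2 - b%:Z ^+ 2 * (x1%:Z - 1) ^+ 2 =
        y1%:Z ^+ 2 + b%:Z ^+ 2 * (2 * (x1%:Z - 1)) + b%:Z ^+ 2 * (d%:Z * y1%:Z ^+ 2 + 1 - x1%:Z ^+ 2).
        by ring.
      rewrite -E1 subrr mulr0 addr0 ltr_pwDl ?exprn_gt0 // mulr_ge0 ?sqr_ge0 //; lia.
    pose a' := absz (a%:Z * x1%:Z - d%:Z * b%:Z * y1%:Z)%R.
    pose b' := absz (b%:Z * x1%:Z - a%:Z * y1%:Z)%R.
    have a'E : a'%:Z = a%:Z * x1%:Z - d%:Z * b%:Z * y1%:Z by rewrite /a' gez0_abs; lia.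
    have b'E : b'%:Z = b%:Z * x1%:Z - a%:Z * y1%:Z by rewrite /b' gez0_abs; lia.
    have E3 : a'%:Z ^+ 2 = d%:Z * b'%:Z ^+ 2 + 1.
      rewrite a'E b'E.
      have -> : (a%:Z * x1%:Z - d%:Z * b%:Z * y1%:Z) ^+ 2 =
        d%:Z * (b%:Z * x1%:Z - a%:Z * y1%:Z) ^+ 2 +
        (a%:Z ^+ 2 - d%:Z * b%:Z ^+ 2) * (x1%:Z ^+ 2 - d%:Z * y1%:Z ^+ 2) by ring.
      by rewrite e1 E2; ring.
    have b'l : (b' < b)%N by move: yl; rewrite -b'E.
    have [|n nE] := IH b' b'l a'; first by move: E3; clear; lia.
    exists n.+1; rewrite exprS -nE /eps.
    have -> : a'%:R = a%:R * x1%:R - d%:R * b%:R * y1%:R :> R.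
      by have := congr1 (intr : int -> R) a'E; rewrite rmorphB !rmorphM /= -!pmulrn.
    have -> : b'%:R = b%:R * x1%:R - a%:R * y1%:R :> R.
      by have := congr1 (intr : int -> R) b'E; rewrite rmorphB !rmorphM /= -!pmulrn.
    have e1R : x1%:R ^+ 2 - d%:R * y1%:R ^+ 2 = 1 :> R.
      by have := congr1 (intr : int -> R) e1; rewrite rmorphB rmorphXn rmorphM rmorphXn.
    rewrite -ss in e1R *.
    by apply: (lin_comb (c := - (a%:R + b%:R * s)) e1R); ring.
  exists eps => // e [x [y [-> /red[a [b [ab [r re xr]]]]]]].
  have [|n nE] := pow b a; first by lia.
  exists n, r => //; rewrite -nE.
  by case: re => ->; [left|right].
exists 1; first by exists 1, 0; rewrite mul0r addr0; split=> //; ring.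
move=> e [x [y [-> /red[a [b [ab [r re xr]]]]]]].
have b0 : b = 0%N.
  by apply/eqP; rewrite -leqn0 leqNgt; apply/negP=> b0; apply: none; exists a, b; split=> //; lia.
have a1 : a = 1%N by move: ab; rewrite b0; nia.
exists 0%N, r => //; left; rewrite expr0.
by case: re => ->; rewrite a1 b0 mul0r addr0 ?invr1.
Qed.

Lemma psolM e1 e2 : psol e1 -> psol e2 -> psol (e1 * e2).
Proof.
move=> [x [y [-> e]]] [x' [y' [-> e']]].
exists (x * x' + d%:Z * y * y'), (x * y' + y * x'); split.
  rewrite !(rmorphD, rmorphM) /= -pmulrn -ss; ring.
have -> : (x * x' + d%:Z * y * y') ^+ 2 - d%:Z * (x * y' + y * x') ^+ 2 =
  (x ^+ 2 - d%:Z * y ^+ 2) * (x' ^+ 2 - d%:Z * y' ^+ 2) by ring.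
by rewrite e e' mulr1.
Qed.

Lemma psolV e : psol e -> psol e^-1.
Proof.
move=> pe; have e0 := psol_neq0 pe; case: pe e0 => x [y [-> xy]] e0.
exists x, (- y); split; last by rewrite sqrrN.
by apply: (mulfI e0); rewrite mulfV // rmorphN mulNr psol_conj.
Qed.

Lemma psolX e n : psol e -> psol (e ^+ n).
Proof.
move=> pe; elim: n => [|n IH]; last by rewrite exprS; apply: psolM.
by exists 1, 0; rewrite expr0 mul0r addr0; split=> //; ring.
Qed.

(** Modulo signs and squares the cyclic group has at most two classes; if neither [e1] nor [e2] is
    trivial, both lie in the class of [eps] and their product is trivial. *)
Lemma pell_mod_squares e1 e2 : psol e1 -> psol e2 ->
  exists2 e, [\/ e = e1, e = e2 | e = e1 * e2] &
  exists2 t, psol t & e = t ^+ 2 \/ e = - t ^+ 2.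
Proof.
have [eps peps H] := pell_cyclic.
have {H} key e : psol e -> exists2 t, psol t &
    (e = t ^+ 2 \/ e = - t ^+ 2) \/ (e = t ^+ 2 * eps \/ e = - (t ^+ 2 * eps)).
  move=> /H[n [r rn er]].
  have [t pt tr] : exists2 t, psol t & r = t ^+ 2 \/ r = t ^+ 2 * eps.
    have hn := odd_double_half n; rewrite -mul2n in hn.
    case: rn => ->; rewrite -hn; case: (odd n).
    - exists (eps ^+ n./2); first exact: psolX.
      by right; rewrite add1n exprS mulrC mulnC exprM.
    - exists (eps ^+ n./2); first exact: psolX.
      by left; rewrite add0n mulnC exprM.
    - exists (eps ^- (n./2).+1); first exact/psolV/psolX.
      right; have e0 := psol_neq0 peps.
      have -> : eps ^- (n./2).+1 ^+ 2 = (eps ^+ (1 + 2 * n./2) * eps)^-1.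
        by rewrite -exprSr -exprVn -!exprM exprVn; congr (_ ^- _); lia.
      by rewrite invfM -mulrA mulVf // mulr1.
    - exists (eps ^- n./2); first exact/psolV/psolX.
      by left; rewrite add0n exprVn -exprM mulnC.
  exists t => //; case: er => ->; case: tr => ->; by [left; left|right; left|left; right|right; right].
move=> p1 p2; have [t1 pt1 h1] := key _ p1; have [t2 pt2 h2] := key _ p2.
case: h1 => h1; first by exists e1; [constructor 1|exists t1].
case: h2 => h2; first by exists e2; [constructor 2|exists t2].
exists (e1 * e2); first by constructor 3.
exists (t1 * t2 * eps); first by do 2?apply: psolM.
by case: h1 => ->; case: h2 => ->; [left|right|right|left]; ring.
Qed.

End PellUnits.
End Pell.

Lemma int_parity (a : int) : exists b : int, a = 2 * b \/ a = 2 * b + 1.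
Proof.
exists (a %/ 2)%Z; have := divz_eq a 2; have := modz_ge0 a (isT : 2 != 0 :> int).
have := ltz_pmod a (isT : 0 < 2 :> int); lia.
Qed.

(** * Gaussian integers *)

Section Gaussian.
Variables (L : splittingFieldType rat) (i : L) (tau : 'AEnd(L)).
Hypotheses (ii : i ^+ 2 = -1) (taui : tau i = - i).
Implicit Types (x y z u w a b t r : L).
Local Notation OO := ring_of_integers.
Definition Gi : {subfield L} := <<QQ L; i>>%AS.

Lemma Gi_i : i \in Gi. Proof. exact: memv_adjoin. Qed.
Lemma ii_Q : i ^+ 2 \in QQ L. Proof. by rewrite ii; mem. Qed.
Lemma i_neq0 : i != 0.
Proof. by rewrite -sqrf_eq0 ii oppr_eq0 oner_eq0. Qed.
Lemma iV : i^-1 = - i.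
Proof. by apply: (mulfI i_neq0); rewrite mulfV ?i_neq0 // mulrN -expr2 ii opprK. Qed.
Lemma isint_i : isint i.
Proof. by apply: isint_sqr; rewrite ii; isi. Qed.
Lemma iunit_i : iunit i.
Proof. by split; [exact: i_neq0|exact: isint_i|rewrite iV; apply/isintN/isint_i]. Qed.
Lemma OOi : OO Gi i. Proof. by split; [exact: Gi_i|exact: isint_i]. Qed.

Lemma tau_rat (a : rat) : tau a%:A = a%:A. Proof. exact: aut_rat. Qed.

Lemma Gi_coord x : x \in Gi -> exists a b : rat, x = a%:A + b%:A * i.
Proof.
move=> /(quad_coord ii_Q)[a [b [/mem1P[qa ->] /mem1P[qb ->] ->]]].
by exists qa, qb.
Qed.

Lemma tau_coord (a b : rat) : tau (a%:A + b%:A * i) = a%:A - b%:A * i.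
Proof. by rewrite rmorphD rmorphM /= !tau_rat taui mulrN. Qed.

Lemma tauGi x : x \in Gi -> tau x \in Gi.
Proof.
apply: aut_adjoin; [by move=> y /mem1P[a ->]; rewrite tau_rat; apply/mem1P; exists a| |by right].
exact: ii_Q.
Qed.

Lemma tauO x : OO Gi x -> OO Gi (tau x).
Proof. by move=> [xG xi]; split; [exact: tauGi|isi]. Qed.

Lemma tautau x : x \in Gi -> tau (tau x) = x.
Proof. by move=> /Gi_coord[a [b ->]]; rewrite tau_coord -mulNr -scaleNr tau_coord scaleNr mulNr opprK. Qed.

Lemma normE (a b : rat) : (a%:A + b%:A * i) * tau (a%:A + b%:A * i) = (a ^+ 2 + b ^+ 2)%:A.
Proof.
rewrite tau_coord; have -> : (a%:A + b%:A * i) * (a%:A - b%:A * i) = a%:A ^+ 2 - b%:A ^+ 2 * i ^+ 2.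
  by move=> *; ring.
by rewrite ii mulrN1 opprK -!in_algE -!rmorphXn -rmorphD.
Qed.

Lemma ratL_inj : injective (fun a : rat => a%:A : L).
Proof. exact: (fmorph_inj (in_alg L)). Qed.

(** Traces make the doubled coordinates integers [A] and [B], and the norm gives
    [A ^+ 2 + B ^+ 2 = 4 N], which forces both to be even. *)
Lemma OOGiP x : OO Gi x <-> exists a b : int, x = a%:~R + b%:~R * i.
Proof.
split; last first.
  move=> [a [b ->]]; split; first by have := Gi_i => ?; mem.
  by have := isint_i => ?; isi.
move=> [/Gi_coord[a [b ->]] xi].
have ti : isint (tau (a%:A + b%:A * i)) by isi.
have [A AE] : exists A : int, a + a = A%:~R.
  have [||A AE] := @isint_rat L (a + a)%:A.
  - by apply/mem1P; exists (a + a).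
  - have -> : (a + a)%:A = a%:A + b%:A * i + tau (a%:A + b%:A * i).
      by rewrite tau_coord scalerDl; ring.
    exact: isintD.
  by exists A; apply: ratL_inj; rewrite AE scaler_int.
have [B BE] : exists B : int, b + b = B%:~R.
  have [||B BE] := @isint_rat L (b + b)%:A.
  - by apply/mem1P; exists (b + b).
  - have -> : (b + b)%:A = (tau (a%:A + b%:A * i) - (a%:A + b%:A * i)) * i.
      rewrite tau_coord scalerDl.
      have -> : (a%:A - b%:A * i - (a%:A + b%:A * i)) * i = - (b%:A + b%:A) * i ^+ 2 by move=> *; ring.
      by rewrite ii mulrN1 opprK.
    by apply: isintM; [exact: isintB|exact: isint_i].
  by exists B; apply: ratL_inj; rewrite BE scaler_int.
have [N NE] : exists N : int, a ^+ 2 + b ^+ 2 = N%:~R.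
  have [||N NE] := @isint_rat L (a ^+ 2 + b ^+ 2)%:A.
  - by apply/mem1P; exists (a ^+ 2 + b ^+ 2).
  - by rewrite -normE; apply: isintM.
  by exists N; apply: ratL_inj; rewrite NE scaler_int.
have ABN : A ^+ 2 + B ^+ 2 = 4 * N.
  apply: (@intr_inj rat); rewrite rmorphD !rmorphXn rmorphM /= -AE -BE -NE; ring.
have [A' A'E] : exists A', A = 2 * A'.
  by have [A' [e|e]] := int_parity A; have [B' [e'|e']] := int_parity B; exists A'; nia.
have [B' B'E] : exists B', B = 2 * B'.
  by have [B' [e|e]] := int_parity B; exists B'; nia.
exists A', B'.
have -> : a = A'%:~R by apply: (mulfI (_ : 2%:R != 0)) => //; rewrite mulr_natl mulr2n AE A'E rmorphM.
have -> : b = B'%:~R by apply: (mulfI (_ : 2%:R != 0)) => //; rewrite mulr_natl mulr2n BE B'E rmorphM.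
by rewrite !scaler_int.
Qed.

(** The norm as a natural number. It is extracted by choice, since [x] is just an element of [L],
    with default 0 when the norm is not natural; [gNE] justifies it on Gaussian integers. *)
Definition gN x : nat := xget 0%N [set n : nat | x * tau x = n%:R].

Lemma gN_int (a b : int) : gN (a%:~R + b%:~R * i) = `|(a ^+ 2 + b ^+ 2)%R|%N.
Proof.
have e : (a%:~R + b%:~R * i) * tau (a%:~R + b%:~R * i) = (`|(a ^+ 2 + b ^+ 2)%R|%N)%:R.
  have -> : a%:~R + b%:~R * i = (a%:~R)%:A + (b%:~R)%:A * i by rewrite !scaler_int.
  rewrite normE -!rmorphXn -rmorphD /= scaler_int pmulrn gez0_abs //.
  by rewrite addr_ge0 ?sqr_ge0.
rewrite /gN; case: xgetP => [n _ /= e'|/(_ _ e)//].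
apply/eqP; rewrite -eqz_nat; apply/eqP; apply: (@intL_inj L).
by rewrite -!pmulrn -e -e'.
Qed.

Lemma gNE x : OO Gi x -> x * tau x = (gN x)%:R.
Proof.
move=> /OOGiP[a [b e]]; rewrite /gN; case: xgetP => [n _ //|none]; exfalso.
have e1 : x = (a%:~R)%:A + (b%:~R)%:A * i by rewrite e !scaler_int.
apply: (none `|(a ^+ 2 + b ^+ 2)%R|%N); rewrite /= e1 normE -!rmorphXn -rmorphD /= scaler_int pmulrn.
by rewrite gez0_abs // addr_ge0 ?sqr_ge0.
Qed.

Lemma natL_inj (m n : nat) : m%:R = n%:R :> L -> m = n.
Proof. by rewrite !pmulrn => /(@intL_inj L) []. Qed.

Lemma gNM x y : OO Gi x -> OO Gi y -> gN (x * y) = (gN x * gN y)%N.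
Proof.
move=> xO yO; apply: natL_inj; rewrite natrM -!gNE //; last exact: OOM.
by rewrite rmorphM /=; ring.
Qed.

Lemma gN_eq0 x : OO Gi x -> (gN x == 0%N) = (x == 0).
Proof. by move=> xO; rewrite -(natL_eq0 L) -gNE // mulf_eq0 fmorph_eq0 orbb. Qed.

Lemma gN_unit x : OO Gi x -> gN x = 1%N <-> iunit x.
Proof.
move=> xO; split.
  move=> e; apply: (@iunit_mul1 _ x (tau x)); [by case: xO|by isi; case: xO|].
  by rewrite gNE // e.
move=> [x0 xi xv]; have vO : OO Gi x^-1 by split=> //; rewrite rpredV; case: xO.
have := gNM xO vO; rewrite mulfV // => /esym/eqP.
have -> : gN 1 = 1%N.
  by apply: natL_inj; rewrite -gNE ?rmorph1 ?mulr1 //; exact: OO1.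
by rewrite muln_eq1 => /andP[/eqP].
Qed.

Lemma rat_round (q : rat) : exists n : int, (q - n%:~R) ^+ 2 <= 4%:R^-1.
Proof.
exists (Num.floor (q + 2%:R^-1)).
have /andP[] := @Num.Theory.floor_itv _ (q + 2%:R^-1).
rewrite rmorphD /= => h1 h2.
have : (q - (Num.floor (q + 2^-1))%:~R + 2^-1) * (2^-1 - (q - (Num.floor (q + 2^-1))%:~R)) >= 0.
  by apply: mulr_ge0; lra.
by lra.
Qed.

(** Rounding both coordinates of [x / y] leaves an error of norm at most 1/2. *)
Lemma euclid x y : OO Gi x -> OO Gi y -> y != 0 ->
  exists2 c, OO Gi c & (gN (x - c * y) < gN y)%N.
Proof.
move=> xO yO y0; have [xG _] := xO; have [yG _] := yO.
have [a [b e]] : exists a b : rat, x / y = a%:A + b%:A * i by apply: Gi_coord; mem.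
have [m hm] := rat_round a; have [n hn] := rat_round b.
pose c : L := m%:~R + n%:~R * i.
have cO : OO Gi c by apply/OOGiP; exists m, n.
exists c => //; have dO : OO Gi (x - c * y) by apply: OOD => //; apply/OON/OOM.
have h : (x - c * y) * tau (x - c * y) = ((a - m%:~R) ^+ 2 + (b - n%:~R) ^+ 2)%:A * (y * tau y).
  have -> : x - c * y = (x / y - c) * y by rewrite mulrBl divfK.
  have -> : x / y - c = (a - m%:~R)%:A + (b - n%:~R)%:A * i.
    by rewrite e /c !scalerBl !scaler_int; ring.
  by rewrite rmorphM /= mulrACA normE.
rewrite !gNE // in h.
have h' : (gN (x - c * y))%:R = ((a - m%:~R) ^+ 2 + (b - n%:~R) ^+ 2) * (gN y)%:R :> rat.
  by apply: ratL_inj; rewrite -!in_algE rmorphM !rmorph_nat /= h.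
have g0 : 0 < (gN y)%:R :> rat by rewrite ltr0n lt0n gN_eq0.
rewrite -(ltr_nat rat) h' -[ltRHS]mul1r ltr_pM2r //; lra.
Qed.

Lemma Gi_PID I : fractional_ideal Gi I ->
  exists r, [/\ r \in Gi, r != 0 & I = principal_ideal Gi r].
Proof.
move=> fI; have mI := fractional_emodule fI; have [I0 ID IM] := mI.
case: fI => IG [x0 Ix0 x00] _ _ [d [dO d0 dI]].
have dG : d \in Gi by case: dO.
have ex : exists n : nat, `[< exists x, [/\ I x, x != 0 & gN (d * x) = n] >].
  by exists (gN (d * x0)); apply/asboolP; exists x0.
case: (ex_minnP ex) => n /asboolP[r [Ir r0 rn]] nmin.
exists r; split; [exact: IG|by []|apply/seteqP; split].
- move=> x Ix; have [c cO h] := euclid (dI _ Ix) (dI _ Ir) (mulf_neq0 d0 r0).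
  have e : d * x - c * (d * r) = d * (x - c * r) by ring.
  rewrite e rn in h.
  have Ixr : I (x - c * r).
    by apply: ID => //; rewrite -mulNr; apply: IM => //; exact: OON.
  have [z|z] := eqVneq (x - c * r) 0.
    by exists c => //; rewrite mulrC; apply/eqP; rewrite eq_sym -subr_eq0 z.
  have /nmin : `[< exists x', [/\ I x', x' != 0 & gN (d * x') = gN (d * (x - c * r))] >].
    by apply/asboolP; exists (x - c * r).
  by rewrite leqNgt h.
by move=> _ [c cO <-]; rewrite mulrC; apply: IM.
Qed.

Lemma Gi_invertible : invertible_ideals Gi.
Proof.
move=> I /Gi_PID[r [rG r0 ->]]; exists (principal_ideal Gi r^-1); split.
  by apply: fractional_principal; rewrite ?rpredV ?invr_eq0.
by rewrite principalM mulfV // principalE iscale1.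
Qed.

Definition gdvd x y := exists2 c, OO Gi c & y = c * x.

Lemma gdvdP x y : x != 0 -> y \in Gi -> x \in Gi -> gdvd x y <-> isint (y / x).
Proof.
move=> x0 yG xG; split; first by move=> [c [_ ci] ->]; rewrite mulfK.
by move=> i1; exists (y / x); [split; [mem|]|rewrite divfK].
Qed.

Lemma bezout x y : OO Gi x -> OO Gi y -> x != 0 -> exists g u v,
  [/\ OO Gi g, OO Gi u & OO Gi v] /\ [/\ g = u * x + v * y, gdvd g x & gdvd g y].
Proof.
move=> xO yO x0.
pose I : set L := [set z | exists u v, [/\ OO Gi u, OO Gi v & z = u * x + v * y]].
have IO : I `<=` OO Gi by move=> _ [u [v [uO vO ->]]]; apply: OOD; exact: OOM.
have Ix : I x by exists 1, 0; split; [exact: OO1|exact: OO0|ring].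
have Iy : I y by exists 0, 1; split; [exact: OO0|exact: OO1|ring].
have [|r [rG r0 Ir]] := @Gi_PID I.
  split.
  - by move=> z /IO[].
  - by exists x.
  - move=> _ _ [u [v [uO vO ->]]] [u' [v' [uO' vO' ->]]]; exists (u + u'), (v + v').
    by split; [exact: OOD|exact: OOD|ring].
  - move=> a _ aO [u [v [uO vO ->]]]; exists (a * u), (a * v).
    by split; [exact: OOM|exact: OOM|ring].
  - by exists 1; split; [exact: OO1|rewrite oner_eq0|move=> z /IO; rewrite mul1r].
have : I r by rewrite Ir; exact: principal_id.
move=> [u [v [uO vO e]]]; exists r, u, v; split; split=> //.
- by rewrite e; apply: OOD; exact: OOM.
- by move: Ix; rewrite Ir => -[c cO <-]; exists c => //; rewrite mulrC.
- by move: Iy; rewrite Ir => -[c cO <-]; exists c => //; rewrite mulrC.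
Qed.

Definition gprime x := [/\ OO Gi x, x != 0, ~ iunit x &
  forall y z, OO Gi y -> OO Gi z -> gdvd x (y * z) -> gdvd x y \/ gdvd x z].

Lemma irr_prime x : OO Gi x -> x != 0 -> ~ iunit x ->
  (forall a b, OO Gi a -> OO Gi b -> x = a * b -> iunit a \/ iunit b) -> gprime x.
Proof.
move=> xO x0 xu irr; split=> // y z yO zO [c cO xyz].
have [g [u [v [[gO uO vO] [e [a aO xa] [b bO yb]]]]]] := bezout xO yO x0.
have [au|gu] := irr a g aO gO xa.
  left; case: au => a0 _ av; exists (b * a^-1).
    by apply: OOM => //; split=> //; rewrite rpredV; case: aO.
  by rewrite {1}yb xa; field.
right; case: gu => g0 _ gv; exists (g^-1 * (u * z + v * c)).
  apply: OOM; first by split=> //; rewrite rpredV; case: gO.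
  by apply: OOD; exact: OOM.
apply: (mulfI g0); rewrite {1}e mulrDl -[v * y * z]mulrA xyz.
by rewrite !mulrA mulfV //; ring.
Qed.

Lemma gprime_coprime x y : gprime x -> OO Gi y -> ~ gdvd x y ->
  exists u v, [/\ OO Gi u, OO Gi v & u * x + v * y = 1].
Proof.
move=> [xO x0 xu xp] yO xy.
have [g [u [v [[gO uO vO] [e [a aO xa] [b bO yb]]]]]] := bezout xO yO x0.
have a0 : a != 0 by apply: contra_neq x0 => a0; rewrite xa a0 mul0r.
have g0 : g != 0 by apply: contra_neq x0 => g0; rewrite xa g0 mulr0.
have [|[c cO ac]|[c cO gc]] := xp a g aO gO.
- by exists 1; [exact: OO1|rewrite mul1r].
- have cg : c * g = 1 by apply: (mulfI a0); rewrite mulr1 [RHS]ac xa; ring.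
  exists (c * u), (c * v); split; [exact: OOM|exact: OOM|].
  by rewrite -!mulrA -mulrDr -e.
- exfalso; apply: xy; exists (b * c); first exact: OOM.
  by rewrite yb gc mulrA.
Qed.

Lemma exists_gprime x : OO Gi x -> x != 0 -> ~ iunit x -> exists2 p, gprime p & gdvd p x.
Proof.
move=> xO x0 xu.
have ex : exists n : nat, `[< exists p, [/\ OO Gi p, ~ iunit p, gdvd p x & gN p = n] >].
  by exists (gN x); apply/asboolP; exists x; split=> //; exists 1; [exact: OO1|rewrite mul1r].
case: (ex_minnP ex) => n /asboolP[p [pO pu px pn]] nmin; exists p => //.
have p0 : p != 0.
  by apply: contra_neq x0 => p0; case: px => c _ ->; rewrite p0 mulr0.
apply: irr_prime => // a b aO bO pab.
apply: contrapT => /not_orP[au bu].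
have := pn; rewrite pab gNM // => e.
have n0 : (0 < n)%N by rewrite -pn lt0n gN_eq0.
have : (n <= gN a)%N.
  apply: nmin; apply/asboolP; exists a; split=> //.
  by case: px => c cO ->; exists (c * b); [exact: OOM|rewrite pab; ring].
have b1 : (1 < gN b)%N.
  have : gN b <> 1%N by move=> /(gN_unit bO).
  have : (0 < gN b)%N by move: n0; rewrite -e muln_gt0 => /andP[].
  by lia.
by nia.
Qed.

Lemma gprime_norm x p : OO Gi x -> gN x = p -> prime p -> gprime x.
Proof.
move=> xO xp pp.
have x0 : x != 0 by rewrite -gN_eq0 // xp -lt0n prime_gt0.
apply: irr_prime => //; first by move/(gN_unit xO); rewrite xp => p1; rewrite p1 in pp.
move=> a b aO bO xab; have : (gN a %| p)%N by rewrite -xp xab gNM // dvdn_mulr.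
move/primeP: pp => [p1 /(_ _)] h /h /orP[/eqP|/eqP ap].
  by move/(gN_unit aO); left.
right; apply/gN_unit => //; apply/eqP; rewrite -(eqn_pmul2l (_ : 0 < gN a)%N).
  by rewrite muln1 -gNM // -xab xp ap.
by rewrite ap; lia.
Qed.

(** A proper factor would have norm [q], a sum of two squares congruent to 3 modulo 4. *)
Lemma gprime_inert q : prime q -> (q %% 4 = 3)%N -> gprime q%:R.
Proof.
move=> pq q4; have qO : OO Gi q%:R by split; [mem|isi].
have Nq : gN q%:R = (q ^ 2)%N.
  have -> : q%:R = (q%:Z)%:~R + 0%:~R * i by rewrite mul0r addr0.
  by rewrite gN_int expr0n addr0 abszX.
have q1 : (1 < q)%N := prime_gt1 pq.
apply: irr_prime => //.
- by rewrite natL_eq0; lia.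
- by move/(gN_unit qO); rewrite Nq; nia.
move=> a b aO bO qab.
have := congr1 gN qab; rewrite Nq gNM // => e.
have : (gN a %| q ^ 2)%N by rewrite e dvdn_mulr.
move/(dvdn_pfactor _ _ pq) => [[|[|[|m]]] // _ ga].
- by left; apply/gN_unit => //; rewrite ga.
- exfalso; move/OOGiP: aO ga => [x [y ->]]; rewrite gN_int expn1 => h.
  have : x ^+ 2 + y ^+ 2 = q%:Z by rewrite -h gez0_abs // addr_ge0 ?sqr_ge0.
  have -> : q%:Z = 4 * (q %/ 4)%N%:Z + 3 by lia.
  by clear; have [x' [->|->]] := int_parity x; have [y' [->|->]] := int_parity y; lia.
- right; apply/gN_unit => //; apply/eqP; rewrite -(eqn_pmul2l (_ : 0 < q ^ 2)%N); last by nia.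
  by rewrite muln1 {2}e ga.
Qed.

Lemma Gi_units u : u \in Gi -> iunit u -> [\/ u = 1, u = -1, u = i | u = - i].
Proof.
move=> uG iu; have uO : OO Gi u by split=> //; case: iu.
move/(gN_unit uO): iu; move/OOGiP: uO => [a [b ->]]; rewrite gN_int => h.
have {}h : a ^+ 2 + b ^+ 2 = 1 by lia.
have [[-> ->]|[[-> ->]|[[-> ->]|[-> ->]]]] :
  (a = 1 /\ b = 0) \/ (a = -1 /\ b = 0) \/ (a = 0 /\ b = 1) \/ (a = 0 /\ b = -1) by nia.
- by constructor 1; ring.
- by constructor 2; ring.
- by constructor 3; ring.
- by constructor 4; ring.
Qed.

Lemma gprime_sqr_false p b t : gprime p -> OO Gi b -> ~ gdvd p b -> t \in Gi ->
  t ^+ 2 = p * b -> False.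
Proof.
move=> [pO p0 pu pp] bO pb tG e.
have tO : OO Gi t by split=> //; apply: isint_sqr; rewrite e; apply: isintM; [case: pO|case: bO].
have [c cO tc] : gdvd p t.
  by have [] // := pp t t tO tO; exists b => //; rewrite -expr2 e mulrC.
apply: pb; exists (c ^+ 2); first exact: OOX.
by apply: (mulfI p0); rewrite -e tc; ring.
Qed.

(** As over the integers, the square of a gcd of [x] and [u] is associated to [x]; the Bezout
    relations show divisibility in both directions. *)
Lemma coprime_sqr_Gi x y u a b : OO Gi x -> OO Gi y -> OO Gi u -> OO Gi a -> OO Gi b -> x != 0 ->
  x * y = u ^+ 2 -> a * x + b * y = 1 ->
  exists2 w, iunit w & exists2 c, c \in Gi & x = w * c ^+ 2.
Proof.
move=> xO yO uO aO bO x0 xy ab.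
have [g [v [w [[gO vO wO] [e [c cO xc] [d dO ud]]]]]] := bezout xO uO x0.
have g0 : g != 0 by apply: contra_neq x0 => g0; rewrite xc g0 mulr0.
have c0 : c != 0 by apply: contra_neq x0 => c0; rewrite xc c0 mul0r.
have h1 : gdvd x (g ^+ 2).
  exists (v ^+ 2 * x + 2%:R * v * w * u + w ^+ 2 * y).
    have nO : OO Gi (2%:R : L) by split; [mem|isi].
    by do 2?apply: OOD; repeat first [apply: OOM|apply: OOX|done].
  by apply: (lin_comb (c := - w ^+ 2) xy); rewrite e; ring.
have h2 : isint (x / g ^+ 2).
  have -> : x / g ^+ 2 = a * c ^+ 2 + b * d ^+ 2.
    apply: (mulIf (expf_neq0 2 g0)); rewrite divfK ?expf_neq0 //.
    have -> : (a * c ^+ 2 + b * d ^+ 2) * g ^+ 2 = a * (c * g) ^+ 2 + b * (d * g) ^+ 2 by ring.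
    rewrite -xc -ud -xy; apply: (lin_comb (c := - x) ab); ring.
  have [_ ai] := aO; have [_ bi] := bO; have [_ ci] := cO; have [_ di] := dO; isi.
exists (x / g ^+ 2); last by exists g; [case: gO|rewrite divfK ?expf_neq0].
case: h1 => f [_ fi] fe.
split=> //; first by rewrite mulf_neq0 ?invr_eq0 ?expf_neq0.
by rewrite invfM invrK fe mulrCA mulVf // mulr1.
Qed.

End Gaussian.

(** * Units of multiquadratic fields *)

Section Units.
Variable L : splittingFieldType rat.
Implicit Types (E F K k : {subfield L}) (g h : 'AEnd(L)) (x y z u w a b t r : L).
Local Notation OO := ring_of_integers.

Lemma sqrt_notQ y (r : nat) (M : int) : prime r -> ~~ (r %| M)%Z ->
  y ^+ 2 = (r%:Z * M)%:~R -> y \notin QQ L.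
Proof. by move=> pr rM e; apply/negP=> yQ; exact: (rat_sqr_prime pr rM yQ e). Qed.

Lemma fix_adjoin E g h y : y ^+ 2 \in E -> (forall x, x \in E -> g (h x) = x) ->
  g (h y) = y -> forall x, x \in <<E; y>>%VS -> g (h x) = x.
Proof.
move=> yy gE gy x /(quad_coord yy)[a [b [aE bE ->]]].
by rewrite !rmorphD !rmorphM /= gy !gE.
Qed.

Lemma fix1_adjoin E g y : y ^+ 2 \in E -> (forall x, x \in E -> g x = x) ->
  g y = y -> forall x, x \in <<E; y>>%VS -> g x = x.
Proof.
move=> yy gE gy x /(quad_coord yy)[a [b [aE bE ->]]].
by rewrite rmorphD rmorphM /= gy !gE.
Qed.

Lemma fixQ g x : x \in QQ L -> g x = x.
Proof. by move=> /mem1P[a ->]; exact: aut_rat. Qed.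

Lemma fixQ1 g y : y ^+ 2 \in QQ L -> g y = y -> forall x, x \in <<QQ L; y>>%VS -> g x = x.
Proof. by move=> yy; apply: fix1_adjoin => // x; exact: fixQ. Qed.

Lemma fixQ2 g y z : y ^+ 2 \in QQ L -> z ^+ 2 \in QQ L -> g y = y -> g z = z ->
  forall x, x \in <<<<QQ L; y>>; z>>%VS -> g x = x.
Proof.
move=> yy zz gy gz; apply: fix1_adjoin => //; last exact: fixQ1.
exact: (subvP (subv_adjoin _ _)).
Qed.

Lemma mem_adj E y x : x \in E -> x \in <<E; y>>%VS.
Proof. exact: (subvP (subv_adjoin _ _)). Qed.

Lemma adj_sub E F y : (E <= F)%VS -> y \in F -> (<<E; y>> <= F)%VS.
Proof. by move=> EF yF; apply/FadjoinP. Qed.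

Lemma adjQ2_sub F y z : y \in F -> z \in F -> (<<<<QQ L; y>>; z>> <= F)%VS.
Proof. by move=> yF zF; apply: (@adj_sub <<QQ L; y>>%AS) => //; apply: adj_sub => //; apply: sub1v. Qed.

Lemma adjQ3_sub F y z x : y \in F -> z \in F -> x \in F -> (<<<<<<QQ L; y>>; z>>; x>> <= F)%VS.
Proof.
move=> yF zF xF; apply: (@adj_sub <<<<QQ L; y>>; z>>%AS) => //; exact: adjQ2_sub.
Qed.

(** By [quad_mem] applied twice, [x] can lie in Q(z, y) only if one of [x], [x y], [x z], [x z y] is
    rational; otherwise [x] changes sign over that field. *)
Lemma sign_auts x y z :
  x ^+ 2 \in QQ L -> y ^+ 2 \in QQ L -> z ^+ 2 \in QQ L ->
  [/\ x \notin QQ L, x * y \notin QQ L, x * z \notin QQ L & x * z * y \notin QQ L] ->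
  exists g : 'AEnd(L), [/\ g x = - x, g y = y & g z = z].
Proof.
move=> xx yy zz [h1 h2 h3 h4].
have yz : y ^+ 2 \in <<QQ L; z>>%VS by apply: mem_adj.
have [||g [gE gx]] := @quad_aut L <<<<QQ L; z>>; y>>%AS x.
- by do 2!apply: mem_adj.
- apply/negP=> /(quad_mem (E := <<QQ L; z>>%AS) yz (mem_adj _ xx)).
  have xy2 : (x * y) ^+ 2 \in QQ L by rewrite exprMn; mem.
  case=> /(quad_mem zz); [move/(_ xx)|move/(_ xy2)] => -[]; apply/negP => //.
  by rewrite mulrAC.
exists g; split=> //; apply: gE; first exact: memv_adjoin.
by apply: mem_adj; exact: memv_adjoin.
Qed.

Section NoNormI.
Variables (x i : L) (m m' p : nat) (sigma tau : 'AEnd(L)).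
Hypotheses (ii : i ^+ 2 = -1) (xx : x ^+ 2 = m%:R).
Hypotheses (pp : prime p) (p4 : (4 < p)%N) (mE : m = (p * m')%N) (pm' : ~~ (p %| m')%N).
Hypothesis m4 : (m %% 4 = 1)%N.
Hypotheses (sx : sigma x = - x) (si : sigma i = i) (tx : tau x = x) (ti : tau i = - i).
Let F : {subfield L} := <<<<QQ L; i>>; x>>%AS.

Let xQ : x ^+ 2 \in QQ L. Proof. by rewrite xx; mem. Qed.
Let iQ : i ^+ 2 \in QQ L. Proof. by rewrite ii; mem. Qed.

(* 2 is unramified in the quadratic field of x, as m is 1 modulo 4. *)
Lemma two_unit_not_sqr y w : y \in <<QQ L; x>>%VS -> iunit w -> y ^+ 2 = 2%:R * w -> False.
Proof.
move=> yx [w0 wi wv] e.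
have yi : isint y by apply: isint_sqr; rewrite e; isi.
have [a [b [aQ bQ ye]]] := quad_coord xQ yx.
have sy : sigma y = a - b * x by rewrite ye rmorphD rmorphM /= sx (fixQ _ aQ) (fixQ _ bQ) mulrN.
have [N NE] : exists N : int, y * sigma y = N%:~R.
  apply: isint_rat; last by isi.
  have -> : y * sigma y = a ^+ 2 - b ^+ 2 * x ^+ 2 by rewrite sy ye; ring.
  by mem.
have [T TE] : exists T : int, y + sigma y = T%:~R.
  by apply: isint_rat; [rewrite sy ye addrACA subrr addr0; mem|isi].
have wQ : w + sigma w \in QQ L.
  have w2 : w = y ^+ 2 / 2%:R by rewrite e mulrC mulKf // two_neq0.
  have -> : w + sigma w = (a ^+ 2 + b ^+ 2 * x ^+ 2).
    have t0 := two_neq0 L.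
    by rewrite w2 fmorph_div rmorphXn rmorph_nat /= sy ye; field; rewrite ?t0.
  by mem.
have [W WE] : exists W : int, w + sigma w = W%:~R by apply: isint_rat => //; isi.
have wu : iunit (w * sigma w) by apply: iunitM; [|apply: iunit_aut].
have N2 : N ^+ 2 = 4 \/ N ^+ 2 = -4.
  have [] := @iunit_rat L (w * sigma w) _ wu.
  - have -> : w * sigma w = (y * sigma y) ^+ 2 / 4%:R.
      rewrite exprMn -rmorphXn /= e rmorphM rmorph_nat /=; have t0 := two_neq0 L.
      have f0 : 4%:R != 0 :> L by rewrite natL_eq0.
      by field; rewrite ?t0 ?f0.
    by rewrite NE; mem.
  - move=> h; left; apply: (@intL_inj L); rewrite rmorphXn /= -NE exprMn -rmorphXn /= e rmorphM rmorph_nat /=.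
    by apply: (lin_comb (c := 4%:R) h); ring.
  - move=> h; right; apply: (@intL_inj L); rewrite rmorphXn /= -NE exprMn -rmorphXn /= e rmorphM rmorph_nat /=.
    by apply: (lin_comb (c := 4%:R) h); ring.
have {}N2 : N = 2 \/ N = -2 by move: N2; clear; nia.
have T2 : T ^+ 2 = 2 * W + 2 * N.
  apply: (@intL_inj L); rewrite rmorphXn rmorphD !rmorphM /= -TE -WE -NE.
  have -> : (y + sigma y) ^+ 2 = y ^+ 2 + sigma (y ^+ 2) + 2%:R * (y * sigma y).
    by rewrite rmorphXn /=; ring.
  by rewrite e rmorphM rmorph_nat /=; ring.
have [T' T'E] : exists T', T = 2 * T'.
  by have [T' [h|h]] := int_parity T; exists T' => //; exfalso; move: T2; rewrite h; clear; lia.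
have aE : a = T'%:~R.
  apply: (mulfI (two_neq0 L)).
  have -> : 2%:R * a = y + sigma y by rewrite sy ye; ring.
  by rewrite TE T'E rmorphM.
have [B BE] : exists B : int, b * m%:R = B%:~R.
  apply: isint_rat; first by mem.
  apply: isint_sqr; have -> : (b * m%:R) ^+ 2 = m%:R * (a ^+ 2 - y * sigma y).
    rewrite sy ye.
    have -> : (a + b * x) * (a - b * x) = a ^+ 2 - b ^+ 2 * x ^+ 2 by ring.
    by rewrite xx; ring.
  by rewrite aE NE; isi.
have key : m%:Z * T' ^+ 2 - B ^+ 2 = m%:Z * N.
  apply: (@intL_inj L); rewrite rmorphB rmorphM !rmorphXn rmorphM /= -NE -BE -aE sy ye.
  rewrite -pmulrn.
  have -> : (a + b * x) * (a - b * x) = a ^+ 2 - b ^+ 2 * x ^+ 2 by ring.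
  by rewrite xx; ring.
(* Modulo 4 the identity reads [T'^2 - B^2 = N] with [N] equal to 2 or -2, which no difference of
   two squares is. *)
have mm : m%:Z = 4 * (m %/ 4)%N%:Z + 1 by have := m4; clear; lia.
move: key; rewrite mm; clear -N2; move: (Posz (m %/ 4)) => n.
have [t [->|->]] := int_parity T'; have [c [->|->]] := int_parity B; case: N2 => ->; lia.
Qed.

(** The norm [B] of [A] to the imaginary field Q(i x) is 1 or -1, and the norm [e] to Q(x) is a unit
    there. Together with [A * sigma A] equal to [i] or [- i] this gives [A ^+ 2 = w i] with [w] a
    unit of Q(x). Multiplying by [(1 + i) ^+ 2 = 2 i] makes 2 a unit times a square in Q(x). *)
Lemma no_unit_norm_i A : A \in F -> iunit A -> A * sigma A = i \/ A * sigma A = - i -> False.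
Proof.
move=> AF Au AsA.
have FF y : y \in <<<<QQ L; i>>; x>>%VS -> [/\ y \in <<<<QQ L; i * x>>; i>>%VS & y \in <<<<QQ L; x>>; i>>%VS].
  move=> yF; split; apply: (subvP _ _ yF); apply: adjQ2_sub.
  - exact: memv_adjoin.
  - have xe : x = - ((i * x) * i) by rewrite mulrAC -expr2 ii; ring.
    rewrite [X in X \in _]xe rpredN; apply: rpredM; last exact: memv_adjoin.
    exact/mem_adj/memv_adjoin.
  - exact: memv_adjoin.
  - exact/mem_adj/memv_adjoin.
have ixQ : (i * x) ^+ 2 \in QQ L by rewrite exprMn; mem.
have sF y : y \in F -> sigma y \in F.
  apply: (aut_adjoin (E := <<QQ L; i>>%AS)); last by right.
    by move=> z zi; rewrite (fixQ1 iQ).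
  exact: mem_adj.
have tF y : y \in F -> tau y \in F.
  apply: (aut_adjoin (E := <<QQ L; i>>%AS)); last by left.
    by apply: aut_adjoin => // [z zQ|]; [rewrite fixQ|right].
  exact: mem_adj.
have ss y : y \in F -> sigma (sigma y) = y.
  apply: fix_adjoin; [exact: mem_adj| |by rewrite sx rmorphN /= sx opprK].
  by apply: fix_adjoin => //; [move=> z zQ; rewrite !fixQ|rewrite !si].
have tt y : y \in F -> tau (tau y) = y.
  apply: fix_adjoin; [exact: mem_adj| |by rewrite !tx].
  by apply: fix_adjoin => //; [move=> z zQ; rewrite !fixQ|rewrite ti rmorphN /= ti opprK].
have st y : y \in F -> sigma (tau y) = tau (sigma y).
  move=> /(quad_coord (mem_adj _ xQ))[a [b [aE bE ->]]].
  have [a1 [a2 [h1 h2 ->]]] := quad_coord iQ aE.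
  have [b1 [b2 [h3 h4 ->]]] := quad_coord iQ bE.
  rewrite !(rmorphD, rmorphM) /= !(fixQ _ h1, fixQ _ h2, fixQ _ h3, fixQ _ h4, tx, ti, sx, si).
  by rewrite !rmorphN /= !(tx, ti, sx, si).
have sA := sF _ AF; have tA := tF _ AF; have stA := sF _ tA.
pose B := A * sigma (tau A).
have B1 : B = 1 \/ B = -1.
  apply: (iunit_imag pp p4 mE pm' (y := i * x)).
  - by rewrite exprMn ii xx mulN1r.
  - have BF : B \in F by rewrite /B; mem.
    apply: (quad_fixed (E := <<QQ L; i * x>>%AS) (g := (sigma \o tau)%AF) (y := i)).
    + exact: mem_adj.
    + move=> z; rewrite comp_lfunE; apply: fix_adjoin => //; first by move=> v vQ; rewrite !fixQ.
      by rewrite !rmorphM /= ti tx rmorphN /= si sx mulrNN.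
    + by rewrite comp_lfunE /= ti rmorphN /= si.
    + by case: (FF _ BF).
    + by rewrite comp_lfunE /= /B !rmorphM /= -(st _ tA) tt // ss // mulrC.
  - by apply: iunitM => //; do 2!apply: iunit_aut.
pose e := A * tau A.
have ex : e \in <<QQ L; x>>%VS.
  have eF : e \in F by rewrite /e; mem.
  apply: (quad_fixed (E := <<QQ L; x>>%AS) (g := tau) (y := i)) => //.
  - exact: mem_adj.
  - exact: fixQ1.
  - by case: (FF _ eF).
  - by rewrite /e rmorphM /= tt // mulrC.
have eu : iunit e by apply: iunitM => //; apply: iunit_aut.
have A2 : A ^+ 2 * sigma B = e * (A * sigma A).
  by rewrite /B /e rmorphM /= ss //; ring.
have [w [wu wx we]] : exists w, [/\ iunit w, w \in <<QQ L; x>>%VS & A ^+ 2 = w * i].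
  have sB : sigma B = B by case: B1 => ->; rewrite ?rmorphN rmorph1.
  move: A2; rewrite sB; case: B1 => ->; case: AsA => ->; rewrite ?mulr1 ?mulrN1 ?mulrN.
  - by exists e.
  - by move=> ->; exists (- e); rewrite mulNr rpredN; split=> //; exact: iunitN.
  - by move/(congr1 -%R); rewrite opprK => ->; exists (- e); rewrite mulNr rpredN; split=> //; exact: iunitN.
  - by move=> /oppr_inj ->; exists e.
pose C := A * (1 + i).
have CF : C \in F by have : i \in F := mem_adj _ (memv_adjoin _ _) => ?; rewrite /C; mem.
have C2 : C ^+ 2 = 2%:R * (- w).
  rewrite /C exprMn we; have -> : (1 + i) ^+ 2 = 1 + i ^+ 2 + 2%:R * i by ring.
  rewrite ii subrr add0r; have -> : w * i * (2%:R * i) = 2%:R * w * i ^+ 2 by ring.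
  by rewrite ii; ring.
have [||Cx|Cx] := @quad_mem L <<QQ L; x>>%AS i C (mem_adj _ iQ).
- by rewrite C2; mem.
- by case: (FF _ CF).
- exact: (two_unit_not_sqr Cx (iunitN wu) C2).
- apply: (two_unit_not_sqr Cx wu).
  by rewrite exprMn C2 ii; ring.
Qed.

End NoNormI.

(** [n] is unramified in Q(z). The norm of [y] is [n] or [- n], and its trace [T] is divisible by
    [n], so [T ^+ 2 - 4 N] contains [n] exactly once ([n] being odd). Yet [a] times this number is a
    rational square, and [n] does not divide [a]. *)
Lemma unramified_sqr y z w g (n : nat) (a : int) : prime n -> odd n -> ~~ (n %| a)%Z ->
  z ^+ 2 = a%:~R -> g z = - z -> y \in <<QQ L; z>>%VS -> iunit w -> y ^+ 2 = n%:R * w -> False.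
Proof.
move=> pn on na zz gz yz wu e.
have zQ : z ^+ 2 \in QQ L by rewrite zz; mem.
have yi : isint y by apply: isint_sqr; rewrite e; have := iunit_int wu => ?; isi.
have [b [c [bQ cQ ye]]] := quad_coord zQ yz.
have gy : g y = b - c * z by rewrite ye rmorphD rmorphM /= gz (fixQ _ bQ) (fixQ _ cQ) mulrN.
have n0 : n%:R != 0 :> L by rewrite natL_eq0 -lt0n prime_gt0.
have wE : w = y ^+ 2 / n%:R by rewrite e mulrC mulKf.
have gw : g w = (g y) ^+ 2 / n%:R by rewrite wE fmorph_div rmorphXn rmorph_nat.
have TQ : y + g y \in QQ L by rewrite gy ye addrACA subrr addr0; mem.
have NQ : y * g y \in QQ L.
  have -> : y * g y = b ^+ 2 - c ^+ 2 * z ^+ 2 by rewrite gy ye; ring.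
  by mem.
have [T TE] := isint_rat TQ (isintD yi (isint_aut g yi)).
have [N NE] := isint_rat NQ (isintM yi (isint_aut g yi)).
have wi := iunit_int wu.
have wN : w * g w = (y * g y / n%:R) ^+ 2 by rewrite gw wE; field.
have yn1 : y * g y / n%:R = 1 \/ y * g y / n%:R = -1.
  apply: iunit_rat; first by mem.
  by apply: iunit_sqr; rewrite -wN; apply: iunitM => //; apply: iunit_aut.
have Nn : N = n%:Z \/ N = - n%:Z.
  case: yn1 => h; [left|right]; apply: (@intL_inj L); rewrite -NE -[LHS](divfK n0) h.
    by rewrite mul1r.
  by rewrite mulN1r rmorphN.
have WQ : w + g w \in QQ L.
  have -> : w + g w = ((y + g y) ^+ 2 - 2%:R * (y * g y)) / n%:R.
    by rewrite gw wE; field.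
  by mem.
have [W WE] := isint_rat WQ (isintD wi (isint_aut g wi)).
have T2 : T ^+ 2 = n%:Z * W + 2 * N.
  apply: (@intL_inj L); rewrite rmorphXn rmorphD !rmorphM /= -TE -WE -NE -pmulrn.
  by rewrite gw {1}wE; field.
have nT : (n %| T)%Z.
  have : (n %| T ^+ 2)%Z.
    by apply/dvdzP; case: Nn => Nn; [exists (W + 2)|exists (W - 2)]; rewrite T2 Nn; ring.
  by rewrite !dvdzE abszX Euclid_dvdX // andbT.
case/dvdzP: nT => T' T'E.
have cz : (2%:R * c * a%:~R) ^+ 2 = (a * (T ^+ 2 - 4 * N))%:~R.
  rewrite rmorphM rmorphB rmorphXn rmorphM /= -TE -NE.
  have -> : (y + g y) ^+ 2 - 4%:R * (y * g y) = 4%:R * c ^+ 2 * z ^+ 2 by rewrite gy ye; ring.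
  by rewrite zz; ring.
have [e1 eN] : exists e1 : int, ~~ (n %| e1)%Z /\ T ^+ 2 - 4 * N = n%:Z * e1.
  have n4 (c4 : int) : c4 = 4 \/ c4 = -4 -> ~~ (n %| n%:Z * T' ^+ 2 + c4)%Z.
    move=> h; apply/negP=> /dvdzP[r re].
    have : (n %| c4)%Z by apply/dvdzP; exists (r - T' ^+ 2); rewrite mulrBl -re; ring.
    rewrite dvdzE; have -> : `|c4|%N = (2 ^ 2)%N by case: h => ->.
    rewrite Euclid_dvdX // andbT /= => /dvdn_leq; have := prime_gt1 pn.
    by move: on; clear; case: n => [|[|[|?]]] //; lia.
  case: Nn => ->.
    by exists (n%:Z * T' ^+ 2 + -4); split; [apply: n4; right|rewrite T'E; ring].
  by exists (n%:Z * T' ^+ 2 + 4); split; [apply: n4; left|rewrite T'E; ring].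
case: eN => ne1 e1E.
apply: (@rat_sqr_prime L (2%:R * c * a%:~R) n (a * e1) pn).
- rewrite dvdzE abszM Euclid_dvdM //; move: na ne1; rewrite !dvdzE => /negbTE -> /negbTE ->.
  by [].
- by mem.
- by rewrite cz e1E; congr (_%:~R); ring.
Qed.

End Units.

(** * Elements that are units times squares, and obstructions to this *)

Section SquareClasses.
Variable L : splittingFieldType rat.
Implicit Types (E F K k : {subfield L}) (g h : 'AEnd(L)) (x y z u w a b t r : L).
Local Notation OO := ring_of_integers.

(** For [r] in [E] the unit lies in [E] as well, being [r / y ^+ 2]. *)
Definition sqclass E r := exists y w, [/\ y \in E, y != 0, iunit w & r = w * y ^+ 2].

Lemma sqclassM E r t : sqclass E r -> sqclass E t -> sqclass E (r * t).
Proof.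
move=> [y [w [yE y0 wu ->]]] [z [v [zE z0 vu ->]]]; exists (y * z), (w * v).
by split; [mem|rewrite mulf_neq0|exact: iunitM|ring].
Qed.

Lemma sqclassX E y : y \in E -> y != 0 -> sqclass E (y ^+ 2).
Proof. by move=> yE y0; exists y, 1; split=> //; [exact: iunit1|rewrite mul1r]. Qed.

Lemma sqclassU E u : iunit u -> sqclass E u.
Proof. by move=> uu; exists 1, u; split; rewrite ?oner_eq0 ?expr1n ?mulr1 ?rpred1. Qed.

Lemma sqclassV E r : sqclass E r -> sqclass E r^-1.
Proof.
move=> [y [w [yE y0 wu ->]]]; exists y^-1, w^-1.
by split; [rewrite rpredV|rewrite invr_eq0|exact: iunitV|rewrite invfM exprVn].
Qed.

Lemma sqclassS E F r : (E <= F)%VS -> sqclass E r -> sqclass F r.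
Proof. by move=> /subvP EF [y [w [yE y0 wu ->]]]; exists y, w; split=> //; exact: EF. Qed.

Lemma sqclass_mulX E r y : y \in E -> y != 0 -> sqclass E (r * y ^+ 2) -> sqclass E r.
Proof.
move=> yE y0 h; have /sqclassV h2 := sqclassX yE y0.
by have := sqclassM h h2; rewrite mulfK // expf_neq0.
Qed.

Section Obstruction.
Variables (ra rb i : L) (a n n' : nat) (ga gb gi : 'AEnd(L)).
Hypotheses (raE : ra ^+ 2 = a%:R) (rbE : rb ^+ 2 = (n * n')%:R) (ii : i ^+ 2 = -1).
Hypotheses (gaa : ga ra = - ra) (gab : ga rb = rb) (gai : ga i = i).
Hypotheses (gba : gb ra = ra) (gbb : gb rb = - rb) (gbi : gb i = i).
Hypotheses (gia : gi ra = ra) (gib : gi rb = rb) (gii : gi i = - i).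
Hypotheses (pn : prime n) (pn' : prime n') (on : odd n) (on' : odd n').
Hypotheses (na : ~~ (n %| a)%N) (na' : ~~ (n' %| a)%N) (n4 : (4 < n)%N) (nn' : n != n').

Let K : {subfield L} := <<<<<<QQ L; i>>; ra>>; rb>>%AS.
Let raQ : ra ^+ 2 \in QQ L. Proof. by rewrite raE; mem. Qed.
Let rbQ : rb ^+ 2 \in QQ L. Proof. by rewrite rbE; mem. Qed.
Let iQ : i ^+ 2 \in QQ L. Proof. by rewrite ii; mem. Qed.
Let irQ : (i * rb) ^+ 2 \in QQ L. Proof. by rewrite exprMn; mem. Qed.
Let irE : (i * rb) ^+ 2 = - (n * n')%:R. Proof. by rewrite exprMn ii rbE mulN1r. Qed.

Lemma Ka : ra \in K. Proof. by apply/mem_adj/memv_adjoin. Qed.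
Lemma Kb : rb \in K. Proof. exact: memv_adjoin. Qed.
Lemma Ki : i \in K. Proof. by do 2!apply: mem_adj; exact: memv_adjoin. Qed.

Lemma coordK z : z \in K -> exists c : 'I_8 -> L, (forall j, c j \in QQ L) /\
  z = c (inord 0) + c (inord 1) * i + c (inord 2) * ra + c (inord 3) * (i * ra)
    + c (inord 4) * rb + c (inord 5) * (i * rb) + c (inord 6) * (ra * rb) + c (inord 7) * (i * ra * rb).
Proof.
have rbK : rb ^+ 2 \in <<<<QQ L; i>>; ra>>%VS by do 2!apply: mem_adj.
have raK : ra ^+ 2 \in <<QQ L; i>>%VS by apply: mem_adj.
move=> /(quad_coord (E := <<<<QQ L; i>>; ra>>%AS) rbK)[u [v [/(quad_coord (E := <<QQ L; i>>%AS) raK)[u0 [u1 [h1 h2 ->]]]]]].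
move=> /(quad_coord (E := <<QQ L; i>>%AS) raK)[v0 [v1 [h3 h4 ->]]] ->.
have [a0 [a1 [? ? ->]]] := quad_coord iQ h1; have [a2 [a3 [? ? ->]]] := quad_coord iQ h2.
have [a4 [a5 [? ? ->]]] := quad_coord iQ h3; have [a6 [a7 [? ? ->]]] := quad_coord iQ h4.
exists (fun j : 'I_8 => nth 0 [:: a0; a1; a2; a3; a4; a5; a6; a7] j); split.
  by case; do 8?case=> //=.
by rewrite !inordK //=; ring.
Qed.

(** Automorphisms of [L] may fail to commute or to be involutions; on [K] they only change the signs
    of the three generators. *)
Lemma commK g h : (g ra = ra \/ g ra = - ra) -> (g rb = rb \/ g rb = - rb) -> (g i = i \/ g i = - i) ->
  (h ra = ra \/ h ra = - ra) -> (h rb = rb \/ h rb = - rb) -> (h i = i \/ h i = - i) ->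
  forall z, z \in K -> [/\ g z \in K, g (g z) = z & g (h z) = h (g z)].
Proof.
move=> ga' gb' gi' ha hb hi z /coordK[c [cQ ->]].
have cg (f : 'AEnd(L)) j : f (c j) = c j by apply: fixQ.
have cK j : c j \in K by do 3!apply: mem_adj.
have kA := Ka; have kB := Kb; have kI := Ki.
split.
- rewrite !(rmorphD, rmorphM) /= !cg.
  have [gA gB gI] : [/\ g ra \in K, g rb \in K & g i \in K].
    by split; [case: ga' => ->|case: gb' => ->|case: gi' => ->]; rewrite ?rpredN.
  by mem; apply: cK.
- rewrite !(rmorphD, rmorphM) /= !cg.
  have e1 : g (g ra) = ra by case: ga' => e; rewrite ?e ?rmorphN /= ?e ?opprK.
  have e2 : g (g rb) = rb by case: gb' => e; rewrite ?e ?rmorphN /= ?e ?opprK.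
  have e3 : g (g i) = i by case: gi' => e; rewrite ?e ?rmorphN /= ?e ?opprK.
  by rewrite e1 e2 e3.
- rewrite !(rmorphD, rmorphM) /= !cg.
  have e1 : g (h ra) = h (g ra).
    by case: ga' => e; case: ha => e'; rewrite ?(e, e') ?rmorphN /= ?(e, e').
  have e2 : g (h rb) = h (g rb).
    by case: gb' => e; case: hb => e'; rewrite ?(e, e') ?rmorphN /= ?(e, e').
  have e3 : g (h i) = h (g i).
    by case: gi' => e; case: hi => e'; rewrite ?(e, e') ?rmorphN /= ?(e, e').
  by rewrite e1 e2 e3.
Qed.

(* The norm z of alpha to T = Q(ra, i rb) satisfies z^2 = n w with w a unit;
   comparing the three quadratic subfields of T forces gi z = z or gi z = - z,
   which makes n or n' a square up to units in Q(ra). *)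
Lemma prime_sqclass_obstruction mu : mu \in <<QQ L; i>>%VS -> mu * gi mu = n%:R -> ~ sqclass K mu.
Proof.
move=> muG mun [al [w [alK al0 wu muE]]].
have kA := Ka; have kB := Kb; have kI := Ki.
have n0 : n%:R != 0 :> L by rewrite natL_eq0 -lt0n prime_gt0.
have Sa : [/\ ga ra = ra \/ ga ra = - ra, ga rb = rb \/ ga rb = - rb & ga i = i \/ ga i = - i] by split; auto.
have Sb : [/\ gb ra = ra \/ gb ra = - ra, gb rb = rb \/ gb rb = - rb & gb i = i \/ gb i = - i] by split; auto.
have Si : [/\ gi ra = ra \/ gi ra = - ra, gi rb = rb \/ gi rb = - rb & gi i = i \/ gi i = - i] by split; auto.
case: Sa => Sa1 Sa2 Sa3; case: Sb => Sb1 Sb2 Sb3; case: Si => Si1 Si2 Si3.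
have aa z : z \in K -> [/\ ga z \in K, ga (ga z) = z & ga (gi z) = gi (ga z)].
  exact: commK.
have bb z : z \in K -> [/\ gb z \in K, gb (gb z) = z & gb (gi z) = gi (gb z)].
  exact: commK.
have ji z : z \in K -> [/\ gi z \in K, gi (gi z) = z & gi (ga z) = ga (gi z)].
  exact: commK.
have KT z : z \in K -> z \in <<<<<<QQ L; ra>>; i * rb>>; i>>%VS.
  apply: (subvP _ _); apply: adjQ3_sub.
  - exact: memv_adjoin.
  - by do 2!apply: mem_adj; exact: memv_adjoin.
  - have e : rb = - ((i * rb) * i) by rewrite mulrAC -expr2 ii; ring.
    rewrite [X in X \in _]e rpredN; apply: rpredM; last exact: memv_adjoin.
    by apply/mem_adj/memv_adjoin.
pose g : 'AEnd(L) := (gi \o gb)%AF.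
have gE z : g z = gi (gb z) by rewrite /g comp_lfunE.
pose z := al * g al.
have [gbal1 gbal2 gbal3] := bb _ alK.
have [gal1 gal2 gal3] := ji _ gbal1.
have zK : z \in K by rewrite /z gE; mem.
pose w' := w * g w.
have wu' : iunit w' by apply: iunitM => //; apply: iunit_aut.
have zz : w' * z ^+ 2 = n%:R.
  rewrite -mun {1}muE; have -> : gi mu = g mu by rewrite gE (fixQ1 iQ gbi).
  by rewrite [in g mu]muE rmorphM rmorphXn /= /w' /z; ring.
have z2 : z ^+ 2 = n%:R * w'^-1 by rewrite -zz mulrC mulKf //; exact: iunit_neq0.
have zT : z \in <<<<QQ L; ra>>; i * rb>>%VS.
  apply: (quad_fixed (E := <<<<QQ L; ra>>; i * rb>>%AS) (g := g) (y := i)).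
  - by do 2!apply: mem_adj.
  - apply: fixQ2 => //; rewrite gE ?gba ?gia //.
    by rewrite rmorphM /= gbi gbb rmorphM rmorphN /= gii gib mulrNN.
  - by rewrite gE gbi gii.
  - exact: KT.
  - have ggal : g (g al) = al.
      rewrite !gE; have [_ _ ->] := bb _ gbal1; rewrite gbal2.
      by case: (ji _ alK).
    by rewrite /z rmorphM /= ggal mulrC.
have nu (f : 'AEnd(L)) : iunit (z * f z / n%:R).
  apply: iunit_sqr.
  have -> : (z * f z / n%:R) ^+ 2 = w'^-1 * (f w')^-1.
    have fz : f z ^+ 2 = n%:R * (f w')^-1.
      by rewrite -rmorphXn /= z2 rmorphM rmorph_nat fmorphV.
    have -> : (z * f z / n%:R) ^+ 2 = z ^+ 2 * f z ^+ 2 / n%:R ^+ 2 by rewrite expr_div_n exprMn.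
    by rewrite z2 fz; field; rewrite n0 fmorph_eq0 iunit_neq0.
  by apply: iunitM; apply: iunitV => //; apply: iunit_aut.
have ra0 : ra != 0.
  rewrite -sqrf_eq0 raE natL_eq0; apply: contra na => /eqP->; exact: dvdn0.
have [gaz1 gaz2 gaz3] := aa _ zK; have [giz1 giz2 giz3] := ji _ zK.
have n'a : ~~ (n %| n')%N by rewrite dvdn_prime2.
have y1 : z * ga z / n%:R = 1 \/ z * ga z / n%:R = -1.
  apply: (iunit_imag pn n4 (erefl _) n'a irE) => //.
  apply: rpredM; last by rewrite rpredV; exact: rpred_nat.
  apply: (quad_fixed (E := <<QQ L; i * rb>>%AS) (g := ga) (y := ra)).
  - exact: mem_adj.
  - by apply: fixQ1 => //; rewrite rmorphM /= gai gab.
  - exact: gaa.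
  - apply: rpredM.
      apply: (subvP _ _ zT); apply: adjQ2_sub; first exact: memv_adjoin.
      exact/mem_adj/memv_adjoin.
    have : ga z \in <<<<QQ L; ra>>; i * rb>>%VS.
      apply: (aut_adjoin (E := <<QQ L; ra>>%AS) _ _ _ zT).
      + by apply: aut_adjoin => // t tQ; rewrite fixQ.
      + exact: mem_adj.
      + by left; rewrite rmorphM /= gai gab.
    apply: (subvP _ _); apply: adjQ2_sub; first exact: memv_adjoin.
    exact/mem_adj/memv_adjoin.
  - by rewrite rmorphM /= gaz2 mulrC.
pose v := ra * (i * rb).
have vQ : v ^+ 2 \in QQ L by rewrite exprMn; mem.
have Tv t : t \in <<<<QQ L; ra>>; i * rb>>%VS -> t \in <<<<QQ L; v>>; ra>>%VS.
  apply: (subvP _ _); apply: adjQ2_sub; first exact: memv_adjoin.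
  have -> : i * rb = v * ra^-1 by rewrite /v mulrAC mulfV // mul1r.
  apply: rpredM; last by rewrite rpredV; exact: memv_adjoin.
  exact/mem_adj/memv_adjoin.
have y2 : z * ga (gi z) / n%:R = 1 \/ z * ga (gi z) / n%:R = -1.
  have vE : v ^+ 2 = - (a * (n * n'))%:R by rewrite exprMn irE raE (natrM _ a) mulrN.
  have e : (a * (n * n') = n * (a * n'))%N by rewrite mulnCA.
  have n'a' : ~~ (n %| a * n')%N by rewrite Euclid_dvdM // negb_or na.
  have := nu (ga \o gi)%AF; rewrite comp_lfunE /=; apply: (iunit_imag pn n4 e n'a' vE).
  apply: rpredM; last by rewrite rpredV; exact: rpred_nat.
  have hz : z * ga (gi z) \in <<<<QQ L; ra>>; i * rb>>%VS.
    apply: rpredM => //.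
    have gT (f : 'AEnd(L)) : (f ra = ra \/ f ra = - ra) -> (f (i * rb) = i * rb \/ f (i * rb) = - (i * rb)) ->
      forall t, t \in <<<<QQ L; ra>>; i * rb>>%VS -> f t \in <<<<QQ L; ra>>; i * rb>>%VS.
      move=> f1 f2; apply: (aut_adjoin (E := <<QQ L; ra>>%AS)) => //; last exact: mem_adj.
      by apply: aut_adjoin => //; move=> t tQ; rewrite fixQ.
    apply: (gT ga) => //; first by left; rewrite rmorphM /= gai gab.
    by apply: (gT gi) => //; right; rewrite rmorphM /= gii gib mulNr.
  apply: (quad_fixed (E := <<QQ L; v>>%AS) (g := (ga \o gi)%AF) (y := ra)).
  - exact: mem_adj.
  - apply: fixQ1 => //; rewrite comp_lfunE /= /v !rmorphM /= gia gii gib.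
    by rewrite rmorphN /= gaa gai gab; ring.
  - by rewrite comp_lfunE /= gia gaa.
  - exact: Tv.
  - rewrite comp_lfunE /= rmorphM /=; have [_ _ ->] := ji _ giz1.
    by rewrite giz2 rmorphM /= gaz2 mulrC.
have n1 (c : L) : c / n%:R = 1 \/ c / n%:R = -1 -> c = n%:R \/ c = - n%:R.
  by case=> h; [left|right]; rewrite -[LHS](divfK n0) h ?mul1r ?mulN1r.
(* Both [z * ga z] and [ga z * gi z] are [n] up to sign, the latter by applying [ga] to the second
   norm; comparing them determines [gi z] up to sign. *)
have giz : gi z = z \/ gi z = - z.
  have h1 := n1 _ y1; have : ga (z * ga (gi z)) = n%:R \/ ga (z * ga (gi z)) = - n%:R.
    by case: (n1 _ y2) => ->; [left|right]; rewrite ?rmorphN rmorph_nat.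
  have [_ e1 _] := aa _ giz1; rewrite rmorphM /= e1 => h2.
  have e : z * (ga z * gi z) = z * ga z * gi z by rewrite mulrA.
  move: e; case: h1 => ->; case: h2 => -> e; [left|right|right|left]; apply: (mulfI n0).
  - by apply: (lin_comb (c := -1) e); ring.
  - by apply: (lin_comb (c := -1) e); ring.
  - by apply: (lin_comb (c := 1) e); ring.
  - by apply: (lin_comb (c := 1) e); ring.
have vu := iunitV wu'.
case: giz => giz.
  have zra : z \in <<QQ L; ra>>%VS.
    apply: (quad_fixed (E := <<QQ L; ra>>%AS) (g := gi) (y := i * rb)) => //.
    - exact: mem_adj.
    - exact: fixQ1.
    - by rewrite rmorphM /= gii gib mulNr.
  by apply: (@unramified_sqr L z ra w'^-1 ga n a%:Z); rewrite // dvdzE.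
(* When [gi] negates [z], the factor [i * rb], also negated by [gi], moves [z] into Q(ra) and
   replaces [n] by [n'] in the square. *)
pose z1 := z * (i * rb) / n%:R.
have z1E : z1 ^+ 2 = n'%:R * (- w'^-1).
  have -> : z1 ^+ 2 = z ^+ 2 * (i * rb) ^+ 2 / n%:R ^+ 2 by rewrite expr_div_n exprMn.
  by rewrite z2 irE natrM; field; rewrite n0 iunit_neq0.
have z1ra : z1 \in <<QQ L; ra>>%VS.
  apply: (quad_fixed (E := <<QQ L; ra>>%AS) (g := gi) (y := i * rb)) => //.
  - exact: mem_adj.
  - exact: fixQ1.
  - by rewrite rmorphM /= gii gib mulNr.
  - apply: rpredM; last by rewrite rpredV; exact: rpred_nat.
    by apply: rpredM => //; exact: memv_adjoin.
  - by rewrite /z1 fmorph_div rmorph_nat rmorphM /= giz rmorphM /= gii gib; ring.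
by apply: (@unramified_sqr L z1 ra (- w'^-1) ga n' a%:Z); rewrite ?dvdzE //; exact: iunitN.
Qed.

End Obstruction.
(** [tau] after [rho] negates both [i] and [s], hence fixes [i * s]; the product is the norm to its
    fixed field. *)
Lemma imag_norm (s i : L) (rho tau : 'AEnd(L)) z :
  i ^+ 2 = -1 -> s ^+ 2 \in QQ L ->
  rho s = - s -> rho i = i -> tau s = s -> tau i = - i ->
  z \in <<<<QQ L; i>>; s>>%VS -> z * tau (rho z) \in <<QQ L; i * s>>%VS.
Proof.
move=> ii sQ rs ri ts ti zk.
have iQ : i ^+ 2 \in QQ L by rewrite ii; mem.
have isQ : (i * s) ^+ 2 \in QQ L by rewrite exprMn; mem.
pose h : 'AEnd(L) := (tau \o rho)%AF.
have hE z' : h z' = tau (rho z') by rewrite /h comp_lfunE.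
have hs : h s = - s by rewrite hE rs rmorphN /= ts.
have hi : h i = - i by rewrite hE ri ti.
have sub z' : z' \in <<<<QQ L; i>>; s>>%VS -> z' \in <<<<QQ L; i * s>>; i>>%VS.
  apply: (subvP _ _); apply: adjQ2_sub; first exact: memv_adjoin.
  have e : s = - ((i * s) * i) by rewrite mulrAC -expr2 ii; ring.
  rewrite [X in X \in _]e rpredN; apply: rpredM; last exact: memv_adjoin.
  exact/mem_adj/memv_adjoin.
have hk z' : z' \in <<<<QQ L; i>>; s>>%VS -> h z' \in <<<<QQ L; i>>; s>>%VS.
  apply: (aut_adjoin (E := <<QQ L; i>>%AS)); [|exact: mem_adj|by right].
  by apply: aut_adjoin => //; [move=> t tQ; rewrite fixQ|right].
have hh z' : z' \in <<<<QQ L; i>>; s>>%VS -> h (h z') = z'.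
  apply: (fix_adjoin (E := <<QQ L; i>>%AS)); [exact: mem_adj| |by rewrite hs rmorphN /= hs opprK].
  by apply: fix_adjoin => //; [move=> t tQ; rewrite !fixQ|rewrite hi rmorphN /= hi opprK].
rewrite -hE; have hz := hk _ zk.
apply: (quad_fixed (E := <<QQ L; i * s>>%AS) (g := h) (y := i)).
- exact: mem_adj.
- by apply: fixQ1 => //; rewrite rmorphM /= hi hs mulrNN.
- exact: hi.
- by apply: sub; apply: rpredM.
- by rewrite rmorphM /= hh // mulrC.
Qed.

(* The norm of y to the imaginary quadratic field of i s has square r * tau r up to sign. *)
Lemma norm_not_sqclass (s i : L) (rho tau : 'AEnd(L)) (d m p p' q d' : nat) r :
  i ^+ 2 = -1 -> s ^+ 2 = d%:R ->
  rho s = - s -> rho i = i -> tau s = s -> tau i = - i ->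
  prime p -> (4 < p)%N -> m = (p * p')%N -> ~~ (p %| p')%N ->
  prime q -> ~~ (q %| m)%N -> d = (q * d')%N -> ~~ (q %| d')%N ->
  (exists d1, d = (p * d1)%N /\ ~~ (p %| d1)%N) ->
  r \in <<QQ L; i>>%VS -> r * tau r = m%:R -> ~ sqclass <<<<QQ L; i>>; s>>%AS r.
Proof.
move=> ii ss rs ri ts ti pp p4 mE pp' pq qm dE qd' [d1 [d1E pd1]] rG rm [y [w [yk y0 wu rE]]].
have iQ : i ^+ 2 \in QQ L by rewrite ii; mem.
have sQ : s ^+ 2 \in QQ L by rewrite ss; mem.
have isQ : (i * s) ^+ 2 \in QQ L by rewrite exprMn; mem.
have isE : (i * s) ^+ 2 = - d%:R by rewrite exprMn ii ss mulN1r.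
pose h : 'AEnd(L) := (tau \o rho)%AF.
have hE z : h z = tau (rho z) by rewrite /h comp_lfunE.
have nrm z : z \in <<<<QQ L; i>>; s>>%VS -> z * h z \in <<QQ L; i * s>>%VS.
  by rewrite hE; exact: imag_norm.
have rk : r \in <<<<QQ L; i>>; s>>%VS by exact: mem_adj.
have wk : w \in <<<<QQ L; i>>; s>>%VS.
  have -> : w = r / y ^+ 2 by rewrite rE mulfK // expf_neq0.
  by apply: rpredM => //; rewrite rpredV; apply: rpredX.
have w1 : w * h w = 1 \/ w * h w = -1.
  apply: (iunit_imag pp p4 d1E pd1 isE); first exact: nrm.
  by apply: iunitM => //; apply: iunit_aut.
pose z := y * h y.
have zz : z ^+ 2 = (m%:Z)%:~R \/ z ^+ 2 = (- m%:Z)%:~R.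
  have e : m%:R = w * h w * z ^+ 2.
    rewrite -rm; have -> : tau r = h r by rewrite hE (fixQ1 iQ ri).
    by rewrite {1}rE [in h r]rE rmorphM rmorphXn /= /z; ring.
  case: w1 => w1; [left|right]; move: e; rewrite w1 ?mul1r ?mulN1r => e.
    by rewrite -pmulrn e.
  by rewrite rmorphN /= -pmulrn e opprK.
have zQ : z ^+ 2 \in QQ L by case: zz => ->; mem.
(* As [z ^+ 2] is rational, [z] or [z * (i * s)] is rational. The first is excluded by [p], which
   divides [m] once, the second by [q], which divides [m d] once. *)
have [z1|z1] := quad_mem isQ zQ (nrm _ yk).
- case: zz => h1.
    by apply: (@rat_sqr_prime L z p p'%:Z) => //; rewrite h1 mE PoszM.
  apply: (@rat_sqr_prime L z p (- p'%:Z)) => //; first by rewrite dvdzE abszN.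
  by rewrite h1 mE PoszM mulrN.
- have [M MM h1] : exists2 M : int, `|M|%N = (m * d')%N & (z * (i * s)) ^+ 2 = (q%:Z * M)%:~R.
    case: zz => h1; rewrite exprMn isE h1.
      exists (- (m * d')%N%:Z); first by rewrite abszN.
      have -> : q%:Z * - (m * d')%N%:Z = - (m%:Z * d%:Z) by rewrite dE !PoszM; ring.
      by rewrite rmorphN rmorphM mulrN.
    exists (m * d')%N%:Z => //.
    have -> : q%:Z * (m * d')%N%:Z = m%:Z * d%:Z by rewrite dE !PoszM; ring.
    by rewrite rmorphN rmorphM mulrNN.
  apply: (@rat_sqr_prime L (z * (i * s)) q M) => //.
  by rewrite dvdzE MM Euclid_dvdM // negb_or qm.
Qed.

End SquareClasses.

(** * The field k *)

Section CapSq.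
Variable L : splittingFieldType rat.
Implicit Types (E F K k : {subfield L}) (x y z u w a b t r : L) (J I : set L).
Local Notation OO := ring_of_integers.

(** A generator [x] of the extension of [J] has [x ^+ 2] associated to [r]. Conversely let
    [r = w * y ^+ 2]: for [a] in [J], [a / y] is integral because its square is, and [y = r / (w y)]
    lies in the extension of [J] because [r] lies in [J J]. *)
Lemma sqrt_ideal_ext k K J r : (k <= K)%VS -> fractional_ideal k J -> r \in k -> r != 0 ->
  ideal_mul J J = principal_ideal k r ->
  (exists x, [/\ x \in K, x != 0 & ideal_ext K J = principal_ideal K x]) <-> sqclass K r.
Proof.
move=> kK fJ rk r0 JJ; have rK := subvP kK _ rk; split.
  move=> [x [xK x0 Jx]]; exists x, (r / x ^+ 2); split=> //; last by rewrite divfK // expf_neq0.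
  have x20 : x ^+ 2 != 0 by rewrite expf_neq0.
  have := congr1 (ideal_ext K) JJ; rewrite ext_mul Jx principalM -expr2 ext_principal //.
  by move=> /(principal_eqP x20 _ rK); apply; mem.
move=> [y [w [yK y0 wu rE]]]; exists y; split=> //.
have [w0 wi wvi] := wu.
have wK : w \in K by have -> : w = r / y ^+ 2 by [rewrite rE mulfK // expf_neq0]; mem.
have [Jk _ JD JM _] := fJ.
have Jy a : J a -> OO K (a / y).
  move=> Ja; have aK : a \in K by apply: (subvP kK); exact: Jk.
  split; first by mem.
  apply: isint_sqr; have : principal_ideal k r (a * a) by rewrite -JJ; exact: im_mem.
  move=> /(principalP _ _ r0)[_ ai].
  have -> : (a / y) ^+ 2 = w * (r^-1 * (a * a)) by rewrite rE; field; rewrite ?y0 ?w0.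
  exact: isintM.
apply/seteqP; split.
  apply: im_ind.
  - by exists 0; [exact: OO0|rewrite mulr0].
  - by move=> _ _ [a aO <-] [b bO <-]; exists (a + b); [exact: OOD|rewrite mulrDr].
  - move=> a b Ja bO; exists ((a / y) * b); first by apply: OOM => //; exact: Jy.
    by field.
have yJ : ideal_ext K J y.
  have : ideal_mul J J r by rewrite JJ; exact: principal_id.
  suff H : ideal_mul J J `<=` [set z | ideal_ext K J (z / (w * y))].
    move/H => /=; suff -> : r / (w * y) = y by [].
    by rewrite rE; field; rewrite ?y0 ?w0.
  apply: im_ind => /=.
  - by rewrite mul0r; exact: im0.
  - by move=> a b ? ?; rewrite mulrDl; apply: imD.
  - move=> a b Ja Jb; have -> : a * b / (w * y) = a * (w^-1 * (b / y)) by field; rewrite ?y0 ?w0.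
    apply: im_mem => //; apply: OOM; last exact: Jy.
    by split; [rewrite rpredV|].
by move=> _ [a aO <-]; rewrite mulrC; have [_ _] := ext_emodule K J; apply.
Qed.

(** An ideal is determined by its square. For [x] on the right and [b] in [J], [b x / r] has
    integral square, hence is integral; as [r] is a sum of products from [J], so [x = r * (x / r)]
    lies in [J]. *)
Lemma sqrt_idealE k J r : fractional_ideal k J -> r != 0 -> r \in k ->
  ideal_mul J J = principal_ideal k r -> J = [set x | x \in k /\ isint (x ^+ 2 / r)].
Proof.
move=> fJ r0 rk JJ; have [Jk _ JD JM _] := fJ; have [J0 _ _] := fractional_emodule fJ.
have Ji a : J a -> isint (a ^+ 2 / r).
  move=> Ja; have : principal_ideal k r (a * a) by rewrite -JJ; exact: im_mem.
  by move=> /(principalP _ _ r0)[_]; rewrite mulrC expr2.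
apply/seteqP; split; first by move=> a Ja; split; [exact: Jk|exact: Ji].
move=> x [xk xi].
have : ideal_mul J J r by rewrite JJ; exact: principal_id.
suff H : ideal_mul J J `<=` [set z | J (z * (x / r))].
  by move/H => /=; rewrite mulrCA mulfV // mulr1.
apply: im_ind => /=; first by rewrite mul0r.
  by move=> a b ? ?; rewrite mulrDl; apply: JD.
move=> a b Ja Jb; have -> : a * b * (x / r) = (b * (x / r)) * a by ring.
apply: JM => //; split; first by have : b \in k := Jk _ Jb => ?; mem.
apply: isint_sqr; have -> : (b * (x / r)) ^+ 2 = (b ^+ 2 / r) * (x ^+ 2 / r) by field.
by apply: isintM => //; exact: Ji.
Qed.

End CapSq.

Section BaseField.
Variables (L : splittingFieldType rat) (s i : L) (d : nat) (rho tau : 'AEnd(L)).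
Implicit Types (E F K : {subfield L}) (x y z u w a b t r p : L) (J I : set L).
Local Notation OO := ring_of_integers.
Hypotheses (ii : i ^+ 2 = -1) (ss : s ^+ 2 = d%:R) (d4 : (d %% 4 = 3)%N).
Hypotheses (rs : rho s = - s) (ri : rho i = i) (ts : tau s = s) (ti : tau i = - i).

Definition kk : {subfield L} := <<Gi i; s>>%AS.
Local Notation k := kk.
Local Notation G := (Gi i).

Lemma sG : s ^+ 2 \in G. Proof. by rewrite ss; mem. Qed.
Lemma Gk : (G <= k)%VS. Proof. exact: subv_adjoin. Qed.
Lemma sk : s \in k. Proof. exact: memv_adjoin. Qed.
Lemma ik : i \in k. Proof. exact/(subvP Gk)/Gi_i. Qed.
Lemma rhoG x : x \in G -> rho x = x.
Proof. by apply: fixQ1 => //; rewrite ii; mem. Qed.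
Lemma qrho : quad_inv G k rho.
Proof. by apply: quad_inv_adjoin; [exact: sG|exact: rhoG|exact: rs]. Qed.
Lemma rhok x : x \in k -> rho x \in k. Proof. by have [_ h _ _ _] := qrho; exact: h. Qed.
Lemma rhorho x : x \in k -> rho (rho x) = x. Proof. by have [_ _ _ h _] := qrho; exact: h. Qed.
Lemma rhofix x : x \in k -> rho x = x -> x \in G.
Proof. by have [_ _ _ _ h] := qrho; exact: h. Qed.
Lemma inv_k : invertible_ideals k.
Proof. exact: (invertible_step qrho (Gi_invertible ii ti)). Qed.
Lemma tauk x : x \in k -> tau x \in k.
Proof.
apply: aut_adjoin; [by move=> y yG; apply: (tauGi ii ti) | exact: sG | by left].
Qed.
(** Integral because [(i * s) ^+ 2 = - d] is 1 modulo 4. *)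
Definition om := (1 + i * s) / 2%:R.
Lemma om_k : om \in k. Proof. by have := sk; have := ik => ? ?; rewrite /om; mem. Qed.
Lemma rho_om : rho om = 1 - om.
Proof.
rewrite /om fmorph_div rmorphD rmorph1 rmorphM rmorph_nat /= ri rs.
by field; exact: two_neq0.
Qed.
Lemma om_sub : om - rho om = i * s.
Proof. by rewrite rho_om /om; field; exact: two_neq0. Qed.
Lemma om_eq : om ^+ 2 - om + ((d + 1) %/ 4)%N%:R = 0.
Proof.
have e : (d + 1 = 4 * ((d + 1) %/ 4))%N by have := d4; clear; lia.
have e' : d%:R + 1 = 4%:R * ((d + 1) %/ 4)%N%:R :> L by rewrite -natrM -e natrD.
have f : (i * s) ^+ 2 = - d%:R by rewrite exprMn ii ss mulN1r.
have t0 := two_neq0 L; have f0 : 4%:R != 0 :> L by rewrite natL_eq0.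
have -> : om ^+ 2 - om + ((d + 1) %/ 4)%N%:R =
  ((i * s) ^+ 2 - 1 + 4%:R * ((d + 1) %/ 4)%N%:R) / 4%:R.
  by rewrite /om; field; rewrite ?t0 ?f0.
by rewrite -e' f; have -> : - d%:R - 1 + (d%:R + 1) = 0 :> L by [ring]; rewrite mul0r.
Qed.
Lemma om_int : isint om.
Proof. by apply: (isint_quad (isint1 L) (isint_nat L ((d + 1) %/ 4)) (w := om)); rewrite mul1r om_eq. Qed.
Lemma OOom : OO k om. Proof. by split; [exact: om_k|exact: om_int]. Qed.

Lemma d_neq0 : d%:R != 0 :> L.
Proof. by rewrite natL_eq0; apply/eqP=> d0; move: d4; rewrite d0. Qed.
Lemma s_neq0 : s != 0.
Proof. by rewrite -sqrf_eq0 ss d_neq0. Qed.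
Lemma dO : OO G (d%:R : L). Proof. by split; [mem|isi]. Qed.

(* Away from the divisors of the discriminant - d of the basis 1, om over Z[i],
   O_k is reduced modulo a Gaussian prime. *)
Lemma reduced_mod p y : gprime i p -> ~ gdvd i p d%:R -> OO k y -> isint (y ^+ 2 / p) -> isint (y / p).
Proof.
move=> pp pd [yk yi] y2.
have [[pG pi] p0 pu pr] := pp.
have tr z : z \in k -> isint z -> isint (z ^+ 2 / p) -> isint ((z + rho z) / p).
  move=> zk zi z2; have rz2 : isint (rho z ^+ 2 / p).
    have -> : rho z ^+ 2 / p = rho (z ^+ 2 / p) by rewrite fmorph_div rmorphXn /= (rhoG pG).
    by isi.
  have n2 : isint (z * rho z / p).
    apply: isint_sqr; have -> : (z * rho z / p) ^+ 2 = (z ^+ 2 / p) * (rho z ^+ 2 / p) by field.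
    exact: isintM.
  have TG : z + rho z \in G by apply: (quad_trace qrho).
  have TO : OO G (z + rho z) by split=> //; isi.
  have d2 : gdvd i p ((z + rho z) * (z + rho z)).
    apply/gdvdP => //; first by mem.
    have -> : (z + rho z) * (z + rho z) / p = z ^+ 2 / p + rho z ^+ 2 / p + 2%:R * (z * rho z / p).
      by ring.
    by isi.
  have dT : gdvd i p (z + rho z) by case: (pr _ _ TO TO d2).
  exact/(gdvdP p0 TG pG).
have T0 := tr y yk yi y2.
have T1 : isint ((om * y + rho (om * y)) / p).
  have [omk omi] := OOom; apply: tr; [mem|isi|].
  have -> : (om * y) ^+ 2 / p = om ^+ 2 * (y ^+ 2 / p) by ring.
  by isi.
have [u [v [[_ ui] [_ vi] uv]]] := gprime_coprime ii ti pp dO pd.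
(* The traces of [y] and [om y] determine [y] after multiplication by [om - rho om = i s], hence
   determine [d y]; a Bezout relation between [p] and [d] then removes [d]. *)
have dy : isint (d%:R * y / p).
  have -> : d%:R * y / p = - (i * s) * ((om * y + rho (om * y)) / p - rho om * ((y + rho y) / p)).
    have -> : (om * y + rho (om * y)) / p - rho om * ((y + rho y) / p) = (om - rho om) * y / p.
      by rewrite rmorphM /=; ring.
    rewrite om_sub; have -> : - (i * s) * (i * s * y / p) = - (i * s) ^+ 2 * y / p by ring.
    by rewrite exprMn ii ss mulN1r opprK.
  have oi := om_int; have ji := isint_i ii.
  have si : isint s by apply: isint_sqr; rewrite ss; isi.
  by isi.
have -> : y / p = u * y + v * (d%:R * y / p).
  have -> : u * y + v * (d%:R * y / p) = (u * p + v * d%:R) * y / p by field.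
  by rewrite uv mul1r.
by isi.
Qed.

Definition Sq r := exists J, fractional_ideal k J /\ ideal_mul J J = principal_ideal k r.

Lemma SqM r t : Sq r -> Sq t -> Sq (r * t).
Proof.
move=> [J [fJ JJ]] [I [fI EI]]; exists (ideal_mul J I); split; first exact: im_fractional.
by rewrite imACA JJ EI principalM.
Qed.

Lemma Sq1 : Sq 1.
Proof. by exists (OO k); split; [exact: fractional_O|rewrite im_OO principalE iscale1]. Qed.

(** The ideal is (p, s): its square is generated by [p^2], [p s] and [s^2 = p b], and it equals (p)
    because [p] and [b] are coprime. *)
Lemma Sq_prime p b : gprime i p -> OO G b -> d%:R = p * b -> ~ gdvd i p b -> Sq p.
Proof.
move=> pp bO de pb; have [pO p0 _ _] := pp.
have [u [v [uO vO uv]]] := gprime_coprime ii ti pp bO pb.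
have pk := OOS Gk pO; have si : isint s by apply: isint_sqr; rewrite ss; isi.
have sO : OO k s by split; [exact: sk|].
pose J : set L := [set z | exists x y, [/\ OO k x, OO k y & z = x * p + y * s]].
have JO : J `<=` OO k by move=> _ [x [y [xO yO ->]]]; apply: OOD; exact: OOM.
have Jp : J p by exists 1, 0; split; [exact: OO1|exact: OO0|ring].
have Js : J s by exists 0, 1; split; [exact: OO0|exact: OO1|ring].
have fJ : fractional_ideal k J.
  split.
  - by move=> z /JO[].
  - by exists p.
  - move=> _ _ [x [y [? ? ->]]] [x' [y' [? ? ->]]]; exists (x + x'), (y + y').
    by split; [exact: OOD|exact: OOD|ring].
  - move=> a _ aO [x [y [? ? ->]]]; exists (a * x), (a * y).
    by split; [exact: OOM|exact: OOM|ring].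
  - by exists 1; split; [exact: OO1|rewrite oner_eq0|move=> z /JO; rewrite mul1r].
exists J; split=> //; apply/seteqP; split.
  apply: im_ind.
  - by exists 0; [exact: OO0|rewrite mulr0].
  - by move=> _ _ [a aO <-] [c cO <-]; exists (a + c); [exact: OOD|rewrite mulrDr].
  - move=> _ _ [x [y [xO yO ->]]] [x' [y' [xO' yO' ->]]].
    exists (x * x' * p + (x * y' + y * x') * s + y * y' * b).
      have bk := OOS Gk bO.
      by repeat first [done | apply: OOD | apply: OOM].
    by apply: (lin_comb (c := - y * y') (etrans ss de)); ring.
move=> _ [a aO <-].
have [_ JD JM] := im_emodule J (fractional_emodule fJ).
have -> : p * a = a * (u * (p * p) + v * (s * s)).
  have e : s * s = p * b by rewrite -expr2 ss.
  rewrite e; apply: (lin_comb (c := - (p * a)) uv); ring.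
apply: (JM a) => //; apply: JD; [apply: (JM u)|apply: (JM v)]; try exact: im_mem.
  exact: OOS Gk uO.
exact: OOS Gk vO.
Qed.

(** Evenness of the valuation of [r] at [p], in divisibility terms: no multiple of [r] by a nonzero
    square has valuation exactly 1. *)
Definition EvenAt p r := forall t b, t \in G -> t != 0 -> OO G b -> r * t ^+ 2 = p * b -> gdvd i p b.

(** For [a] in [J], [(t a) ^+ 2 / p] is integral, so [t a / p] is integral because [O_k] is reduced
    modulo [p]. As [r] is a sum of products from [J], [p ^+ 2] divides [r * t ^+ 2]. *)
Lemma Sq_even p r : gprime i p -> ~ gdvd i p d%:R -> r \in G -> Sq r -> EvenAt p r.
Proof.
move=> pp pd rG [J [fJ JJ]] t b tG t0 bO rt; have [[pG pi] p0 _ _] := pp; have [bG bi] := bO.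
have tk := subvP Gk _ tG.
have [b0|b0] := eqVneq b 0; first by exists 0; [exact: OO0|rewrite mul0r].
have r0 : r != 0.
  apply: contra_neq b0 => r0; move: rt; rewrite r0 mul0r => /esym/eqP.
  by rewrite mulf_eq0 (negbTE p0) => /eqP.
have key a : J a -> isint (t * a / p).
  move=> Ja; have : principal_ideal k r (a * a) by rewrite -JJ; exact: im_mem.
  move=> /(principalP _ _ r0)[_ ai]; have ak : a \in k by have [Jk _ _ _ _] := fJ; exact: Jk.
  have e : (t * a) ^+ 2 / p = b * (r^-1 * (a * a)).
    have -> : (t * a) ^+ 2 / p = (r * t ^+ 2) / p * (r^-1 * (a * a)) by field; rewrite ?p0 ?r0.
    by rewrite rt; field; rewrite ?p0 ?r0.
  have ai2 : isint ((t * a) ^+ 2 / p) by rewrite e; isi.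
  apply: (reduced_mod pp pd) => //; split; first by mem.
  apply: isint_sqr; have -> : (t * a) ^+ 2 = p * ((t * a) ^+ 2 / p) by field.
  by isi.
apply/gdvdP => //.
have -> : b / p = r * t ^+ 2 / p ^+ 2 by rewrite rt; field.
have : ideal_mul J J r by rewrite JJ; exact: principal_id.
suff H : ideal_mul J J `<=` [set z | isint (z * t ^+ 2 / p ^+ 2)] by move/H.
apply: im_ind => /=.
- by rewrite mul0r mul0r; isi.
- by move=> x y ? ?; rewrite !mulrDl; isi.
- move=> x y Jx Jy; have -> : x * y * t ^+ 2 / p ^+ 2 = (t * x / p) * (t * y / p) by field.
  by apply: isintM; exact: key.
Qed.

Lemma norm_principal I : fractional_ideal k I -> exists r, [/\ r \in G, r != 0 &
  ideal_mul I [set rho x | x in I] = principal_ideal k r].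
Proof.
move=> fI; have fn := norm_ideal_fractional qrho fI.
have [r [rG r0 nE]] := Gi_PID ii ti fn; exists r; split=> //.
by rewrite (norm_idealE qrho (Gi_invertible ii ti)) // nE ext_principal //; exact: Gk.
Qed.

Lemma gal_rho : exists2 g : gal_of k, g \in 'Gal(k / G)%g & forall x, x \in k -> g x = rho x.
Proof.
have rk : (rho @: k <= k)%VS.
  by apply/subvP=> _ /memv_imgP[x xk ->]; exact: rhok.
exists (gal k rho); last by move=> x xk; rewrite galK.
rewrite gal_kHom ?Gk //; apply/kAHomP => x xG.
by rewrite galK ?(subvP Gk) // rhoG.
Qed.

Lemma gal_cases (g : gal_of k) : g \in 'Gal(k / G)%g ->
  (forall x, x \in k -> g x = x) \/ (forall x, x \in k -> g x = rho x).
Proof.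
move=> gG; have gfix x : x \in G -> g x = x by apply: fixed_gal gG; exact: Gk.
have [gs|gs] : g s = s \/ g s = - s.
- by apply: sqr_opp_or; rewrite -rmorphXn /= gfix // sG.
- left=> x /(quad_coord sG)[a [b [aG bG ->]]].
  by rewrite rmorphD rmorphM /= gs !gfix.
- right=> x /(quad_coord sG)[a [b [aG bG ->]]].
  by rewrite !rmorphD !rmorphM /= gs rs (gfix a) // (gfix b) // (rhoG aG) (rhoG bG).
Qed.

Lemma invariantP I : I `<=` [set x | x \in k] ->
  invariant_ideal G k I <-> [set rho x | x in I] = I.
Proof.
move=> Ik; split.
  move=> inv; have [g gG gE] := gal_rho; rewrite -{2}(inv g gG).
  by apply: eq_imagel => x /Ik xk; rewrite gE.
move=> e g /gal_cases[h|h].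
  rewrite -[RHS]image_id; apply: eq_imagel => x /Ik xk; exact: h.
by rewrite -[RHS]e; apply: eq_imagel => x /Ik xk; exact: h.
Qed.

(** The witness is [1 + rho x]; if it vanishes, then [x = -1] and [s] serves. *)
Lemma hilbert90 x : x \in k -> x * rho x = 1 -> exists y, [/\ y \in k, y != 0 & rho y = y * x].
Proof.
move=> xk N1; have [e|e] := eqVneq (1 + rho x) 0.
  exists s; split; [exact: sk|exact: s_neq0|].
  have rx : rho x = -1 by apply/eqP; rewrite -addr_eq0 addrC e.
  have -> : x = -1 by rewrite -(rhorho xk) rx rmorphN rmorph1.
  by rewrite rs mulrN1.
exists (1 + rho x); split=> //; first by have := rhok xk => ?; mem.
by rewrite rmorphD rmorph1 /= rhorho // mulrDl mul1r [rho x * x]mulrC N1 addrC.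
Qed.

(** * Capitulation in K forces strong ambiguity *)

Section Capitulation.
Variables (x : L) (m m' p : nat) (K : {subfield L}) (sigma : 'AEnd(L)).
Hypotheses (xx : x ^+ 2 = m%:R) (KE : K = <<k; x>>%AS).
Hypotheses (pp : prime p) (p4 : (4 < p)%N) (mE : m = (p * m')%N) (pm' : ~~ (p %| m')%N).
Hypothesis m4 : (m %% 4 = 1)%N.
Hypotheses (rx : rho x = x) (tx : tau x = x).
Hypotheses (sx : sigma x = - x) (si : sigma i = i) (s_s : sigma s = s).

Let xk : x ^+ 2 \in k. Proof. by rewrite xx; mem. Qed.
Lemma sigk y : y \in k -> sigma y = y.
Proof.
apply: fix1_adjoin; [exact: sG| |exact: s_s].
by move=> z zG; apply: (fixQ1 _ si zG); rewrite ii; mem.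
Qed.
Lemma qsigma : quad_inv k K sigma.
Proof. by rewrite KE; apply: quad_inv_adjoin => //; exact: sigk. Qed.
Let kK : (k <= K)%VS. Proof. by case: qsigma. Qed.
Lemma rhoK y : y \in K -> rho y \in K.
Proof. by rewrite KE; apply: aut_adjoin => //; [exact: rhok|left]. Qed.
Lemma rhorhoK y : y \in K -> rho (rho y) = y.
Proof. by rewrite KE; apply: fix_adjoin => //; [exact: rhorho|rewrite !rx]. Qed.
Lemma sigrhoK y : y \in K -> sigma (rho y) = rho (sigma y).
Proof.
rewrite KE => /(quad_coord xk)[a [b [ak bk ->]]]; rewrite !rmorphD !rmorphM /= rx sx.
by rewrite rmorphN /= rx !(sigk ak, sigk bk) !(sigk (rhok ak), sigk (rhok bk)).
Qed.

Lemma ext_inj I J : fractional_ideal k I -> fractional_ideal k J ->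
  ideal_ext K I = ideal_ext K J -> I = J.
Proof.
move=> fI fJ e; have [I' [fI' EI]] := inv_k fI; have [J' [fJ' EJ]] := inv_k fJ.
have [Ik _ _ _ _] := fI; have [Jk _ _ _ _] := fJ.
have [I'k _ _ _ _] := fI'; have [J'k _ _ _ _] := fJ'.
apply/seteqP; split=> z zI.
- apply: (contraction kK (fractional_emodule fJ) EJ J'k); first exact: Ik.
  by rewrite -e; exact: ext_sub.
- apply: (contraction kK (fractional_emodule fI) EI I'k); first exact: Jk.
  by rewrite e; exact: ext_sub.
Qed.

Lemma img_principal (g : 'AEnd(L)) y : (forall z, z \in K -> g z \in K) ->
  (forall z, z \in K -> g (g z) = z) ->
  [set g z | z in principal_ideal K y] = principal_ideal K (g y).
Proof. by move=> gK gg; rewrite principalE img_scale img_O. Qed.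

Lemma img_ext (g : 'AEnd(L)) I : (forall z, z \in K -> g z \in K) ->
  (forall z, z \in K -> g (g z) = z) ->
  [set g z | z in ideal_ext K I] = ideal_ext K [set g z | z in I].
Proof. by move=> gK gg; rewrite img_im img_O. Qed.

Lemma capitulation_strongly_ambiguous c :
  capitulation_kernel k K c -> strongly_ambiguous G k c.
Proof.
move=> cK; have cg : class_group k c by case: cK.
split=> //; case: cg cK => I fI <- /(capitulationP kK fI)[al [alK al0 IE]].
have [_ sK _ sigsig sigfix] := qsigma.
have [r [rG r0 rE]] := norm_principal fI.
have mI := fractional_emodule fI; have [Ik _ _ _ _] := fI.
have rk := subvP Gk _ rG; have rK := subvP kK _ rk.
have rI : [set rho z | z in ideal_ext K I] = principal_ideal K (rho al).
  by rewrite IE img_principal //; [exact: rhoK|exact: rhorhoK].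
rewrite img_ext in rI; [|exact: rhoK|exact: rhorhoK].
have e1 : principal_ideal K r = principal_ideal K (al * rho al).
  by rewrite -(ext_principal r kK) -rE ext_mul IE rI principalM.
have ralK := rhoK alK.
pose A := al * rho al / r.
have Au : iunit A by apply/(principal_eqP r0 rK) => //; mem.
have AK : A \in K by rewrite /A; mem.
(* [A] is fixed by [rho], so it has no component along [s]. *)
have AF : A \in <<<<QQ L; i>>; x>>%VS.
  have sQ : s ^+ 2 \in <<<<QQ L; i>>; x>>%VS by apply: mem_adj; exact: sG.
  apply: (quad_fixed (E := <<<<QQ L; i>>; x>>%AS) (g := rho) (y := s)) => //.
  - by apply: fixQ2 => //; rewrite ?ii ?xx; mem.
  - move: AK; rewrite KE; apply: (subvP _ _); apply: (@adjQ3_sub L _ i s x).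
    + by do 2!apply: mem_adj; exact: memv_adjoin.
    + exact: memv_adjoin.
    + by apply: mem_adj; exact: memv_adjoin.
  - by rewrite /A fmorph_div rmorphM /= rhorhoK // (rhoG rG) [rho al * al]mulrC.
pose a := al * sigma al.
have ak : a \in k by apply: (quad_norm qsigma).
have a0 : a != 0 by rewrite mulf_neq0 ?fmorph_eq0.
have salK := sK _ alK.
(* [sigma] fixes [I] pointwise, so [sigma al] also generates its extension and [I I] becomes
   generated by [al * sigma al]; the equality descends because extension of ideals is injective. *)
have II : ideal_mul I I = principal_ideal k a.
  apply: ext_inj; [exact: im_fractional|exact: fractional_principal|].
  rewrite ext_mul ext_principal // IE.
  have -> : principal_ideal K a = ideal_mul (principal_ideal K al) (principal_ideal K (sigma al)).
    by rewrite principalM.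
  congr ideal_mul; rewrite -img_principal // -IE img_ext //; congr ideal_ext.
  by rewrite -{1}[I]image_id; apply: eq_imagel => z /Ik zk; rewrite sigk.
pose b := a / r.
have bk : b \in k by rewrite /b; mem.
have b0 : b != 0 by rewrite mulf_neq0 ?invr_eq0.
have nb : b * rho b = A * sigma A.
  rewrite /b /a /A !fmorph_div !rmorphM /= (sigrhoK alK) (rhoG rG) (sigk rk).
  by ring.
have bu : iunit (b * rho b) by rewrite nb; apply: iunitM => //; apply: iunit_aut.
have bG : b * rho b \in G by apply: (quad_norm qrho).
(* The norm of [b] is [A * sigma A], a unit of Z[i] other than [i] and [- i]; if it is -1, the
   factor [i] turns it into 1. *)
have [x0 [x0k x00 N0 x0E]] : exists x0, [/\ x0 \in k, x0 != 0, x0 * rho x0 = 1 &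
    exists2 u, iunit u & u \in k /\ x0 = u * b].
  have noi : b * rho b = i \/ b * rho b = - i -> False.
    by rewrite nb; apply: (no_unit_norm_i ii xx pp p4 mE pm' m4 sx si tx ti AF Au).
  have ikk := ik; have i0 := i_neq0 ii.
  have [h|h|h|h] := Gi_units ii ti bG bu.
  - exists b; split=> //; exists 1; first exact: iunit1.
    by rewrite mul1r rpred1.
  - exists (i * b); split=> //; [mem|by rewrite mulf_neq0| |].
      by rewrite rmorphM /= ri mulrACA h -expr2 ii mulrNN mulr1.
    by exists i; [exact: iunit_i|].
  - by case: noi; left.
  - by case: noi; right.
have [y [yk y0 ry]] := hilbert90 x0k N0.
exists (iscale y I); first by rewrite ideal_classE //; exists y.
apply/invariantP; first by move=> _ [z /Ik /= zk <-] /=; mem.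
rewrite img_scale ry.
case: x0E => u uu [uk x0E]; have [u0 ui uvi] := uu.
(* Comparing [I rho(I) = (r)] with [I I = (a)] shows that the conjugate of [I] is [r / a] times [I];
   scaling by [y] cancels this factor up to the unit [u]. *)
have rI' : [set rho z | z in I] = iscale (r / a) I.
  have : iscale a [set rho z | z in I] = iscale r I.
    by rewrite -(im_principal a (img_emodule qrho mI)) -(im_principal r mI) -II -rE imAC.
  move=> /(congr1 (iscale a^-1)); rewrite iscaleK // => ->.
  by rewrite iscaleM mulrC.
rewrite rI' iscaleM x0E /b.
have -> : y * (u * (a / r)) * (r / a) = y * u by field; rewrite ?r0 ?a0.
rewrite -iscaleM; congr iscale; have [_ _ IM] := mI.
apply/seteqP; split=> z.
  by move=> [v vI <-]; apply: IM.
move=> zI; exists (u^-1 * z); last by rewrite mulVKf.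
by apply: IM => //; split=> //; rewrite rpredV.
Qed.

End Capitulation.

End BaseField.

(** * Strongly ambiguous classes as vectors over F_2 *)

Section Ambiguous.
Variables (L : splittingFieldType rat) (s i : L) (d : nat) (rho tau : 'AEnd(L)).
Implicit Types (E F K : {subfield L}) (x y z u w a b t r p : L) (J I : set L).
Local Notation OO := ring_of_integers.
Hypotheses (ii : i ^+ 2 = -1) (ss : s ^+ 2 = d%:R) (d4 : (d %% 4 = 3)%N).
Hypotheses (rs : rho s = - s) (ri : rho i = i) (ts : tau s = s) (ti : tau i = - i).
Local Notation k := (kk s i).
Local Notation G := (Gi i).
Variable ps : 'I_5 -> L.
Hypothesis psP : forall j, gprime i (ps j).
Hypothesis psd : forall j, exists b, [/\ OO G b, d%:R = ps j * b & ~ gdvd i (ps j) b].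
Hypothesis dprod : d%:R = \prod_j ps j.
Local Notation V := 'rV['F_2]_5.
Local Notation sqr_k := (Sq s i).

Definition rv (v : V) : L := \prod_j ps j ^+ (v 0 j).

Lemma psO j : OO G (ps j). Proof. by case: (psP j). Qed.
Lemma ps_neq0 j : ps j != 0. Proof. by case: (psP j). Qed.

Lemma prodO (I : Type) (r : seq I) (F : I -> L) : (forall j, OO G (F j)) -> OO G (\prod_(j <- r) F j).
Proof. by move=> h; apply: (big_ind (OO G)) => //; [exact: OO1|exact: OOM]. Qed.

Lemma rvO v : OO G (rv v). Proof. by apply: prodO => j; apply: OOX; exact: psO. Qed.
Lemma rvG v : rv v \in G. Proof. by case: (rvO v). Qed.
Lemma rv_neq0 v : rv v != 0.
Proof. by apply/prodf_neq0 => j _; rewrite expf_neq0 // ps_neq0. Qed.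
Lemma rv0 : rv 0 = 1. Proof. by rewrite /rv big1 // => j _; rewrite mxE. Qed.

Lemma F2_carry (a b : 'F_2) : (a + b = (a + b)%R + 2 * (a * b) :> nat)%N.
Proof. by case: a b => [[|[|a]] ha] [[|[|b]] hb]. Qed.

(** The square root is the product of the primes selected by both vectors: these are the carries of
    the addition in F_2. *)
Lemma rvD (v w : V) : exists c, [/\ c \in G, c != 0 & rv v * rv w = rv (v + w) * c ^+ 2].
Proof.
exists (\prod_j ps j ^+ (v 0 j * w 0 j)); split.
- by have [] := prodO (index_enum _) (F := fun j => ps j ^+ (v 0 j * w 0 j)) (fun j => OOX _ (psO j)).
- by apply/prodf_neq0 => j _; rewrite expf_neq0 // ps_neq0.
rewrite -prodrXl -!big_split /=; apply: eq_bigr => j _.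
by rewrite -exprM -!exprD mxE mulnC F2_carry mulnC.
Qed.

Lemma rv_Sq v : sqr_k (rv v).
Proof.
apply: (big_ind sqr_k); [exact: Sq1|exact: SqM|] => j _.
have [b [bO de pb]] := psd j; have sp := Sq_prime ii ss ti (psP j) bO de pb.
elim: (nat_of_ord _) => [|n IH]; first by rewrite expr0; exact: Sq1.
by rewrite exprS; apply: SqM.
Qed.

Lemma rv_delta (j : 'I_5) : rv (delta_mx 0 j) = ps j.
Proof.
rewrite /rv (bigD1 j) //= big1 ?mulr1; first by rewrite mxE !eqxx.
by move=> l lj; rewrite mxE eqxx (negbTE lj).
Qed.

Lemma rv_total : rv (const_mx 1) = d%:R.
Proof. by rewrite dprod; apply: eq_bigr => j _; rewrite mxE. Qed.

Lemma gdvd_prod p (r : seq 'I_5) : gprime i p -> gdvd i p (\prod_(j <- r) ps j) -> exists j, gdvd i p (ps j).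
Proof.
move=> pp; have [pO p0 pu pr] := pp; elim: r => [|j r IH].
  rewrite big_nil => -[c [cG ci] e]; case: pu; apply: (@iunit_mul1 _ _ c); [by case: pO|by []|].
  by rewrite mulrC -e.
rewrite big_cons => /(pr _ _ (psO j) (prodO r psO))[h|]; [by exists j|exact: IH].
Qed.

Lemma gprime_dvd_d p : gprime i p -> gdvd i p d%:R -> exists j u, [/\ u \in G, iunit u & p = u * ps j].
Proof.
move=> pp; rewrite dprod => /(gdvd_prod pp)[j [c cO e]]; exists j.
have [pO p0 pu _] := pp; have [psO' ps0 psu psr] := psP j.
have c0 : c != 0 by apply: contra_neq ps0 => c0; rewrite e c0 mul0r.
have [|[b [bG bi] be]|[b [bG bi] be]] := psr c p cO pO.
- by exists 1; [exact: OO1|rewrite mul1r].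
- case: pu; apply: (@iunit_mul1 _ _ b); [by case: pO|by []|].
  by apply: (mulfI c0); rewrite mulr1 [RHS]be e; ring.
- exists b; split=> //; apply: (@iunit_mul1 _ _ c) => //; first by case: cO.
  by apply: (mulfI p0); rewrite mulr1 [RHS]be e; ring.
Qed.

Definition spanned r := exists v u t, [/\ u \in G, iunit u, t \in G, t != 0 & r = u * rv v * t ^+ 2].

Lemma spanned_sqr r t : t \in G -> t != 0 -> spanned r -> spanned (r * t ^+ 2).
Proof.
move=> tG t0 [v [u [z [uG uu zG z0 ->]]]]; exists v, u, (z * t); split=> //.
- by mem.
- by rewrite mulf_neq0.
- by ring.
Qed.

Lemma spanned_ps r j : spanned r -> spanned (ps j * r).
Proof.
move=> [v [u [z [uG uu zG z0 ->]]]].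
have [c [cG c0 ce]] := rvD (delta_mx 0 j) v; rewrite rv_delta in ce.
exists (delta_mx 0 j + v), u, (z * c); split=> //; first by mem.
  by rewrite mulf_neq0.
by apply: (lin_comb (c := u * z ^+ 2) ce); ring.
Qed.

Lemma spanned_unit r u : u \in G -> iunit u -> spanned r -> spanned (u * r).
Proof.
move=> uG uu [v [u' [z [uG' uu' zG z0 ->]]]]; exists v, (u * u'), z; split=> //; first by mem.
  exact: iunitM.
by ring.
Qed.

Lemma EvenAtM p r b : gprime i p -> ~ gdvd i p d%:R -> EvenAt i p (b * r) ->
  (exists j u, [/\ u \in G, iunit u & b = u * ps j]) -> EvenAt i p r.
Proof.
move=> pp pd ev [j [u [uG uu bE]]] t c tG t0 cO e.
have [pO p0 pu pr] := pp.
have uO : OO G u by split=> //; case: uu.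
have bO : OO G b by rewrite bE; apply: OOM => //; exact: psO.
have h : b * r * t ^+ 2 = p * (b * c) by rewrite -mulrA e; ring.
have [[f fO fe]|//] := pr _ _ bO cO (ev t (b * c) tG t0 (OOM bO cO) h).
exfalso; apply: pd; have [b' [bO' -> _]] := psd j.
have uVO : OO G u^-1 by split; [rewrite rpredV|case: uu].
exists (u^-1 * b' * f); first by apply: OOM => //; exact: OOM.
have -> : u^-1 * b' * f * p = u^-1 * b' * (f * p) by ring.
by rewrite -fe bE; field; exact: iunit_neq0.
Qed.

Lemma EvenAt_sqr p r t : t \in G -> t != 0 -> EvenAt i p (r * t ^+ 2) -> EvenAt i p r.
Proof.
move=> tG t0 ev z c zG z0 cO e; apply: (ev (z / t) c) => //; [mem|by rewrite mulf_neq0 ?invr_eq0|].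
by rewrite -e; field.
Qed.

(** After clearing denominators by a square, induct on the norm and strip a Gaussian prime: one
    dividing [d] is recorded in the vector, any other occurs twice by evenness and is absorbed into
    the square. *)
Lemma even_spanned r : r \in G -> r != 0 ->
  (forall p, gprime i p -> ~ gdvd i p d%:R -> EvenAt i p r) -> spanned r.
Proof.
move=> rG r0 ev.
have [n [n0 ni]] := isint_denom r.
have nL : n%:~R != 0 :> L by rewrite intL_eq0.
suff main N x : (gN tau x < N)%N -> OO G x -> x != 0 ->
    (forall p, gprime i p -> ~ gdvd i p d%:R -> EvenAt i p x) -> spanned x.
  have -> : r = (n%:~R * (n%:~R * r)) * (n%:~R^-1) ^+ 2 by field.
  apply: spanned_sqr; [by mem|by rewrite invr_eq0|].
  apply: (main (gN tau (n%:~R * (n%:~R * r))).+1) => //.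
  - by split; [mem|isi].
  - by rewrite !mulf_neq0.
  - move=> p pp pd; apply: (@EvenAt_sqr p _ n%:~R^-1); [mem|by rewrite invr_eq0|].
    have -> : (n%:~R * (n%:~R * r)) * (n%:~R^-1) ^+ 2 = r by field.
    exact: ev.
elim: N x => // N IH x xN xO x0 {}ev.
have [xu|xu] := pselect (iunit x).
  exists 0, x, 1; split; rewrite ?rpred1 ?oner_eq0 //; first by case: xO.
  by rewrite rv0 expr1n !mulr1.
have [p pp [y yO xy]] := exists_gprime ii ti xO x0 xu.
have [pO p0 pu pr] := pp.
have y0 : y != 0 by apply: contra_neq x0 => y0; rewrite xy y0 mul0r.
have p1 : (1 < gN tau p)%N.
  have h : gN tau p <> 1%N by move=> /(gN_unit ii ti pO).
  have : (0 < gN tau p)%N by rewrite lt0n (gN_eq0 ii ti).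
  by lia.
have yN : (gN tau y < N)%N.
  have y1 : (0 < gN tau y)%N by rewrite lt0n (gN_eq0 ii ti).
  move: xN; rewrite xy (gNM ii ti) //; nia.
have [pd|pd] := pselect (gdvd i p d%:R).
  have pj := gprime_dvd_d pp pd.
  have sy : spanned y.
    apply: IH => // p' pp' pd'; apply: (@EvenAtM p' y p) => //.
    by rewrite mulrC -xy; exact: ev.
  case: pj => j [u [uG uu pE]]; rewrite xy pE mulrC -mulrA.
  by apply: spanned_unit => //; apply: spanned_ps.
have [z zO yz] : gdvd i p y.
  apply: (ev p pp pd 1 y); rewrite ?rpred1 ?oner_eq0 //.
  by rewrite expr1n mulr1 xy mulrC.
have z0 : z != 0 by apply: contra_neq y0 => z0; rewrite yz z0 mul0r.
have xE : x = z * p ^+ 2 by rewrite xy yz; ring.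
rewrite xE; apply: spanned_sqr => //; first by case: pO.
apply: IH => //.
- apply: leq_ltn_trans yN; rewrite yz (gNM ii ti) // leq_pmulr //; lia.
- move=> p' pp' pd'; apply: (@EvenAt_sqr p' z p) => //; first by case: pO.
  by rewrite -xE; exact: ev.
Qed.

(** The square root of the ideal (r_v), given by the formula of [sqrt_idealE], which makes
    invariance under [rho] immediate. *)
Definition Jv v : set L := [set x | x \in k /\ isint (x ^+ 2 / rv v)].

Lemma rvk v : rv v \in k. Proof. exact/(subvP (Gk s i))/rvG. Qed.

Lemma JvP v : fractional_ideal k (Jv v) /\ ideal_mul (Jv v) (Jv v) = principal_ideal k (rv v).
Proof.
have [J [fJ JJ]] := rv_Sq v.
by have := sqrt_idealE fJ (rv_neq0 v) (rvk v) JJ; rewrite -/(Jv v) => <-.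
Qed.

Lemma Jv_mod v : emodule k (Jv v). Proof. exact: fractional_emodule (JvP v).1. Qed.

Lemma Jv_invariant v : invariant_ideal G k (Jv v).
Proof.
apply/(invariantP ii ss rs ri); first by move=> x [].
have sub : [set rho x | x in Jv v] `<=` Jv v.
  move=> _ [x [xk xi] <-]; split; first exact: (rhok ii ss rs ri).
  rewrite -rmorphXn /= -(rhoG ii ri (rvG v)) -fmorph_div; exact: isint_aut.
apply/seteqP; split=> // x xJ; have xk : x \in k by case: xJ.
by exists (rho x); [apply: sub; exists x|exact: (rhorho ii ss rs ri)].
Qed.

Lemma Jv_strongly_ambiguous v : strongly_ambiguous G k (ideal_class k (Jv v)).
Proof.
split; first by exists (Jv v) => //; exact: (JvP v).1.
by exists (Jv v); [exact: class_self (Jv_mod v)|exact: Jv_invariant].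
Qed.

(** For an invariant [I], the square of [I] is its norm, generated by some [r] in Q(i). By
    reducedness [r] has even valuation at the primes not dividing [d], so [r = u * rv v * t ^+ 2],
    and [Jv v] is [I] scaled by [t^-1]. *)
Lemma strongly_ambiguousE c : strongly_ambiguous G k c -> exists v, c = ideal_class k (Jv v).
Proof.
move=> [[I0 fI0 <-] [I cI Iinv]].
have mI0 := fractional_emodule fI0.
have [y [yk y0 IE]] := class_memP mI0 cI.
have fI : fractional_ideal k I by rewrite IE; apply: iscale_fractional.
have [Ik _ _ _ _] := fI.
have [r [rG r0 rE]] := norm_principal ii ss rs ri ti fI.
rewrite ((invariantP ii ss rs ri Ik).1 Iinv) in rE.
have rk : r \in k by exact: (subvP (Gk s i)).
have [v [u [t [uG uu tG t0 rvE]]]] : spanned r.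
  apply: even_spanned => // p pp pd.
  by apply: (Sq_even ii ss d4 rs ri ti pp pd rG); exists I.
exists v; rewrite -(class_mem_eq mI0 cI).
have tk : t \in k by exact: (subvP (Gk s i)).
have [u0 ui uv] := uu.
apply: (ideal_class_eqP (fractional_emodule fI) (Jv_mod v)).2.
exists t^-1; split; [mem|by rewrite invr_eq0|].
have -> := sqrt_idealE fI r0 rk rE.
have v0 := rv_neq0 v.
apply/seteqP; split=> x.
  move=> [xk xi]; exists (t * x); last by rewrite mulKf.
  split; first by mem.
  have -> : (t * x) ^+ 2 / r = u^-1 * (x ^+ 2 / rv v) by rewrite rvE; field; rewrite ?t0 ?u0 ?v0.
  exact: isintM.
move=> [z [zk zi] <-]; split; first by mem.
have -> : (t^-1 * z) ^+ 2 / rv v = u * (z ^+ 2 / r) by rewrite rvE; field; rewrite ?t0 ?u0 ?v0.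
exact: isintM.
Qed.

Lemma Jv_capitulates K v : (k <= K)%VS ->
  capitulation_kernel k K (ideal_class k (Jv v)) <-> sqclass K (rv v).
Proof.
move=> kK; have [fJ JJ] := JvP v; split.
  by move/(capitulationP kK fJ)/(sqrt_ideal_ext kK fJ (rvk v) (rv_neq0 v) JJ).
by move/(sqrt_ideal_ext kK fJ (rvk v) (rv_neq0 v) JJ)/(capitulationP kK fJ).
Qed.

Lemma Jv_classE (v w : V) : ideal_class k (Jv v) = ideal_class k (Jv w) <-> sqclass k (rv v * rv w).
Proof.
have v0 := rv_neq0 v; have w0 := rv_neq0 w; split.
  move=> /(ideal_class_eqP (Jv_mod v) (Jv_mod w))[x [xk x0 e]].
  have := (JvP w).2; rewrite e iscale_im iscale_imr iscaleM (JvP v).2 principalE iscaleM -principalE.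
  have x20 : x * x * rv v != 0 by rewrite !mulf_neq0.
  have xvk : x * x * rv v \in k by have := rvk v => ?; mem.
  move=> /(principal_eqP x20 xvk (rvk w)) wu.
  exists (x * rv v), (rv w / (x * x * rv v)); split=> //.
  - by have := rvk v => ?; mem.
  - by rewrite mulf_neq0.
  - by field; rewrite ?x0 ?v0.
move=> [y [u [yk y0 [u0 ui uv] e]]]; apply: (ideal_class_eqP (Jv_mod v) (Jv_mod w)).2.
have vk := rvk v.
have wE : rv w = u * (y / rv v) ^+ 2 * rv v.
  by apply: (mulfI v0); rewrite e; field.
exists (y / rv v); split; [mem|by rewrite mulf_neq0 ?invr_eq0|].
apply/seteqP; split=> x.
  move=> [xk xi]; exists (x / (y / rv v)); last by field; rewrite ?y0 ?v0.
  split; first by mem.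
  have -> : (x / (y / rv v)) ^+ 2 / rv v = u * (x ^+ 2 / rv w) by rewrite wE; field; rewrite ?y0 ?v0 ?u0.
  exact: isintM.
move=> [z [zk zi] <-]; split; first by mem.
have -> : (y / rv v * z) ^+ 2 / rv w = u^-1 * (z ^+ 2 / rv v) by rewrite wE; field; rewrite ?y0 ?v0 ?u0.
exact: isintM.
Qed.

End Ambiguous.

(** * Ramification in quadratic extensions of k *)

Section RamifiedExtensions.
Variables (L : splittingFieldType rat) (s i : L) (d : nat) (rho tau : 'AEnd(L)).
Implicit Types (E F : {subfield L}) (x y z u w a b c t r p : L) (J I P : set L).
Local Notation OO := ring_of_integers.
Hypotheses (ii : i ^+ 2 = -1) (ss : s ^+ 2 = d%:R) (d4 : (d %% 4 = 3)%N).
Hypotheses (rs : rho s = - s) (ri : rho i = i) (ts : tau s = s) (ti : tau i = - i).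
Local Notation k := (kk s i).
Local Notation G := (Gi i).

Lemma nat_OO E n : OO E (n%:R : L). Proof. by split; [mem|isi]. Qed.

Section AtPrime.
Variables (K : {subfield L}) (sigma : 'AEnd(L)) (P : set L).
Hypotheses (qs : quad_inv k K sigma) (prP : prime_ideal K P).
Let kK : (k <= K)%VS. Proof. by case: qs. Qed.
Let mP : emodule K P. Proof. by have [] := prime_proper prP. Qed.
Let PD x y : P x -> P y -> P (x + y). Proof. by have [_ h _] := mP; exact: h. Qed.
Let PM x y : OO K x -> P y -> P (x * y). Proof. by have [_ _ h] := mP; exact: h. Qed.
Let PN x : P x -> P (- x). Proof. exact: emoduleN mP. Qed.
Let PP x y : OO K x -> OO K y -> P (x * y) -> P x \/ P y.
Proof. by have [_ _ _ h] := prP; exact: h. Qed.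
Let P1 : ~ P 1. Proof. by have [_ _ h _] := prP. Qed.
Let PO x : P x -> OO K x. Proof. by have [_ h _ _] := prP; exact: h. Qed.

Lemma prime_sqr x : OO K x -> P (x ^+ 2) -> P x.
Proof. by move=> xO; rewrite expr2 => /(PP xO xO)[]. Qed.

Lemma two_or_odd n : (0 < n)%N -> P n%:R -> P 2%:R \/ exists2 m, odd m & P m%:R.
Proof.
elim/ltn_ind: n => n IH n0 Pn.
case on: (odd n); first by right; exists n.
have e : n = (2 * n./2)%N by rewrite mul2n even_halfK // on.
rewrite e natrM in Pn; case/(PP (nat_OO _ _) (nat_OO _ _)): Pn; first by left.
by apply: IH; move: e n0; clear; lia.
Qed.

(* The residue field at a prime above 2 is perfect: explicitly, the square of
   a + b (om + n) is a + b om modulo 2 for n = (d + 1) / 4. *)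
Lemma frobenius_surj y : P 2%:R -> OO k y -> exists2 c, OO k c & P (c ^+ 2 - y).
Proof.
move=> P2 yO; have [yk yi] := yO; have iO : OO G i := OOi ii.
have P1i : P (1 + i).
  apply: prime_sqr; first by apply: (OOS (subv_trans (Gk s i) kK)); apply: OOD; [exact: OO1|].
  have -> : (1 + i) ^+ 2 = i * 2%:R by apply: (lin_comb (c := 1) ii); ring.
  by apply: PM => //; apply: (OOS (subv_trans (Gk s i) kK)).
have GK x : OO G x -> OO K x := OOS (subv_trans (Gk s i) kK).
have Peven (n : int) : (exists m, n = 2 * m) -> P n%:~R.
  move=> [m ->]; rewrite rmorphM mulrC; apply: PM => //; by split; [mem|isi].
have evenP (n : int) : exists m, n ^+ 2 - n = 2 * m.
  have [m [->|->]] := int_parity n; [exists (2 * m ^+ 2 - m)|exists (2 * m ^+ 2 + m)]; ring.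
have sqG x : OO G x -> P (x ^+ 2 - x).
  move=> /(OOGiP ii ti)[a [b ->]].
  have -> : (a%:~R + b%:~R * i) ^+ 2 - (a%:~R + b%:~R * i) = ((a - b) ^+ 2 - (a - b))%:~R +
     (2%:R * (a - b)%:~R * b%:~R + b%:~R ^+ 2 * (1 + i) - b%:~R) * (1 + i).
    by rewrite rmorphB rmorphXn !rmorphB; ring.
  apply: PD; first exact: Peven (evenP _).
  apply: PM => //; apply: GK; split; last by have := isint_i ii => ?; isi.
  by have := Gi_i i => ?; mem.
set n0 := ((d + 1) %/ 4)%N.
pose T0 := y + rho y; pose T1 := om s i * y + rho (om s i * y).
have omO := OOom ii ss d4; have [omk omi] := omO.
have trO z : OO k z -> OO G (z + rho z).
  by move=> [zk zi]; split; [exact: (quad_trace (qrho ii ss rs ri))|isi].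
have T0O : OO G T0 by exact: trO.
have T1O : OO G T1 by apply: trO; exact: OOM.
have Gkk x : OO G x -> OO k x := OOS (Gk s i).
pose h := (d./2).
have dh : d = (2 * h + 1)%N.
  have od : odd d by move: d4; clear; lia.
  by rewrite /h -{1}(odd_double_half d) od mul2n addnC.
have dy : d%:R * y = (T1 - T0 + 2%:R * n0%:R * T0) + om s i * (T0 - 2%:R * T1).
  have e1 : (om s i - rho (om s i)) * y = T1 - rho (om s i) * T0.
    by rewrite /T1 /T0 (rmorphM _ (om s i) y) /=; ring.
  have e2 : om s i - rho (om s i) = 2%:R * om s i - 1 by rewrite (rho_om rs ri); ring.
  have e3 : (2%:R * om s i - 1) ^+ 2 = - d%:R.
    by rewrite -e2 (om_sub rs ri) exprMn ii ss mulN1r.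
  have oe := om_eq ii ss d4; rewrite -/n0 in oe.
  have -> : d%:R * y = - (2%:R * om s i - 1) * ((2%:R * om s i - 1) * y).
    by apply: (lin_comb (c := y) e3); ring.
  rewrite -{2}e2 e1 (rho_om rs ri).
  by apply: (lin_comb (c := - 2%:R * T0) oe); ring.
pose A := T1 - T0; pose e := n0%:R * T0 - om s i * T1 - h%:R * y.
(* As [d = 2 h + 1], the expression of [d y] through traces gives [y] itself modulo 2. *)
have ye : y = A + T0 * om s i + 2%:R * e.
  have : (2%:R * h%:R + 1) * y = (T1 - T0 + 2%:R * n0%:R * T0) + om s i * (T0 - 2%:R * T1).
    by rewrite -dy dh natrD natrM.
  by move=> e4; rewrite /A /e; apply: (lin_comb (c := 1) e4); ring.
have AO : OO G A by apply: OOD => //; exact: OON.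
have kO n : OO k (n%:R : L) := nat_OO k n.
have eO : OO k e.
  by rewrite /e; repeat first [done | exact: Gkk | apply: OOD | apply: OON | apply: OOM].
exists (A + T0 * (om s i + n0%:R)).
  by repeat first [done | exact: Gkk | apply: OOD | apply: OOM].
have -> : (A + T0 * (om s i + n0%:R)) ^+ 2 - y = (A ^+ 2 - A) + om s i * (T0 ^+ 2 - T0)
  + T0 ^+ 2 * ((n0%:Z ^+ 2 - n0%:Z)%:~R) + (T0 ^+ 2 * n0%:R * om s i + A * T0 * (om s i + n0%:R) - e) * 2%:R.
  have oe := om_eq ii ss d4; rewrite -/n0 in oe.
  rewrite rmorphB rmorphXn /= -pmulrn.
  have -> : y = A + T0 * om s i + 2%:R * e by exact: ye.
  by apply: (lin_comb (c := T0 ^+ 2) oe); ring.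
have kKO x : OO k x -> OO K x := OOS kK.
apply: PD; last first.
  apply: PM => //; apply: kKO.
  by repeat first [done | exact: Gkk | apply: OOD | apply: OON | apply: OOM | apply: OOX].
apply: PD; last by apply: PM; [apply: GK; exact: OOX|exact: Peven (evenP _)].
apply: PD; first exact: sqG.
by apply: PM; [exact: kKO|exact: sqG].
Qed.

(** If [sigma] acts trivially modulo [P], every residue comes from [O_k], which is what
    [ramified_inertia] asks for. In residue characteristic 2, [w ^+ 2] is congruent to the norm of
    [w], which has a square root modulo [P]; if an odd [m] lies in [P], then [w] is congruent to
    half its trace, [(m + 1) / 2] being an inverse of 2. *)
Lemma ramified_at x n : unramified_finite k K -> x \in K -> x != 0 -> sigma x = - x ->
  (0 < n)%N -> P n%:R -> (forall w, OO K w -> P ((w - sigma w) ^+ 2)) -> False.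
Proof.
move=> unr xK x0 sx n0 Pn Pin.
have sO w : OO K w -> OO K (sigma w).
  by case: qs => _ h _ _ _ [wK wi]; split; [exact: h|isi].
have {}Pin w : OO K w -> P (w - sigma w).
  by move=> wO; apply: prime_sqr; [apply: OOD => //; apply/OON/sO|exact: Pin].
have [_ npK] := unr _ prP; apply: npK.
apply: (ramified_inertia qs (inv_k ii ss rs ri ti) prP xK x0 sx Pin) => w wO.
have nk : OO k (w * sigma w).
  split; first by apply: (quad_norm qs); case: wO.
  by apply: isintM; [case: wO|case: (sO _ wO)].
have tk : OO k (w + sigma w).
  split; first by apply: (quad_trace qs); case: wO.
  by apply: isintD; [case: wO|case: (sO _ wO)].
have [P2|[m om Pm]] := two_or_odd n0 Pn.
  have [c cO Pc] := frobenius_surj P2 nk; exists c => //.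
  have cK := OOS kK cO.
  apply: prime_sqr; first by apply: OOD => //; apply: OON.
  have -> : (w - c) ^+ 2 = w * (w - sigma w) + (c ^+ 2 - w * sigma w) + (w * sigma w - w * c) * 2%:R.
    by ring.
  apply: PD; last by apply: PM => //; apply: OOD; [exact: OOM (sO _ wO)|apply/OON/OOM].
  by apply: PD => //; apply: PM => //; exact: Pin.
have hm : (m = 2 * m./2 + 1)%N by rewrite -{1}(odd_double_half m) om mul2n addnC.
have hO : OO k ((m./2 + 1)%N%:R : L) := nat_OO k _.
exists ((m./2 + 1)%N%:R * (w + sigma w)); first exact: OOM.
have -> : w - (m./2 + 1)%N%:R * (w + sigma w) = (m./2 + 1)%N%:R * (w - sigma w) - w * m%:R.
  have mL : m%:R = 2%:R * m./2%:R + 1 :> L by rewrite {1}hm natrD natrM.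
  by rewrite natrD mL; ring.
apply: PD; last by apply: PN; apply: PM.
by apply: PM; [exact: OOS hO|exact: Pin].
Qed.

End AtPrime.

(** * Constraints on the radicand of an unramified quadratic extension *)

Section Quadratic.
Variables (x : L) (K : {subfield L}) (sigma : 'AEnd(L)).
Hypotheses (xx : x ^+ 2 \in k) (x0 : x != 0) (sx : sigma x = - x).
Hypotheses (KE : K = <<k; x>>%AS) (sk' : forall y, y \in k -> sigma y = y).
Hypothesis unr : unramified_finite k K.

Lemma qsig : quad_inv k K sigma.
Proof. by rewrite KE; exact: quad_inv_adjoin. Qed.
Lemma xK : x \in K. Proof. by rewrite KE; exact: memv_adjoin. Qed.

Lemma diffE w : OO K w -> exists c, [/\ c \in k, w - sigma w = c * x & OO k ((w - sigma w) ^+ 2)].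
Proof.
have [kK sK kfix sigsig sfix] := qsig; have xk := xK.
move=> [wK wi]; have swK := sK _ wK.
have ck : (w - sigma w) / x \in k.
  apply: sfix; first by mem.
  by rewrite fmorph_div rmorphB /= sx sigsig // invrN; ring.
exists ((w - sigma w) / x); rewrite divfK //; split=> //; split; last by isi.
have -> : (w - sigma w) ^+ 2 = ((w - sigma w) / x) ^+ 2 * x ^+ 2 by field.
by mem.
Qed.

Lemma gprime_above p : gprime i p -> exists P n, [/\ prime_ideal K P, P p, (0 < n)%N & P n%:R].
Proof.
move=> pp; have [pO p0 pu _] := pp.
have GK : (G <= K)%VS by apply: subv_trans (Gk s i) _; case: qsig.
have pK := OOS GK pO.
have [P [prP Pp]] := exists_prime pK p0 pu.
exists P, (gN tau p); split=> //; first by rewrite lt0n (gN_eq0 ii ti).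
rewrite -(gNE ii ti) // mulrC; have [[_ _ PM] _ _] := prime_proper prP.
by apply: PM => //; apply: (OOS GK); exact: (tauO ii ti).
Qed.

(** Otherwise [x ^+ 2 * t ^+ 2 = p * b] with [p] not dividing [b], and each [D = (w - sigma w) ^+ 2]
    is [c ^+ 2 * p * b]. Reducedness makes [c * b] integral, so [D * b = (c * b) ^+ 2 * p] lies in a
    prime above [p] while [b] does not; then [D] does, and that prime ramifies. *)
Lemma radicand_even p : gprime i p -> ~ gdvd i p d%:R -> x ^+ 2 \in G -> EvenAt i p (x ^+ 2).
Proof.
move=> pp pd xG t b tG t0 bO e; apply: contrapT => pb.
have [P [n [prP Pp n0 Pn]]] := gprime_above pp.
have [[_ PD PM] PO P1] := prime_proper prP; have [_ _ _ PP] := prP.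
have [pO p0 _ _] := pp; have [pG pi] := pO; have [bG bi] := bO.
have kK : (k <= K)%VS by case: qsig.
have GK : (G <= K)%VS by apply: subv_trans (Gk s i) kK.
apply: (ramified_at qsig prP unr xK x0 sx n0 Pn) => w wO.
have [c0 [ck we DO]] := diffE wO.
pose c := c0 / t; set D := (w - sigma w) ^+ 2 in DO *.
have tk := subvP (Gk s i) _ tG; have pk := subvP (Gk s i) _ pG; have bk := subvP (Gk s i) _ bG.
have ck' : c \in k by rewrite /c; mem.
have DE : D = c ^+ 2 * (p * b) by rewrite /D we -e /c; field.
have [_ Di] := DO.
have cb : isint (c * b).
  have -> : c * b = (c * p * b) / p by field.
  have e2 : (c * p * b) ^+ 2 / p = D * b by rewrite DE; field.
  apply: (reduced_mod ii ss d4 rs ri ti pp pd); last by rewrite e2; isi.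
  split; first by mem.
  by apply: isint_sqr; have -> : (c * p * b) ^+ 2 = D * b * p by [rewrite DE; ring]; isi.
have PDb : P (D * b).
  have -> : D * b = (c * b) ^+ 2 * p by rewrite DE; ring.
  by apply: PM => //; apply: OOX; apply: (OOS kK); split; [mem|].
have [//|Pb] := PP _ _ (OOS kK DO) (OOS GK bO) PDb.
exfalso; apply: P1; have [u [v [uO vO <-]]] := gprime_coprime ii ti pp bO pb.
by apply: PD; apply: PM => //; apply: (OOS GK).
Qed.

(** The valuation of [e ^+ 2 * d] at [p] is odd and nonnegative, hence positive. *)
Lemma gprime_odd p b e : gprime i p -> OO G b -> d%:R = p * b -> ~ gdvd i p b -> e \in G ->
  isint (e ^+ 2 * d%:R) -> gdvd i p (e ^+ 2 * d%:R).
Proof.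
move=> pp bO de pb eG ei; have [pO p0 _ pr] := pp.
have EO : OO G (e ^+ 2 * d%:R) by split=> //; mem.
have [bG bi] := bO; have [pG pi] := pO.
have edO : OO G (e * d%:R).
  split; first by mem.
  by apply: isint_sqr; have -> : (e * d%:R) ^+ 2 = e ^+ 2 * d%:R * d%:R by [ring]; isi.
have [f fO ef] : gdvd i p (e * d%:R).
  have [] // : gdvd i p (e * d%:R) \/ gdvd i p (e * d%:R).
  apply: pr => //; exists (e ^+ 2 * d%:R * b); first exact: OOM.
  by apply: (lin_comb (c := e ^+ 2 * d%:R) de); ring.
have : gdvd i p (e ^+ 2 * d%:R * b).
  exists (f ^+ 2); first exact: OOX.
  apply: (mulIf p0); have -> : f ^+ 2 * p * p = (e * d%:R) ^+ 2 by rewrite ef; ring.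
  by apply: (lin_comb (c := - e ^+ 2 * d%:R) de); ring.
by case/(pr _ _ EO bO).
Qed.

(** For [D = (w - sigma w) ^+ 2], both [(D - rho D) ^+ 2] and [- D * rho D] are [d] times squares
    from Q(i), hence divisible by [p]. So [D ^+ 2 = D * rho D + D * (D - rho D)] lies in the prime
    above [p], which ramifies. *)
Lemma radicand_not_s t p b : gprime i p -> OO G b -> d%:R = p * b -> ~ gdvd i p b ->
  t \in G -> x ^+ 2 = t * s -> False.
Proof.
move=> pp bO de pb tG xE.
have [P [n [prP Pp n0 Pn]]] := gprime_above pp.
have [[_ PD PM] PO P1] := prime_proper prP; have [_ _ _ PP] := prP.
have kK : (k <= K)%VS by case: qsig.
have GK : (G <= K)%VS by apply: subv_trans (Gk s i) kK.
have s0 := s_neq0 ss d4.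
apply: (ramified_at qsig prP unr xK x0 sx n0 Pn) => w wO.
have [c [ck we DO]] := diffE wO; set D := (w - sigma w) ^+ 2 in DO *.
have [Dk Di] := DO; have skk := sk s i; have rDk := rhok ii ss rs ri Dk.
have DE : D = c ^+ 2 * (t * s) by rewrite /D we -xE; ring.
have P_G z : gdvd i p z -> P z by move=> [f fO ->]; apply: PM => //; exact: OOS fO.
have rD : rho D = - (rho c ^+ 2 * (t * s)).
  by rewrite DE rmorphM rmorphXn rmorphM /= rs (rhoG ii ri tG); ring.
have E1 : P ((D - rho D) ^+ 2).
  pose e := (D - rho D) / s.
  have eG : e \in G.
    apply: (rhofix ii ss rs ri); first by rewrite /e; mem.
    by rewrite /e fmorph_div rmorphB /= (rhorho ii ss rs ri) // rs invrN; ring.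
  have e2 : (D - rho D) ^+ 2 = e ^+ 2 * d%:R by rewrite -ss /e; field.
  by rewrite e2; apply: P_G; apply: (gprime_odd pp bO de pb eG); rewrite -e2; isi.
have rDO : OO k (rho D) by split=> //; isi.
have E2 : P (D - rho D).
  apply: (prime_sqr prP) => //; apply: (OOS kK); apply: OOD => //; exact: OON.
have E3 : P (D * rho D).
  pose g := c * rho c * t.
  have gG : g \in G.
    by have : c * rho c \in G := quad_norm (qrho ii ss rs ri) ck => ?; rewrite /g; mem.
  have e3 : D * rho D = - (g ^+ 2 * d%:R) by rewrite rD DE -ss /g; ring.
  have e4 : g ^+ 2 * d%:R = - (D * rho D) by rewrite e3 opprK.
  rewrite e3; apply: (emoduleN (And3 _ PD PM)); first by have [[]] := prime_proper prP.
  by apply: P_G; apply: (gprime_odd pp bO de pb gG); rewrite e4; isi.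
apply: (prime_sqr prP); first exact: OOS DO.
have -> : D ^+ 2 = D * rho D + D * (D - rho D) by ring.
by apply: PD => //; apply: PM => //; exact: OOS DO.
Qed.

(** Ramification occurs above [la = 1 + i]. With trace [A] of [w] and [w - sigma w = c * x], put
    [B = n c]; then [n D = i * B ^+ 2], and it suffices that [la] divides [B]. *)
Lemma radicand_not_i (n : nat) : odd n -> x ^+ 2 = i * n%:R -> False.
Proof.
move=> on xE; pose la := 1 + i.
have laO : OO G la by apply: OOD; [exact: OO1|exact: OOi].
have [laG lai] := laO.
have la2 : la ^+ 2 = 2%:R * i by rewrite /la; apply: (lin_comb (c := 1) ii); ring.
have la0 : la != 0.
  by rewrite -sqrf_eq0 la2 mulf_neq0 ?two_neq0 ?i_neq0.
have la1 : la * (1 - i) = 2%:R by rewrite /la; apply: (lin_comb (c := -1) ii); ring.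
have gla : gN tau la = 2%N.
  apply: (@natL_inj L); rewrite -(gNE ii ti laO) -la1 /la rmorphD rmorph1 /= ti; ring.
have pla : gprime i la by apply: (gprime_norm ii ti laO gla).
have lad : ~ gdvd i la d%:R.
  move=> [f fO fe]; have := congr1 (gN tau) fe; rewrite (gNM ii ti) // gla.
  have -> : gN tau (d%:R : L) = (d ^ 2)%N.
    have -> : d%:R = (d%:Z)%:~R + 0%:~R * i by rewrite mul0r addr0.
    by rewrite (gN_int ii ti) expr0n addr0 abszX.
  by move=> e; have : odd (d ^ 2) by [rewrite oddX /=; move: d4; clear; lia]; rewrite e oddM andbF.
have [P [m [prP Pp m0 Pm]]] := gprime_above pla.
have [[_ PD PM] PO P1] := prime_proper prP; have [_ _ _ PP] := prP.
have [kK sK kfix sigsig sfix] := qsig.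
have GK : (G <= K)%VS by apply: subv_trans (Gk s i) kK.
have iO := OOi ii; have i_i := isint_i ii; have iG := Gi_i i; have ikk := ik s i.
apply: (ramified_at qsig prP unr xK x0 sx m0 Pm) => w wO.
have [c [ck we DO]] := diffE wO; set D := (w - sigma w) ^+ 2 in DO *.
have [Dk Di] := DO; have [wK wi] := wO; have swK := sK _ wK.
pose A := w + sigma w; pose B := n%:R * c.
have Ak : A \in k by apply: (quad_trace qsig).
have Ai : isint A by rewrite /A; isi.
have nD : n%:R * D = i * B ^+ 2.
  by rewrite /D we /B; have -> : (c * x) ^+ 2 = c ^+ 2 * x ^+ 2 by [ring]; rewrite xE; ring.
have Bk : B \in k by rewrite /B; mem.
have Bi : isint B.
  apply: isint_sqr; have -> : B ^+ 2 = - i * (n%:R * D).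
    by rewrite nD; apply: (lin_comb (c := B ^+ 2) ii); ring.
  by isi.
have nA : n%:R * A ^+ 2 - i * B ^+ 2 = 4%:R * n%:R * (w * sigma w).
  by rewrite -nD /A /D; ring.
pose N := w * sigma w.
have Ni : isint N by rewrite /N; isi.
have hn : (n = 2 * n./2 + 1)%N by rewrite -{1}(odd_double_half n) on mul2n addnC.
have hnL : n%:R = 2%:R * n./2%:R + 1 :> L by rewrite {1}hn natrD natrM.
have i1i : isint (1 - i) by isi.
have r2 : 2%:R / la = 1 - i by rewrite -la1 mulrC mulKf.
(* Modulo [la], [nA] says [A ^+ 2 = B ^+ 2], since [n] and [i] are 1 there; reducedness divides
   [A - B] itself by [la]. *)
have Ae : isint ((A - B) / la).
  apply: (reduced_mod ii ss d4 rs ri ti pla lad); first by split; [mem|isi].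
  have -> : (A - B) ^+ 2 / la = (2%:R / la) * (2%:R * n%:R * N - n./2%:R * A ^+ 2 - A * B) + B ^+ 2.
    have -> : B ^+ 2 = la * B ^+ 2 / la by rewrite mulrC mulKf.
    have e1 : (A - B) ^+ 2 = 2%:R * (2%:R * n%:R * N - n./2%:R * A ^+ 2 - A * B) + la * B ^+ 2.
      rewrite hnL /la in nA *; apply: (lin_comb (c := 1) nA); rewrite /N; ring.
    by rewrite e1; ring.
  by rewrite r2; isi.
pose e := (A - B) / la.
have AE : A = B + la * e by rewrite /e; field.
(* Substituting [A = B + la * e] in [nA] shows that 2 divides [(n - i) * B ^+ 2]. *)
have h1 : isint ((n%:R - i) * B ^+ 2 / 2%:R).
  have t0 := two_neq0 L.
  have -> : (n%:R - i) * B ^+ 2 / 2%:R = 2%:R * n%:R * N - n%:R * (la * e * B + i * e ^+ 2).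
    apply: (mulIf t0); rewrite divfK //.
    have e2 := la2; move: nA; rewrite AE -/N => nA.
    have -> : (2%:R * n%:R * N - n%:R * (la * e * B + i * e ^+ 2)) * 2%:R =
      4%:R * n%:R * N - n%:R * (2%:R * la * e * B + 2%:R * i * e ^+ 2) by ring.
    rewrite -nA -la2; ring.
  by isi.
have h2 : isint (B / la).
  apply: (reduced_mod ii ss d4 rs ri ti pla lad); first by [].
  (* [n ^ 2 + 1] is twice an odd number, so [n - i] contains [la] only once and [la] divides
     [B ^+ 2]. *)
  have [m1 m1E] : exists m1 : nat, (n ^ 2 + 1 = 2 * (2 * m1 + 1))%N.
    by exists ((n ^ 2 - 1) %/ 4)%N; rewrite hn; clear; lia.
  have m1L : n%:R ^+ 2 + 1 = 2%:R * (2%:R * m1%:R + 1) :> L.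
    by have := congr1 (fun n : nat => n%:R : L) m1E; rewrite natrD natrX natrM natrD natrM.
  have -> : B ^+ 2 / la = ((n%:R - i) * B ^+ 2 / 2%:R) * ((2%:R / la) * n./2%:R + 1) - (2%:R / la) * m1%:R * B ^+ 2.
    have t0 := two_neq0 L.
    have e3 : (n%:R - i) * (2%:R * n./2%:R + la) = 2%:R * (2%:R * m1%:R + 1).
      have -> : 2%:R * n./2%:R + la = n%:R + i by rewrite hnL /la; ring.
      by rewrite -m1L; apply: (lin_comb (c := -1) ii); ring.
    have -> : ((n%:R - i) * B ^+ 2 / 2%:R) * ((2%:R / la) * n./2%:R + 1) =
       (n%:R - i) * (2%:R * n./2%:R + la) * (B ^+ 2 / 2%:R / la) by field; rewrite ?la0 ?t0.
    by rewrite e3; field; rewrite ?la0 ?t0.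
  by rewrite r2; isi.
have PB : P B.
  have -> : B = (B / la) * la by field.
  by apply: PM => //; apply: (OOS kK); split=> //; have := subvP (Gk s i) _ laG => ?; mem.
have P2 : P 2%:R by rewrite -la1 mulrC; apply: PM => //; apply: (OOS GK); split; [mem|].
have BO : OO K B by apply: (OOS kK).
have PnD : P (n%:R * D).
  rewrite nD expr2 mulrA; apply: PM => //; apply: OOM => //; exact: OOS iO.
have [Pn|//] := PP _ _ (nat_OO K n) (OOS kK DO) PnD.
exfalso; apply: P1; have -> : 1 = n%:R + (- n./2%:R) * 2%:R :> L by rewrite hnL; ring.
by apply: PD => //; apply: PM => //; apply: OON; exact: nat_OO.
Qed.

End Quadratic.

(* k(sqrt a) is generated over k both by (1 + sqrt a)/2 and by (1 + i sqrt b)/2,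
   with coprime discriminants a and - b. *)
Lemma unramified_sqrt x y (a b : nat) (K : {subfield L}) (sigma : 'AEnd(L)) :
  x ^+ 2 = a%:R -> y ^+ 2 = b%:R -> coprime a b -> (a %% 4 = 1)%N -> (b %% 4 = 3)%N ->
  K = <<k; x>>%AS -> y \in K -> sigma x = - x -> sigma y = - y ->
  (forall z, z \in k -> sigma z = z) -> unramified_ext k K.
Proof.
move=> xx yy ab a4 b4 KE yK sx sy skk.
have xk : x ^+ 2 \in k by rewrite xx; mem.
have qs : quad_inv k K sigma by rewrite KE; exact: quad_inv_adjoin.
have kK : (k <= K)%VS by case: qs.
have xK : x \in K by rewrite KE; exact: memv_adjoin.
have ikk := ik s i; have iK := subvP kK _ ikk; have t0 := two_neq0 L.
have f0 : 4%:R != 0 :> L by rewrite natL_eq0.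
have half (v : L) (c : int) : v ^+ 2 = (4 * c + 1)%:~R -> isint ((1 + v) / 2%:R).
  move=> vv; apply: (isint_quad (isint1 L) (isint_int L (- c))).
  have -> : ((1 + v) / 2%:R) ^+ 2 - 1 * ((1 + v) / 2%:R) + (- c)%:~R = (v ^+ 2 - (4 * c + 1)%:~R) / 4%:R.
    by rewrite rmorphD rmorphM rmorphN /=; field; rewrite ?t0 ?f0.
  by rewrite vv subrr mul0r.
split=> //; last first.
  (* [k] contains [i], hence has no real place. *)
  move=> f /(_ i ikk) fi; exfalso.
  have : f i ^+ 2 = -1 by rewrite -rmorphXn ii rmorphN rmorph1.
  move=> e; have := real_exprn_even_ge0 (n := 2) fi isT.
  by rewrite e oppr_ge0 ler10.
move=> P prP; have [[P0 PD PM] PO P1] := prime_proper prP.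
have xO : OO K x by split=> //; apply: isint_sqr; rewrite xx; isi.
have iyO : OO K (i * y).
  by split; [mem|apply: isint_sqr; rewrite exprMn ii yy; isi].
have [Px|Px] := pselect (P x).
  (* A prime containing both [x] and [i * y] would contain the coprime numbers [a] and [b]; so at
     each prime one of the two generators has its conjugate difference outside [P]. *)
  have Py : ~ P (i * y).
    move=> Py; apply: P1.
    have a_gt0 : (0 < a)%N by move: a4; clear; case: a.
    have [u v uv _] := egcdnP b a_gt0; rewrite (eqP ab) in uv.
    have -> : 1 = u%:R * (x * x) + v%:R * ((i * y) * (i * y)) :> L.
      rewrite -!expr2 exprMn ii yy xx mulN1r mulrN -!natrM uv natrD; ring.
    apply: PD; rewrite mulrA; [apply: (PM (u%:R * x))|apply: (PM (v%:R * (i * y)))] => //.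
      by apply: OOM => //; exact: nat_OO.
    by apply: OOM => //; exact: nat_OO.
  apply: (unramified_different qs (inv_k ii ss rs ri ti) prP (t := (1 + i * y) / 2%:R)).
    split; first by mem.
    apply: (half _ (- ((b + 1) %/ 4)%N%:Z)).
    rewrite exprMn ii yy mulN1r.
    have -> : 4 * - ((b + 1) %/ 4)%N%:Z + 1 = - b%:Z by move: b4; clear; lia.
    by rewrite rmorphN.
  rewrite fmorph_div rmorphD rmorph1 rmorphM rmorph_nat /= sy skk //.
  by have -> : (1 + i * y) / 2%:R - (1 + i * - y) / 2%:R = i * y by [field].
apply: (unramified_different qs (inv_k ii ss rs ri ti) prP (t := (1 + x) / 2%:R)).
  split; first by mem.
  apply: (half _ (a %/ 4)%N%:Z); rewrite xx.
  by have -> : 4 * (a %/ 4)%N%:Z + 1 = a%:Z by move: a4; clear; lia.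
rewrite fmorph_div rmorphD rmorph1 rmorph_nat /= sx.
by have -> : (1 + x) / 2%:R - (1 - x) / 2%:R = x by [field].
Qed.

End RamifiedExtensions.

(** * Square classes over k *)

Section GaussianPrimes.
Variables (L : splittingFieldType rat) (i : L) (tau : 'AEnd(L)).
Hypotheses (ii : i ^+ 2 = -1) (ti : tau i = - i).
Local Notation OO := ring_of_integers.
Local Notation G := (Gi i).
Implicit Types (E : {subfield L}) (x y z w r : L).

Lemma gN_nat (n : nat) : gN tau (n%:R : L) = (n ^ 2)%N.
Proof.
have -> : n%:R = (n%:Z)%:~R + 0%:~R * i by rewrite mul0r addr0.
by rewrite (gN_int ii ti) expr0n addr0 abszX.
Qed.

Lemma gdvd_gN x y : OO G x -> gdvd i x y -> (gN tau x %| gN tau y)%N.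
Proof. by move=> xO [c cO ->]; rewrite (gNM ii ti) // dvdn_mull. Qed.

Lemma gN_tau x (n : nat) : OO G x -> x * tau x = n%:R -> gN tau x = n.
Proof. by move=> xO e; apply: (@natL_inj L); rewrite -(gNE ii ti xO). Qed.

(** For a prime, the factorisation from [pell_half] with [g > 1] has [g = p] and [h = 1]. *)
Lemma neg_pell p : prime p -> (p %% 4 = 1)%N -> exists u v : nat, (p * u ^ 2 = v ^ 2 + 1)%N.
Proof.
move=> pp p4; have [|g [h [u [v [pE g1 e]]]]] := @pell_half p _ p4.
  move=> c; apply/eqP => pc; have : (c %| p)%N by rewrite pc dvdn_mulr.
  by case/((primeP pp).2 c)/orP => /eqP ce; move: pc (prime_gt1 pp); rewrite ce; clear; nia.
exists u, v; have gp : (g %| p)%N by rewrite pE dvdn_mulr.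
have ge : g = p by case/((primeP pp).2 g)/orP: gp => /eqP // ge; rewrite ge in g1.
by rewrite -ge e; move: pE; rewrite ge; have := prime_gt0 pp; clear; nia.
Qed.

Lemma gdvd_nat_imag (n : nat) (a b : int) : (1 < n)%N -> b = 1 \/ b = -1 ->
  ~ gdvd i (n%:R : L) (a%:~R + b%:~R * i).
Proof.
move=> n1 b1 [f fO e2]; have [x [y fE]] := (OOGiP ii ti f).1 fO; rewrite fE in e2.
have : b = y * n%:Z.
  apply: (@intL_inj L); rewrite rmorphM /=.
  have e3 := congr1 tau e2; rewrite !(rmorphD, rmorphM, rmorph_nat, rmorph_int) /= ti in e3.
  have t0 := two_neq0 L; have i0 := i_neq0 ii.
  have : 2%:R * i * b%:~R = 2%:R * i * (y%:~R * n%:R).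
    apply: (lin_comb (c := 1) e2); rewrite -[RHS]addr0.
    by apply: (lin_comb (c := -1) e3); ring.
  by apply: mulfI; rewrite mulf_neq0.
move=> /(congr1 absz); rewrite abszM => e; have : (n %| 1)%N.
  by move: e; case: b1 => -> /= ->; rewrite dvdn_mull.
by rewrite dvdn1; case: eqP n1 => // ->.
Qed.

(** [p] divides [(v + i)(v - i)] but neither factor, so a Gaussian prime divisor of [p] has norm
    [p]. If it divided its conjugate, it would divide twice each coordinate, so [p] would divide
    both coordinates and [p ^ 2] would divide the norm. *)
Lemma split_prime p : prime p -> (p %% 4 = 1)%N ->
  exists pi, [/\ gprime i pi, gprime i (tau pi), pi * tau pi = p%:R & ~ gdvd i pi (tau pi)].
Proof.
move=> pp p4; have [u [v e]] := neg_pell pp p4; have p1 := prime_gt1 pp.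
have pO : OO G (p%:R : L) by split; [mem|isi].
have p0 : p%:R != 0 :> L by rewrite natL_eq0; case: (p) pp.
have pu : ~ iunit (p%:R : L).
  by move=> /(gN_unit ii ti pO); rewrite gN_nat => h; move: h p1; clear; nia.
have iO := OOi ii.
have vO : OO G (v%:R + i) by apply: OOD => //; split; [mem|isi].
have vO' : OO G (v%:R - i) by apply: OOD; [split; [mem|isi]|exact: OON].
have [pi ppi pid] := exists_gprime ii ti pO p0 pu; have [piO pi0 piu pir] := ppi.
have gpi : gN tau pi = p.
  have := gdvd_gN piO pid; rewrite gN_nat => /(dvdn_pfactor _ 2 pp)[[|[|[|n]]] // _ ge].
  - by case: piu; apply/(gN_unit ii ti piO).
  - exfalso; have [c cO ce] := pid.
    have cu : iunit c.
      apply/(gN_unit ii ti cO); have := congr1 (gN tau) ce; rewrite (gNM ii ti) // gN_nat ge.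
      by move=> h; apply/eqP; rewrite -(@eqn_pmul2r (p ^ 2)) ?expn_gt0 ?mul1n ?(ltnW p1) // -h.
    have nd (b : int) : (b = 1 \/ b = -1) -> ~ gdvd i pi (v%:R + b%:~R * i).
      move=> b1 [f fO fe]; apply: (@gdvd_nat_imag p v b) => //.
      have [c0 ci cV] := cu; have [cG _] := cO; have [fG fi] := fO.
      exists (f / c); first by split; [mem|isi].
      by rewrite fe ce; field.
    have : gdvd i pi ((v%:R + i) * (v%:R - i)).
      have -> : (v%:R + i) * (v%:R - i) = p%:R * u%:R ^+ 2.
        have eL : p%:R * u%:R ^+ 2 = v%:R ^+ 2 + 1 :> L by rewrite -natrX -natrM e natrD natrX.
        by rewrite eL; apply: (lin_comb (c := -1) ii); ring.
      have [f fO ->] := pid; exists (f * u%:R ^+ 2); last by ring.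
      by apply: OOM => //; apply: OOX; split; [mem|isi].
    case/(pir _ _ vO vO'); first by have := @nd 1 (or_introl erefl); rewrite mul1r.
    by have := @nd (-1) (or_intror erefl); rewrite rmorphN mulN1r.
have piE : pi * tau pi = p%:R by rewrite (gNE ii ti piO) gpi.
have [a [b pab]] := (OOGiP ii ti pi).1 piO.
exists pi; split=> //.
  apply: (gprime_norm ii ti (tauO ii ti piO) _ pp).
  by apply: gN_tau; [exact: tauO|rewrite (tautau ii ti) 1?mulrC //; case: piO].
have tpi : tau pi = a%:~R - b%:~R * i by rewrite pab !(rmorphD, rmorphM, rmorph_int) /= ti; ring.
move=> [c [cG ci] ce].
have half (n : int) z : (z = 1 \/ z = i) -> gdvd i pi (2%:R * n%:~R * z) -> (p %| `|n|)%N.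
  move=> zz h; have zO : OO G z by case: zz => ->; [exact: OO1|].
  have nO : OO G (2%:R * n%:~R : L) by split; [mem|isi].
  have := gdvd_gN piO h; rewrite gpi (gNM ii ti) //.
  have -> : gN tau z = 1%N by apply/(gN_unit ii ti zO); case: zz => ->; [exact: iunit1|exact: iunit_i].
  have -> : 2%:R * n%:~R = (2 * n)%:~R + 0%:~R * i :> L by rewrite rmorphM /= mul0r addr0.
  rewrite (gN_int ii ti) expr0n addr0 abszX muln1 Euclid_dvdX // abszM Euclid_dvdM // andbT.
  case/orP => //; move=> /(dvdn_leq (ltn0Sn 1)); by move: p4 p1; clear; case: p => [|[|[|p]]].
have pa : (p %| `|a|)%N.
  apply: (half a 1 (or_introl erefl)); exists (1 + c); first by split; [mem|isi].
  by apply: (lin_comb (c := 1) ce); rewrite tpi pab; ring.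
have pb : (p %| `|b|)%N.
  apply: (half b i (or_intror erefl)); exists (1 - c); first by split; [mem|isi].
  by apply: (lin_comb (c := -1) ce); rewrite tpi pab; ring.
have := gpi; rewrite pab (gN_int ii ti).
have -> : `|(a ^+ 2 + b ^+ 2)%R|%N = (`|a| ^ 2 + `|b| ^ 2)%N by clear; nia.
case/dvdnP: pa => a' ->; case/dvdnP: pb => b' -> h.
have : (p * p * (a' ^ 2 + b' ^ 2) = p * 1)%N by rewrite muln1 -[RHS]h; ring.
rewrite -mulnA => /eqP; rewrite eqn_pmul2l ?(ltnW p1) // => /eqP h2.
by have : (p %| 1)%N by [rewrite -h2 dvdn_mulr]; rewrite dvdn1; case: eqP p1 => // ->.
Qed.

Lemma split_prime_nat pi (p n : nat) : OO G pi -> pi * tau pi = p%:R -> prime p -> ~~ (p %| n)%N -> ~ gdvd i pi n%:R.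
Proof.
move=> piO piE pp pn /(gdvd_gN piO); rewrite (gN_tau piO piE) gN_nat Euclid_dvdX // andbT.
exact/negP.
Qed.

Lemma inert_prime_nat (q n : nat) : prime q -> ~~ (q %| n)%N -> ~ gdvd i (q%:R : L) n%:R.
Proof.
move=> pq qn; have qO : OO G (q%:R : L) by split; [mem|isi].
move=> /(gdvd_gN qO); by rewrite !gN_nat dvdn_pexp2r // (negbTE qn).
Qed.

Lemma gdvd_split pi z (p n : nat) : gprime i pi -> pi * tau pi = p%:R -> OO G z -> z * tau z = (p * n)%:R ->
  exists mu z', [/\ mu = pi \/ mu = tau pi, OO G z', z = mu * z', mu * tau mu = p%:R & z' * tau z' = n%:R].
Proof.
move=> ppi piE zO zE; have [piO pi0 piu pir] := ppi; have [piG pii] := piO.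
have tzO := tauO ii ti zO.
have p0 : p%:R != 0 :> L by rewrite -piE mulf_neq0 // fmorph_eq0.
have [mu [mupi [z' zO' ze]]] : exists mu, (mu = pi \/ mu = tau pi) /\ gdvd i mu z.
  have : gdvd i pi (z * tau z).
    exists (tau pi * n%:R); first by apply: OOM; [exact: tauO|split; [mem|isi]].
    by rewrite zE natrM -piE; ring.
  case/(pir _ _ zO tzO) => [h|[c cO ce]]; first by exists pi; split; [left|].
  exists (tau pi); split; [by right|exists (tau c); first exact: tauO].
  by rewrite -rmorphM /= -ce (tautau ii ti) //; case: zO.
have muE : mu * tau mu = p%:R by case: mupi => -> //; rewrite (tautau ii ti) // mulrC.
exists mu, z'; split=> //; first by rewrite mulrC.
apply: (mulfI p0); rewrite -natrM -zE ze rmorphM /= -muE; ring.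
Qed.

(* For v^2 + 1 = m u^2 one has (v + i + u x)^2 = 2 (v + i) (v + u x), where
   v + u x is a unit and 2 = - i (1 + i)^2. *)
Lemma neg_pell_sqclass E x mu z (m u v : nat) : i \in E -> x \in E -> x ^+ 2 = m%:R ->
  (m * u ^ 2 = v ^ 2 + 1)%N -> OO G mu -> OO G z -> v%:R + i = mu * z ->
  z * tau z = (u ^ 2)%:R -> (0 < u)%N -> sqclass E mu.
Proof.
move=> iE xE xx e muO zO vE zE u0; have iO := OOi ii; have [zG zi] := zO; have [muG mui] := muO.
have eL : m%:R * u%:R ^+ 2 = v%:R ^+ 2 + 1 :> L by rewrite -natrX -natrM e natrD natrX.
(* Modulo 4, [v ^ 2 + 1] is never 0. *)
have ou : odd u.
  apply: contraT => ou; have := congr1 (fun n => n %% 4)%N e.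
  rewrite -(even_halfK ou) -mul2n expnMn mulnCA -modnMml modnn mul0n mod0n.
  have [h [v2|v2]] := int_parity v%:Z; have : exists w : nat, (v = 2 * w \/ v = 2 * w + 1)%N by exists (v %/ 2)%N; clear; lia.
    by case=> w [] ->; clear; nia.
  by case=> w [] ->; clear; nia.
have tzO := tauO ii ti zO.
have [h hE] : exists h : nat, (u ^ 2 = 2 * h + 1)%N.
  by exists (u ^ 2)./2; rewrite -{1}(odd_double_half (u ^ 2)) oddX ou orbT mul2n addnC.
have tvE : v%:R - i = tau mu * tau z by rewrite -rmorphM /= -vE rmorphD rmorph_nat /= ti.
have hO : OO G (h%:R : L) by split; [mem|isi].
have uO : OO G (u%:R : L) by split; [mem|isi].
have z0 : z != 0.
  by apply/eqP => z0; move: zE; rewrite z0 mul0r => /esym/eqP; rewrite natL_eq0 expn_eq0; move: u0; clear; case: u.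
have [w wu [c cG cE]] : exists2 w, iunit w & exists2 c, c \in G & z = w * c ^+ 2.
  (* The Bezout coefficients come from [mu * z - tau mu * tau z = 2 i] and [z * tau z = 2 h + 1]:
     [i h] times the first plus the second is 1. *)
  apply: (coprime_sqr_Gi ii ti zO tzO uO (a := tau z + i * h%:R * mu) (b := - (i * h%:R * tau mu))) => //.
  - by apply: OOD => //; apply: OOM => //; apply: OOM.
  - by apply/OON/OOM; [apply: OOM|exact: tauO].
  - by rewrite zE natrX.
  have e1 : mu * z - tau mu * tau z = 2%:R * i by rewrite -vE -tvE; ring.
  have e2 : z * tau z = 2%:R * h%:R + 1 by rewrite zE hE natrD natrM.
  apply: (lin_comb (c := 1) e2); rewrite -[RHS]addr0; apply: (lin_comb (c := i * h%:R) e1).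
  by rewrite -[RHS]addr0; apply: (lin_comb (c := 2%:R * h%:R) ii); ring.
pose la := 1 + i; pose Y := v%:R + i + u%:R * x; pose ep := v%:R + u%:R * x.
have [w0 wi wV] := wu; have i0 := i_neq0 ii.
have c0 : c != 0 by apply: contra_neq z0 => c0; rewrite cE c0 expr0n mulr0.
have xi : isint x by apply: isint_sqr; rewrite xx; isi.
have epu : iunit ep.
  apply: (@iunit_mul1 _ _ (u%:R * x - v%:R)); [by rewrite /ep; isi|isi|].
  rewrite /ep; apply: (lin_comb (c := 1) eL); rewrite -[RHS]addr0.
  by apply: (lin_comb (c := u%:R ^+ 2) xx); ring.
have [ep0 epi epV] := epu.
have la2 : la ^+ 2 = 2%:R * i by rewrite /la; apply: (lin_comb (c := 1) ii); ring.
have la0 : la != 0 by rewrite -sqrf_eq0 la2 mulf_neq0 ?two_neq0.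
have YY : Y ^+ 2 = 2%:R * (v%:R + i) * ep.
  rewrite /Y /ep; apply: (lin_comb (c := 1) eL); rewrite -[RHS]addr0.
  apply: (lin_comb (c := u%:R ^+ 2) xx); rewrite -[RHS]addr0.
  by apply: (lin_comb (c := 1) ii); ring.
have mu0 : mu != 0.
  apply/eqP => mu0; move: vE tvE; rewrite mu0 rmorph0 !mul0r => e1 e2.
  have : 2%:R * i == 0 by have -> : 2%:R * i = (v%:R + i) - (v%:R - i) by [ring]; rewrite e1 e2 subrr.
  by rewrite mulf_eq0 (negbTE (two_neq0 L)) (negbTE i0).
have GE : (G <= E)%VS by apply: adj_sub => //; exact: sub1v.
have cE' := subvP GE _ cG.
have Y0 : Y != 0.
  by rewrite -sqrf_eq0 YY vE cE !mulf_neq0 ?two_neq0 // expf_neq0.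
exists (Y / (c * la)), (i / (w * ep)); split.
- by rewrite /Y /la; mem.
- by rewrite mulf_neq0 ?invr_eq0 ?mulf_neq0.
- by apply: iunitM; [exact: iunit_i|apply/iunitV/iunitM].
have -> : (Y / (c * la)) ^+ 2 = Y ^+ 2 / (c ^+ 2 * la ^+ 2) by field; rewrite ?c0 ?la0.
by rewrite YY la2 vE cE; field; rewrite ?w0 ?ep0 ?c0 ?i0 ?two_neq0.
Qed.

Lemma split_exact pi (p m : nat) : gprime i pi -> pi * tau pi = p%:R -> ~ gdvd i pi (tau pi) -> prime p -> ~~ (p %| m)%N ->
  [/\ OO G (tau pi * m%:R), (p * m)%:R = pi * (tau pi * m%:R) & ~ gdvd i pi (tau pi * m%:R)].
Proof.
move=> ppi piE pit pp pm; have [piO _ _ pr] := ppi.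
have mO : OO G (m%:R : L) by split; [mem|isi].
have tO := tauO ii ti piO.
split; [exact: OOM|by rewrite natrM -piE mulrA|].
by case/(pr _ _ tO mO) => //; exact: (split_prime_nat piO piE pp pm).
Qed.

Lemma gprime_unit_sqr r b n T w : gprime i r -> OO G b -> n = r * b -> ~ gdvd i r b ->
  T \in G -> iunit w -> n = w * T ^+ 2 -> False.
Proof.
move=> pr bO nE rb TG wu e; have [w0 wi wV] := wu; have [rO r0 _ _] := pr; have [rG _] := rO; have [bG bi] := bO.
have n0 : n != 0.
  rewrite nE mulf_neq0 //; apply/eqP => b0; apply: rb; exists 0; first exact: OO0.
  by rewrite b0 mul0r.
have T0 : T != 0 by apply: contra_neq n0 => T0; rewrite e T0 expr0n mulr0.
have wG : w \in G by have -> : w = n / T ^+ 2 by [rewrite e; field]; rewrite nE; mem.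
have wbO : OO G (w^-1 * b) by split; [mem|isi].
apply: (gprime_sqr_false (t := T) pr wbO) => //.
  move=> [c cO ce]; apply: rb; exists (w * c); last by rewrite -mulrA -ce mulVKf.
  by apply: OOM.
by have -> : r * (w^-1 * b) = w^-1 * n by [rewrite nE; ring]; rewrite e mulKf.
Qed.

Lemma nat_not_unit_sqr (p m : nat) T w : prime p -> odd p -> ~~ (p %| m)%N ->
  T \in G -> iunit w -> (p * m)%:R = w * T ^+ 2 -> False.
Proof.
move=> pp op pm TG wu e; have [p4|p4] : (p %% 4 = 1 \/ p %% 4 = 3)%N by move: op; clear; lia.
  have [pi [ppi _ piE pit]] := split_prime pp p4.
  have [bO bE bn] := split_exact ppi piE pit pp pm.
  exact: (gprime_unit_sqr ppi bO bE bn TG wu).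
apply: (gprime_unit_sqr (gprime_inert ii ti pp p4) _ (natrM _ p m) _ TG wu) => //; first by split; [mem|isi].
exact: inert_prime_nat.
Qed.

End GaussianPrimes.

(** * Independent sign changes of the radicals *)

Section Signs.
Variables (L : splittingFieldType rat) (x s i : L) (m m' d d' p q : nat).
Hypotheses (ii : i ^+ 2 = -1) (xx : x ^+ 2 = m%:R) (ss : s ^+ 2 = d%:R).
Hypotheses (pp : prime p) (mE : m = (p * m')%N) (pm' : ~~ (p %| m')%N).
Hypotheses (pq : prime q) (dE : d = (q * d')%N) (qd' : ~~ (q %| d')%N) (qm : ~~ (q %| m)%N).

Lemma i_notQ : i \notin QQ L.
Proof.
apply/negP => iQ; have [c] := @rat_sqr_int L i (-1) iQ (etrans ii (esym (rmorphN1 _))).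
by clear; nia.
Qed.

(** [p] divides [m] once, and [q] divides [d] once but not [m], so the radicals [x], [s], [i] are
    independent modulo rational squares. *)
Lemma three_signs : exists sigma rho tau : 'AEnd(L),
  [/\ [/\ sigma x = - x, sigma s = s & sigma i = i],
      [/\ rho x = x, rho s = - s & rho i = i]
    & [/\ tau x = x, tau s = s & tau i = - i]].
Proof.
have xQ : x ^+ 2 \in QQ L by rewrite xx; mem.
have sQ : s ^+ 2 \in QQ L by rewrite ss; mem.
have iQ : i ^+ 2 \in QQ L by rewrite ii; mem.
have qd'm : ~~ (q %| d' * m)%N by rewrite Euclid_dvdM // negb_or qd'.
have x1 : x \notin QQ L.
  by apply: (@sqrt_notQ L x p m'%:Z) => //; rewrite xx mE -PoszM.
have x2 : x * i \notin QQ L.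
  apply: (@sqrt_notQ L _ p (- m'%:Z)) => //; first by rewrite dvdzE abszN.
  by rewrite exprMn ii xx mE natrM rmorphM rmorphN /= -!pmulrn; ring.
have s1 : s \notin QQ L.
  by apply: (@sqrt_notQ L s q d'%:Z) => //; rewrite ss dE -PoszM.
have s2 : s * i \notin QQ L.
  apply: (@sqrt_notQ L _ q (- d'%:Z)) => //; first by rewrite dvdzE abszN.
  by rewrite exprMn ii ss dE natrM rmorphM rmorphN /= -!pmulrn; ring.
have s3 : s * x \notin QQ L.
  apply: (@sqrt_notQ L _ q (d' * m)%N%:Z) => //.
  by rewrite exprMn xx ss dE -PoszM -natrM mulnA.
have s4 : s * x * i \notin QQ L.
  apply: (@sqrt_notQ L _ q (- (d' * m)%N%:Z)) => //; first by rewrite dvdzE abszN.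
  by rewrite !exprMn ii xx ss dE natrM rmorphM rmorphN /= -!pmulrn natrM; ring.
have s5 : x * s * i \notin QQ L by rewrite [x * s]mulrC.
have s6 : i * s * x \notin QQ L by have -> : i * s * x = s * x * i by ring.
have [sigma sg] := @sign_auts L x i s xQ iQ sQ (And4 x1 x2 (etrans (congr1 (fun z => z \notin QQ L) (mulrC x s)) s3) s5).
have [rho rh] := @sign_auts L s i x sQ iQ xQ (And4 s1 s2 s3 s4).
have [tau ta] : exists tau : 'AEnd(L), [/\ tau i = - i, tau x = x & tau s = s].
  apply: sign_auts => //; split=> //; [exact: i_notQ|by rewrite mulrC|by rewrite mulrC].
by exists sigma, rho, tau; case: sg => ? ? ?; case: rh => ? ? ?; case: ta.
Qed.

End Signs.

(** * Comparison with the units of Q(sqrt d) *)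

Section NotBoth.
Variables (L : splittingFieldType rat) (s i : L) (d : nat) (rho tau : 'AEnd(L)).
Implicit Types (x y z u w t : L).
Hypotheses (ii : i ^+ 2 = -1) (ss : s ^+ 2 = d%:R) (d4 : (d %% 4 = 3)%N).
Hypotheses (rs : rho s = - s) (ri : rho i = i) (ts : tau s = s) (ti : tau i = - i).
Local Notation k := (kk s i).
Local Notation G := (Gi i).
Variables (p d1 q d2 : nat).
Hypotheses (pp : prime p) (p4 : (4 < p)%N) (pd : d = (p * d1)%N) (pd1 : ~~ (p %| d1)%N).
Hypotheses (pq : prime q) (q4 : (q %% 4 = 3)%N) (qd : d = (q * d2)%N).
Hypothesis sqfree : forall n : nat, (d %| n ^ 2)%N -> (d %| n)%N.

(** Squarefreeness of [d] makes [2 a] and [2 b] integers [t], [u]; then [t ^+ 2 - d * u ^+ 2 = 4 e]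
    with [d] congruent to 3 modulo 4 forces both to be even. *)
Lemma int_of_quad g (e : int) : g \in <<QQ L; s>>%VS -> isint g -> g * rho g = e%:~R -> e = 1 \/ e = -1 ->
  exists x y : int, g = x%:~R + y%:~R * s /\ x ^+ 2 - d%:Z * y ^+ 2 = e.
Proof.
have sQ : s ^+ 2 \in QQ L by rewrite ss; mem.
move=> gs gi gN e1; have [a [b [aQ bQ gE]]] := quad_coord sQ gs.
have rg : rho g = a - b * s by rewrite gE rmorphD rmorphM /= rs !fixQ // mulrN.
have s_i : isint s by apply: isint_sqr; rewrite ss; isi.
have s0 := s_neq0 ss d4; have dn0 := d_neq0 L d4; have t0 := two_neq0 L.
have [t tE] : exists t : int, 2%:R * a = t%:~R.
  apply: isint_rat; first by mem.
  have -> : 2%:R * a = g + rho g by rewrite rg gE; ring.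
  by isi.
have [m mE] : exists m : int, 2%:R * b * d%:R = m%:~R.
  apply: isint_rat; first by mem.
  have -> : 2%:R * b * d%:R = (g - rho g) * s by rewrite rg gE -ss; ring.
  by isi.
have nE : a ^+ 2 - d%:R * b ^+ 2 = e%:~R by rewrite -gN rg gE -ss; ring.
have mm : m ^+ 2 = d%:Z * (t ^+ 2 - 4 * e).
  apply: (@intL_inj L); rewrite !(rmorphM, rmorphB, rmorphXn) /= -mE -tE -nE; ring.
have dm : (d %| `|m|)%N.
  by apply: sqfree; rewrite -abszX mm abszM dvdn_mulr.
have [u uE] : exists u : int, m = u * d%:Z by apply/dvdzP; rewrite dvdzE.
have bE : 2%:R * b = u%:~R by apply: (mulIf dn0); rewrite mE uE rmorphM.
have tu : t ^+ 2 - d%:Z * u ^+ 2 = 4 * e.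
  apply: (@intL_inj L); rewrite !(rmorphM, rmorphB, rmorphXn) /= -bE -tE -nE; ring.
have [x [y [tx uy]]] : exists x y : int, t = 2 * x /\ u = 2 * y.
  have [x tx] := int_parity t; have [y uy] := int_parity u; exists x, y.
  have [d0 dd] : exists d0 : int, d%:Z = 4 * d0 + 3 by exists (d %/ 4)%N%:Z; move: d4; clear; lia.
  move: tu; rewrite dd; clear -tx uy.
  case: tx => ->; case: uy => -> // h; exfalso; move: h; first [
    have -> : (2 * x) ^+ 2 - (4 * d0 + 3) * (2 * y + 1) ^+ 2 = 4 * (x ^+ 2 - d0 * (2 * y + 1) ^+ 2 - 3 * y ^+ 2 - 3 * y) - 3 by [ring]
  | have -> : (2 * x + 1) ^+ 2 - (4 * d0 + 3) * (2 * y) ^+ 2 = 4 * (x ^+ 2 + x - (4 * d0 + 3) * y ^+ 2) + 1 by [ring]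
  | have -> : (2 * x + 1) ^+ 2 - (4 * d0 + 3) * (2 * y + 1) ^+ 2 = 4 * (x ^+ 2 + x - d0 * (2 * y + 1) ^+ 2 - 3 * y ^+ 2 - 3 * y) - 2 by [ring]];
    set X := (X in 4 * X); move: X; clear; lia.
exists x, y; split.
  rewrite gE; congr (_ + _ * _); apply: (mulfI t0); [rewrite tE tx|rewrite bE uy]; by rewrite rmorphM.
by move: tu; rewrite tx uy; clear; nia.
Qed.

(** The inert prime [q] would divide [(x + i)(x - i)], but it divides neither factor. *)
Lemma no_neg_pell (x y : int) : x ^+ 2 - d%:Z * y ^+ 2 = -1 -> False.
Proof.
move=> e; have [_ _ _ pr] := gprime_inert ii ti pq q4; have iO := OOi ii.
have xO b : ring_of_integers G (x%:~R + b%:~R * i : L).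
  by have [iG i_i] := iO; split; [mem|isi].
have : gdvd i (q%:R : L) ((x%:~R + 1%:~R * i) * (x%:~R + (-1)%:~R * i)).
  exists ((d2%:Z * y ^+ 2)%:~R); first by split; [mem|isi].
  have -> : (x%:~R + 1%:~R * i) * (x%:~R + (-1)%:~R * i) = (x ^+ 2 + 1)%:~R.
    by rewrite !(rmorphN, rmorphD, rmorphXn, rmorph1) /=; apply: (lin_comb (c := -1) ii); ring.
  have -> : x ^+ 2 + 1 = d%:Z * y ^+ 2 by move: e; clear; lia.
  by rewrite qd PoszM !rmorphM /=; ring.
by case/(pr _ _ (xO _) (xO _)); apply: (gdvd_nat_imag ii ti (prime_gt1 pq)); [left|right].
Qed.

(* The quotient of y by its conjugate is a unit of norm 1 which a priori lies
   in k; the imaginary subfield Q(i s) having only the units 1 and -1 forces it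
   into Q(s) or i Q(s), and the norm -1 is excluded in Q(s). *)
Lemma rational_sqclass_psol (n : nat) y w : y \in k -> y != 0 -> iunit w -> n%:R = w * y ^+ 2 ->
  psol s d (rho y / y).
Proof.
move=> yk y0 wu nE; have [w0 wi wV] := wu.
pose e := rho y / y.
have ry0 : rho y != 0 by rewrite fmorph_eq0.
have ryk := rhok ii ss rs ri yk.
have ek : e \in k by rewrite /e; mem.
have e0 : e != 0 by rewrite mulf_neq0 ?invr_eq0.
have re : rho e = e^-1 by rewrite /e fmorph_div /= (rhorho ii ss rs ri) // invf_div.
have eu : iunit e.
  apply: iunit_sqr.
  have h := congr1 rho nE; rewrite rmorph_nat rmorphM rmorphXn /= nE in h.
  have -> : e ^+ 2 = w / rho w.
    have rw0 : rho w != 0 by rewrite fmorph_eq0.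
    apply: (mulIf rw0); rewrite divfK //; apply: (mulIf (expf_neq0 2 y0)); rewrite h /e.
    by field.
  by apply: iunitM => //; apply/iunitV/iunit_aut.
have iQ : i ^+ 2 \in QQ L by rewrite ii; mem.
have sQ : s ^+ 2 \in QQ L by rewrite ss; mem.
have te : tau e = e \/ tau e = - e.
  have f1 : e * tau (rho e) = 1 \/ e * tau (rho e) = -1.
    apply: (iunit_imag pp p4 pd pd1 (y := i * s)); first by rewrite exprMn ii ss mulN1r.
      exact: imag_norm.
    by apply: iunitM => //; do 2 apply: iunit_aut.
  have te0 : tau e != 0 by rewrite fmorph_eq0.
  have eE : e = e / tau e * tau e by rewrite divfK.
  by rewrite re fmorphV /= in f1; case: f1 => f1; [left|right]; rewrite [in RHS]eE f1; ring.
have sub z : z \in k -> z \in <<<<QQ L; s>>; i>>%VS.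
  apply: (subvP _ _); apply: adjQ2_sub; first exact: memv_adjoin.
  exact/mem_adj/memv_adjoin.
have inQs z : z \in k -> tau z = z -> z \in <<QQ L; s>>%VS.
  move=> zk tz; apply: (quad_fixed (E := <<QQ L; s>>%AS) (g := tau) (y := i)) => //.
  - exact: mem_adj.
  - exact: fixQ1.
  - exact: sub.
have eR : e * rho e = 1 by rewrite re mulfV.
have [_ ei _] := eu; have ikk := ik s i.
case: te => te.
  have [||x [x' [xE xN]]] := @int_of_quad e 1 (inQs _ ek te) ei; [by rewrite eR|by left|].
  by exists x, x'.
have [||||x [x' [xE xN]]] := @int_of_quad (i * e) (-1).
- by apply: inQs; [mem|rewrite rmorphM /= te ti mulrNN].
- by have := isint_i ii => ?; isi.
- by rewrite rmorphM /= ri mulrACA -expr2 ii eR mulr1 rmorphN.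
- by right.
by case: (no_neg_pell xN).
Qed.

Lemma psol_rho t : psol s d t -> t \in k /\ t * rho t = 1.
Proof.
have d0 : (0 < d)%N by move: d4; clear; case: d.
have skk := sk s i; move=> [x [y [-> h]]]; split; first by mem.
by rewrite rmorphD rmorphM !rmorph_int /= rs mulrN; apply: (psol_conj ss h).
Qed.

(** By Hilbert 90, [t = rho z / z], so [y' = y / z ^+ 2] satisfies [rho y' = y'] or [rho y' = - y'],
    and [y'] or [y' / s] lies in Q(i). Replacing [z ^+ 2] by the norm of [z], which differs from it
    by the unit [t], makes [n] or [n d] a unit times a square of Q(i). *)
Lemma psol_sqr_rational (n : nat) y w t : y \in k -> y != 0 -> iunit w -> n%:R = w * y ^+ 2 ->
  psol s d t -> rho y / y = t ^+ 2 \/ rho y / y = - t ^+ 2 ->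
  exists T w', [/\ T \in G, iunit w' & n%:R = w' * T ^+ 2 \/ (n * d)%:R = w' * T ^+ 2].
Proof.
move=> yk y0 wu nE /psol_rho[tk tN] ye; have [w0 wi wV] := wu.
have [z [zk z0 rz]] := hilbert90 ii ss d4 rs ri tk tN.
have rzk := rhok ii ss rs ri zk; have ryk := rhok ii ss rs ri yk.
have t0 : t != 0 by apply/eqP => t0; move: tN; rewrite t0 mul0r => /esym/eqP; rewrite oner_eq0.
pose y' := y / z ^+ 2; pose N := z * rho z.
have y'k : y' \in k by rewrite /y'; mem.
have NG : N \in G by exact: (quad_norm (qrho ii ss rs ri)).
have y'0 : y' != 0 by rewrite mulf_neq0 ?invr_eq0 ?expf_neq0.
have rz0 : rho z != 0 by rewrite fmorph_eq0.
have N0 : N != 0 by rewrite mulf_neq0.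
have ry' : rho y' = y' \/ rho y' = - y'.
  have h : rho y' = (rho y / y) * y' / t ^+ 2.
    by rewrite /y' fmorph_div rmorphXn /= rz; field; rewrite ?z0 ?t0 ?y0.
  case: ye => ye; [left|right]; rewrite h ye; field; exact: t0.
have nN : n%:R ^+ 2 = w * rho w * (y' * rho y') ^+ 2 * N ^+ 4.
  have h := congr1 rho nE; rewrite rmorph_nat rmorphM rmorphXn /= in h.
  rewrite expr2 {1}nE h /y' /N fmorph_div rmorphXn /=; field; by rewrite ?z0 ?rz0.
have wwu : iunit (w * rho w) by apply: iunitM => //; exact: iunit_aut.
have s0 := s_neq0 ss d4; have skk := sk s i; have dn0 := d_neq0 L d4.
case: ry' => ry'.
  have yG := rhofix ii ss rs ri y'k ry'.
  exists (y' * N), (n%:R / (y' * N) ^+ 2); split.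
  - by mem.
  - apply: iunit_sqr; rewrite exprMn nN ry'.
    by have -> : w * rho w * (y' * y') ^+ 2 * N ^+ 4 * ((y' * N) ^+ 2)^-1 ^+ 2 = w * rho w by field; rewrite ?y'0 ?N0.
  - by left; rewrite divfK // expf_neq0 // mulf_neq0.
pose y2 := y' / s.
have y2k : y2 \in k by rewrite /y2; mem.
have y2G : y2 \in G.
  by apply: (rhofix ii ss rs ri y2k); rewrite /y2 fmorph_div /= rs ry' invrN mulrNN.
have y20 : y2 != 0 by rewrite mulf_neq0 ?invr_eq0.
have y'E : y' = y2 * s by rewrite /y2 divfK.
exists (d%:R * y2 * N), ((n * d)%:R / (d%:R * y2 * N) ^+ 2); split.
- by mem.
- apply: iunit_sqr; rewrite exprMn natrM exprMn nN ry' y'E.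
  have -> : y2 * s * - (y2 * s) = - (y2 ^+ 2 * d%:R) by rewrite -ss; ring.
  have -> : w * rho w * (- (y2 ^+ 2 * d%:R)) ^+ 2 * N ^+ 4 * d%:R ^+ 2 * ((d%:R * y2 * N) ^+ 2)^-1 ^+ 2 = w * rho w.
    by field; rewrite ?y20 ?N0 ?dn0.
  exact: wwu.
- by right; rewrite [RHS]divfK // expf_neq0 // (mulf_neq0 (mulf_neq0 dn0 y20) N0).
Qed.

(** The Pell solutions attached to [p], [q] and [p q] cannot all be nonsquares up to sign. A square
    makes the number itself or its product with [d] a unit times a square in Q(i); up to rational
    squares these products are [q p'], [p p'] and [p'], and in every case some prime occurs exactly
    once. *)
Lemma not_both_sqclass (p' : nat) : d = (p * p' * q)%N -> prime p' -> odd p' -> odd p ->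
  p != p' -> p != q -> p' != q -> sqclass k p%:R -> sqclass k q%:R -> False.
Proof.
move=> dE pp' op' op pp'' ppq p'q [y1 [w1 [y1k y10 w1u e1]]] [y2 [w2 [y2k y20 w2u e2]]].
have oq : odd q by move: q4; clear; lia.
have ps1 := rational_sqclass_psol y1k y10 w1u e1; have ps2 := rational_sqclass_psol y2k y20 w2u e2.
have d0 : (0 < d)%N by move: d4; clear; case: d.
have e12 : (p * q)%:R = (w1 * w2) * (y1 * y2) ^+ 2 by rewrite natrM e1 e2; ring.
have r12 : rho (y1 * y2) / (y1 * y2) = (rho y1 / y1) * (rho y2 / y2) by rewrite rmorphM /=; field; rewrite ?y10 ?y20.
have main n y w (r m : nat) : y \in k -> y != 0 -> iunit w -> n%:R = w * y ^+ 2 ->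
    n = (r * m)%N -> prime r -> odd r -> ~~ (r %| m)%N ->
    forall t, psol s d t ->
    rho y / y = t ^+ 2 \/ rho y / y = - t ^+ 2 ->
    exists T w', [/\ T \in G, iunit w' & (n * d)%:R = w' * T ^+ 2].
  move=> yk y0 wu nE nr pr or rm t pt yt.
  have [T [w' [TG wu' [h|h]]]] := psol_sqr_rational yk y0 wu nE pt yt; last by exists T, w'.
  by exfalso; apply: (nat_not_unit_sqr ii ti pr or rm TG wu'); rewrite -h nr.
have fin r m c T w : prime r -> odd r -> ~~ (r %| m)%N -> (0 < c)%N -> T \in G -> iunit w ->
    (r * m * c ^ 2)%:R = w * T ^+ 2 -> False.
  move=> pr or rm c0 TG wu h; have cn0 : c%:R != 0 :> L by rewrite natL_eq0 -lt0n.
  apply: (nat_not_unit_sqr ii ti pr or rm (T := T / c%:R) _ wu); first by mem.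
  by rewrite exprMn exprVn mulrA -h (natrM _ (r * m)) natrX mulfK // expf_neq0.
have ndp1 a : prime a -> ~~ (a %| 1)%N by rewrite dvdn1; case: eqP => // ->.
have ndp a b : prime a -> prime b -> a != b -> ~~ (a %| b)%N by move=> pa pb; rewrite dvdn_prime2.
have [e [] -> [t pt et]] := pell_mod_squares d0 ss ps1 ps2.
- have [T [w' [TG wu' h]]] := main _ _ _ p 1%N y1k y10 w1u e1 (esym (muln1 p)) pp op (ndp1 p pp) t pt et.
  apply: (fin q p' p T w') => //; [by apply: ndp; rewrite // eq_sym|exact: prime_gt0|].
  by rewrite -h dE; congr (_%:R); ring.
- have [T [w' [TG wu' h]]] := main _ _ _ q 1%N y2k y20 w2u e2 (esym (muln1 q)) pq oq (ndp1 q pq) t pt et.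
  apply: (fin p p' q T w') => //; [exact: ndp|exact: prime_gt0|].
  by rewrite -h dE; congr (_%:R); ring.
- rewrite -r12 in et.
  have y12k : y1 * y2 \in k by mem.
  have y120 : y1 * y2 != 0 by rewrite mulf_neq0.
  have [T [w' [TG wu' h]]] := main _ _ _ p q y12k y120 (iunitM w1u w2u) e12 erefl pp op (ndp p q pp pq ppq) t pt et.
  apply: (fin p' 1%N (p * q)%N T w') => //.
  - exact: ndp1.
  - by rewrite muln_gt0 !prime_gt0.
  by rewrite -h dE; congr (_%:R); ring.
Qed.

End NotBoth.

(** * The radicand of K *)

Section Radicand.
Variables (L : splittingFieldType rat) (s i : L) (rho tau : 'AEnd(L)) (p1 p2 q : nat).
Implicit Types (x y z u w t r : L) (K E : {subfield L}).
Local Notation OO := ring_of_integers.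
Local Notation d := (p1 * p2 * q)%N.
Hypotheses (pr1 : prime p1) (pr2 : prime p2) (prq : prime q).
Hypotheses (p1_4 : (p1 %% 4 = 1)%N) (p2_4 : (p2 %% 4 = 1)%N) (q_4 : (q %% 4 = 3)%N).
Hypotheses (p12 : p1 != p2).
Hypotheses (ii : i ^+ 2 = -1) (ss : s ^+ 2 = d%:R).
Hypotheses (rs : rho s = - s) (ri : rho i = i) (ts : tau s = s) (ti : tau i = - i).
Local Notation k := (kk s i).
Local Notation G := (Gi i).
Local Notation V := 'rV['F_2]_5.

Lemma mod4_neq (a b : nat) : (a %% 4 = 1)%N -> (b %% 4 = 3)%N -> a != b.
Proof. by move=> a4 b4; apply/eqP => ab; rewrite ab b4 in a4. Qed.

Let p1q : p1 != q. Proof. exact: mod4_neq. Qed.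
Let p2q : p2 != q. Proof. exact: mod4_neq. Qed.

Lemma prime_ndvd (a b : nat) : prime a -> prime b -> a != b -> ~~ (a %| b)%N.
Proof. by move=> pa pb; rewrite dvdn_prime2. Qed.

Lemma prime_ndvd2 (a b c : nat) : prime a -> prime b -> prime c -> a != b -> a != c -> ~~ (a %| b * c)%N.
Proof. by move=> pa pb pc ab ac; rewrite Euclid_dvdM // negb_or !prime_ndvd. Qed.

Lemma d_mod4 : (d %% 4 = 3)%N.
Proof. by rewrite -modnMml -(modnMml p1) p1_4 mul1n p2_4 mul1n q_4. Qed.

Let d4 := d_mod4.

Variables (pi1 pi2 : L).
Hypotheses (pp1 : gprime i pi1) (pp1' : gprime i (tau pi1)) (pi1E : pi1 * tau pi1 = p1%:R)
  (pi1n : ~ gdvd i pi1 (tau pi1)).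
Hypotheses (pp2 : gprime i pi2) (pp2' : gprime i (tau pi2)) (pi2E : pi2 * tau pi2 = p2%:R)
  (pi2n : ~ gdvd i pi2 (tau pi2)).

Definition ps (j : 'I_5) : L := nth 0 [:: pi1; tau pi1; pi2; tau pi2; q%:R] j.

Lemma ordP5 (P : 'I_5 -> Prop) : P (inord 0) -> P (inord 1) -> P (inord 2) -> P (inord 3) -> P (inord 4) -> forall j, P j.
Proof.
move=> h0 h1 h2 h3 h4 [j jlt]; have -> : Ordinal jlt = inord j by apply: val_inj; rewrite /= inordK.
by case: j jlt => [|[|[|[|[|j]]]]].
Qed.

Lemma psE : [/\ ps (inord 0) = pi1, ps (inord 1) = tau pi1, ps (inord 2) = pi2, ps (inord 3) = tau pi2
  & ps (inord 4) = q%:R].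
Proof. by split; rewrite /ps inordK. Qed.

Let pi1G : pi1 \in G. Proof. by case: pp1 => -[]. Qed.
Let pi2G : pi2 \in G. Proof. by case: pp2 => -[]. Qed.

Lemma psP j : gprime i (ps j).
Proof.
have [e0 e1 e2 e3 e4] := psE; move: j; apply: ordP5; rewrite ?(e0, e1, e2, e3, e4) //.
exact: (gprime_inert ii ti).
Qed.

Lemma tau_ndvd pi : gprime i pi -> ~ gdvd i pi (tau pi) -> ~ gdvd i (tau pi) (tau (tau pi)).
Proof.
move=> [piO _ _ _] h [c cO ce]; apply: h; have [piG _] := piO; exists (tau c); first exact: tauO.
by have := congr1 tau ce; rewrite rmorphM /= !(tautau ii ti) // (tauGi ii ti).
Qed.

Lemma psd j : exists b, [/\ OO G b, d%:R = ps j * b & ~ gdvd i (ps j) b].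
Proof.
have [e0 e1 e2 e3 e4] := psE; have ttau := tautau ii ti.
have t1 : tau pi1 * tau (tau pi1) = p1%:R by rewrite ttau // mulrC.
have t2 : tau pi2 * tau (tau pi2) = p2%:R by rewrite ttau // mulrC.
have nd1 : ~~ (p1 %| p2 * q)%N by exact: prime_ndvd2.
have nd2 : ~~ (p2 %| p1 * q)%N by apply: prime_ndvd2 => //; rewrite eq_sym.
have ndq : ~~ (q %| p1 * p2)%N by apply: prime_ndvd2 => //; rewrite eq_sym.
have E1 : d = (p1 * (p2 * q))%N by ring.
have E2 : d = (p2 * (p1 * q))%N by ring.
have E3 : d = (q * (p1 * p2))%N by ring.
move: j; apply: ordP5; rewrite ?(e0, e1, e2, e3, e4).
- by have [h1 h2 h3] := split_exact ii ti pp1 pi1E pi1n pr1 nd1; eexists; split; [exact: h1|rewrite E1; exact: h2|].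
- by have [h1 h2 h3] := split_exact ii ti pp1' t1 (tau_ndvd pp1 pi1n) pr1 nd1; eexists; split; [exact: h1|rewrite E1; exact: h2|].
- by have [h1 h2 h3] := split_exact ii ti pp2 pi2E pi2n pr2 nd2; eexists; split; [exact: h1|rewrite E2; exact: h2|].
- by have [h1 h2 h3] := split_exact ii ti pp2' t2 (tau_ndvd pp2 pi2n) pr2 nd2; eexists; split; [exact: h1|rewrite E2; exact: h2|].
exists (p1 * p2)%:R; split; [exact: nat_OO|by rewrite E3 natrM|exact: (inert_prime_nat ii ti prq ndq)].
Qed.

Lemma prod5 (F : 'I_5 -> L) : \prod_j F j = F (inord 0) * F (inord 1) * F (inord 2) * F (inord 3) * F (inord 4).
Proof.
rewrite !big_ord_recr big_ord0 /= mul1r.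
by do !congr (_ * _); congr F; apply: val_inj; rewrite /= inordK.
Qed.

Lemma prod_ps : d%:R = \prod_j ps j.
Proof. have [e0 e1 e2 e3 e4] := psE; rewrite prod5 e0 e1 e2 e3 e4 !natrM -pi1E -pi2E; ring. Qed.

Local Notation rv := (rv ps).

Lemma rvE (v : V) : rv v = pi1 ^+ (v 0 (inord 0)) * tau pi1 ^+ (v 0 (inord 1)) * pi2 ^+ (v 0 (inord 2)) *
  tau pi2 ^+ (v 0 (inord 3)) * q%:R ^+ (v 0 (inord 4)).
Proof. by have [e0 e1 e2 e3 e4] := psE; rewrite -[LHS]/(\prod_j ps j ^+ (v 0 j)) prod5 e0 e1 e2 e3 e4. Qed.

Lemma rv_norm (v : V) : rv v * tau (rv v) =
  (p1 ^ (v 0 (inord 0) + v 0 (inord 1)) * p2 ^ (v 0 (inord 2) + v 0 (inord 3)) * q ^ (2 * v 0 (inord 4)))%:R.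
Proof.
have ttau := tautau ii ti.
rewrite mul2n -addnn !natrM !natrX -pi1E -pi2E rvE.
move: (nat_of_ord _) (nat_of_ord _) (nat_of_ord _) (nat_of_ord _) (nat_of_ord _) => a b c e f.
by rewrite !rmorphM !rmorphXn rmorph_nat /= !ttau // !exprD !exprMn; ring.
Qed.

Lemma rational_sqrt_k c (N : nat) : c \in k -> c ^+ 2 = N%:R ->
  exists z, z \in QQ L /\ [\/ z ^+ 2 = (N%:Z)%:~R, z ^+ 2 = (- N%:Z)%:~R, z ^+ 2 = (N%:Z * d%:Z)%:~R
    | z ^+ 2 = (- (N%:Z * d%:Z))%:~R].
Proof.
move=> ck cN; have iQ : i ^+ 2 \in QQ L by rewrite ii; mem.
have sQ : s ^+ 2 \in QQ L by rewrite ss; mem.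
have cG : c ^+ 2 \in G by rewrite cN; mem.
have dec z : z \in G -> z ^+ 2 \in QQ L -> z \in QQ L \/ z * i \in QQ L.
  by move=> zG zQ; exact: (quad_mem iQ zQ zG).
have [h|h] := quad_mem (sG i ss) cG ck.
  have [h1|h1] := dec _ h (ltac:(rewrite cN; mem)).
    by exists c; split=> //; constructor 1.
  exists (c * i); split=> //; constructor 2.
  by rewrite exprMn cN ii rmorphN /= -pmulrn mulrN1.
have e : (c * s) ^+ 2 = N%:R * d%:R by rewrite exprMn cN ss.
have [h1|h1] := dec _ h (ltac:(rewrite e; mem)).
  by exists (c * s); split=> //; constructor 3; rewrite e -PoszM -pmulrn (natrM _ N).
exists (c * s * i); split=> //; constructor 4.
by rewrite exprMn e ii rmorphN /= -PoszM -pmulrn (natrM _ N) mulrN1.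
Qed.

Lemma neg_ndvdz (n : nat) (M : nat) : ~~ (n %| M)%N -> ~~ (n %| - M%:Z)%Z.
Proof. by rewrite dvdzE abszN. Qed.

(** A square root in [k] of this number makes it, up to sign and possibly a factor [d], a rational
    square. The factor [d] would give [q] an odd exponent, and without it an exponent 1 at [p1] or
    [p2] is impossible. *)
Lemma norm_exponents c (a b f : nat) : c \in k -> c ^+ 2 = (p1 ^ a * p2 ^ b * q ^ (2 * f))%:R ->
  a != 1%N /\ b != 1%N.
Proof.
move=> ck cE.
have odd_exp (n M : nat) z : prime n -> ~~ (n %| M)%N -> z \in QQ L ->
    z ^+ 2 = ((n * M)%N%:Z)%:~R \/ z ^+ 2 = (- (n * M)%N%:Z)%:~R -> False.
  move=> pn nM zQ [] h; first exact: (rat_sqr_prime pn (M := M) _ zQ h).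
  by apply: (rat_sqr_prime pn (neg_ndvdz nM) zQ); rewrite mulrN.
have [z [zQ zE]] := rational_sqrt_k ck cE.
have q0 : q%:R != 0 :> L by rewrite natL_eq0 -lt0n prime_gt0.
have nd (n : nat) a' b' e f' : prime n -> ~~ (n %| a')%N -> ~~ (n %| b')%N -> ~~ (n %| a' ^ e * b' ^ f')%N.
  by move=> pn na nb; rewrite Euclid_dvdM // !Euclid_dvdX // (negbTE na) (negbTE nb).
set N := (_ * _ * _)%N in zE cE.
have zN : z ^+ 2 = (N%:Z)%:~R \/ z ^+ 2 = (- N%:Z)%:~R.
  suff no : z ^+ 2 = (N%:Z * d%:Z)%:~R \/ z ^+ 2 = (- (N%:Z * d%:Z))%:~R -> False.
    by case: zE => h; [left|right|case: no; left|case: no; right].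
  move=> h; apply: (odd_exp q (p1 ^ a.+1 * p2 ^ b.+1)%N (z / q%:R ^+ f)) => //.
  - by apply: nd => //; apply: prime_ndvd; rewrite // eq_sym.
  - by mem.
  have Nd : (N%:Z * d%:Z)%:~R = ((q * (p1 ^ a.+1 * p2 ^ b.+1))%N%:Z)%:~R * q%:R ^+ (2 * f) :> L.
    rewrite -PoszM -!pmulrn -natrX -natrM; congr (_%:R); rewrite /N !expnS.
    by move: (p1 ^ a)%N (p2 ^ b)%N (q ^ (2 * f))%N => A B C; ring.
  have qF : (q%:R ^+ f) ^+ 2 = q%:R ^+ (2 * f) :> L by rewrite -exprM mulnC.
  rewrite exprMn exprVn qF.
  have qF0 : q%:R ^+ (2 * f) != 0 :> L by rewrite expf_neq0.
  by case: h => ->; [left; rewrite Nd mulfK|right; rewrite !rmorphN /= Nd -mulNr mulfK].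
split; apply/eqP => e1.
  apply: (odd_exp p1 (p2 ^ b * q ^ (2 * f))%N z) => //; first by apply: nd => //; exact: prime_ndvd.
  by have <- : N = (p1 * (p2 ^ b * q ^ (2 * f)))%N by [rewrite /N e1 expn1 mulnA].
apply: (odd_exp p2 (p1 ^ a * q ^ (2 * f))%N z) => //.
  by apply: nd => //; apply: prime_ndvd; rewrite // eq_sym.
by have <- : N = (p2 * (p1 ^ a * q ^ (2 * f)))%N by [rewrite /N e1 expn1 mulnA [(p2 * _)%N]mulnC].
Qed.

Lemma norm_sqr_even c (v : V) : c \in k -> c ^+ 2 = rv v * tau (rv v) ->
  v 0 (inord 0) = v 0 (inord 1) /\ v 0 (inord 2) = v 0 (inord 3).
Proof.
move=> ck; rewrite rv_norm => /(norm_exponents ck)[h1 h2].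
have F2add (a b : 'F_2) : (a + b != 1)%N -> a = b.
  by move: a b => [[|[|a]] ha] [[|[|b]] hb] // _; exact: val_inj.
by split; apply: F2add.
Qed.

Section Identify.
Variables (K : {subfield L}) (sigma : 'AEnd(L)).
Hypotheses (unr : unramified_finite k K) (galK : galois (QQ L) K).
Hypothesis sigk : forall z, z \in k -> sigma z = z.

Lemma adjoin_scale x y : y \in k -> y != 0 -> <<k; y * x>>%AS = <<k; x>>%AS.
Proof.
move=> yk y0; apply: val_inj => /=; apply/eqP; rewrite eqEsubv; apply/andP; split; apply: adj_sub.
- exact: subv_adjoin.
- by apply: rpredM; [exact: mem_adj|exact: memv_adjoin].
- exact: subv_adjoin.
- rewrite -{1}[x](mulKf y0).
  by apply: rpredM; [rewrite rpredV; exact: mem_adj|exact: memv_adjoin].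
Qed.

Definition generates x := [/\ x ^+ 2 \in k, x != 0, sigma x = - x & K = <<k; x>>%AS].

Lemma generates_scale x y : y \in k -> y != 0 -> generates x -> generates (y * x).
Proof.
move=> yk y0 [xx x0 sx KE]; split; first by rewrite exprMn; mem.
- by rewrite mulf_neq0.
- by rewrite rmorphM /= sx sigk // mulrN.
- by rewrite adjoin_scale.
Qed.

Lemma generates_notin x : generates x -> x \notin k.
Proof.
move=> [xx x0 sx _]; apply/negP => /sigk; rewrite sx => /eqP; rewrite -subr_eq0 -opprD oppr_eq0 -mulr2n.
by rewrite -mulr_natr mulf_eq0 (negbTE x0) (negbTE (two_neq0 L)).
Qed.

(** [K] is normal over Q, so the conjugate [g x] lies in [K] with square in [k]; by [quad_mem] it is
    a [k]-multiple of [x]. *)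
Lemma generates_cocycle (g : 'AEnd(L)) x : generates x ->
  (forall z, z \in k -> g z \in k) -> (forall z, z \in k -> g (g z) = z) ->
  g x / x \in k /\ (g (g x) = x \/ g (g x) = - x).
Proof.
move=> gx gk gg; have xn := generates_notin gx; have [xx x0 sx KE] := gx.
have xK : x \in K by rewrite KE; exact: memv_adjoin.
have ggx : g (g x) = x \/ g (g x) = - x by apply: sqr_opp_or; rewrite -!rmorphXn /= gg.
split=> //; have gxK : g x \in <<k; x>>%VS by have := aut_stable g galK xK; rewrite KE.
have gxx : (g x) ^+ 2 \in k by rewrite -rmorphXn /= gk.
have [h|h] := quad_mem xx gxx gxK.
  case/negP: xn; have := gk _ h; case: ggx => ->; rewrite ?rpredN //.
have -> : g x / x = (g x * x) / x ^+ 2 by field.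
by mem.
Qed.

(** [rho x / x] has norm 1 or -1. For norm 1, Hilbert 90 rescales [x] so that its square is fixed by
    [rho]. For norm -1, the same applied to [i] times it gives a radicand in [s] times Q(i), which
    would ramify above [q]. *)
Lemma radicand_Gi x : generates x -> exists y, generates y /\ y ^+ 2 \in G.
Proof.
move=> gx; have [xx x0 sx KE] := gx.
have [gk ggx] := generates_cocycle gx (rhok ii ss rs ri) (rhorho ii ss rs ri).
set ga := rho x / x in gk.
have gaN : ga * rho ga = rho (rho x) / x.
  by rewrite /ga fmorph_div /=; field; rewrite x0 fmorph_eq0.
have ikk := ik s i; have i0 := i_neq0 ii.
have ga0 : ga != 0 by rewrite mulf_neq0 ?invr_eq0 ?fmorph_eq0.
have rx : rho x = ga * x by rewrite /ga divfK.
case: ggx => gg2; rewrite gg2 ?mulNr divff // in gaN.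
  have [y [yk y0 ry]] := hilbert90 ii ss d4 rs ri gk gaN.
  exists (y^-1 * x); have g' : generates (y^-1 * x) by apply: generates_scale; rewrite ?rpredV ?invr_eq0.
  split=> //; apply: (rhofix ii ss rs ri); first by case: g'.
  rewrite rmorphXn rmorphM /= fmorphV /= ry rx; congr (_ ^+ 2); field; by rewrite y0.
have iga : (i * ga) * rho (i * ga) = 1.
  by rewrite rmorphM /= ri mulrACA -expr2 ii gaN mulrNN mulr1.
have [y [yk y0 ry]] := hilbert90 ii ss d4 rs ri (rpredM ikk gk) iga.
have g' : generates (y^-1 * x) by apply: generates_scale; rewrite ?rpredV ?invr_eq0.
have [xx' x0' sx' KE'] := g'.
have s0 := s_neq0 ss d4; have skk := sk s i.
have tG : (y^-1 * x) ^+ 2 / s \in G.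
  apply: (rhofix ii ss rs ri); first by mem.
  rewrite fmorph_div rmorphXn rmorphM /= fmorphV /= ry rx rs.
  have -> : ((y * (i * ga))^-1 * (ga * x)) ^+ 2 / - s = - i ^- 2 * ((y^-1 * x) ^+ 2 / s).
    by move: ga0; move: (ga) => g0 g0n; field; rewrite ?oppr_eq0 ?s0 ?g0n ?i0 ?y0.
  by rewrite -exprVn -[i^-1]mulr1 exprMn exprVn ii expr1n mulr1 invrN invr1 opprK mul1r.
have [b [bO dE bn]] := psd (inord 4).
exfalso; apply: (radicand_not_s ii ss d4 rs ri ti xx' x0' sx' KE' sigk unr (psP (inord 4)) bO dE bn tG).
by rewrite divfK.
Qed.

(** Evenness away from [d] gives a unit times some [rv v]; since -1 is the square of [i], only the
    units 1 and [i] remain. *)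
Lemma radicand_rv x : generates x -> exists y v u, [/\ generates y, u = 1 \/ u = i & y ^+ 2 = u * rv v].
Proof.
move=> /radicand_Gi[y [gy yG]]; have [yy y0 sy KE] := gy; have ikk := ik s i; have i0 := i_neq0 ii.
have [v [u [t [uG uu tG t0 e]]]] : spanned i ps (y ^+ 2).
  apply: (even_spanned ii d4 ti psP psd prod_ps yG); first by rewrite expf_neq0.
  by move=> p pp pd; exact: (radicand_even ii ss d4 rs ri ti yy y0 sy KE sigk unr pp pd yG).
have tk := subvP (Gk s i) _ tG.
have g1 : generates (t^-1 * y) by apply: generates_scale; rewrite ?rpredV ?invr_eq0.
have e1 : (t^-1 * y) ^+ 2 = u * rv v by rewrite exprMn e exprVn; field.
have g2 : generates (i * (t^-1 * y)) by apply: generates_scale.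
have e2 : (i * (t^-1 * y)) ^+ 2 = - u * rv v by rewrite exprMn ii e1; ring.
case: (Gi_units ii ti uG uu) => ue; rewrite ue ?opprK in e1 e2.
- by exists (t^-1 * y), v, 1; split=> //; left.
- by exists (i * (t^-1 * y)), v, 1; split=> //; left.
- by exists (t^-1 * y), v, i; split=> //; right.
- by exists (i * (t^-1 * y)), v, i; split=> //; right.
Qed.

(** Normality over Q puts [y * tau y] in [k], a square root of [rv v * tau (rv v)]. So conjugate
    primes have equal exponents and [rv v] is rational; the unit [i] is excluded by ramification
    above 2. *)
Lemma radicand_nat x : generates x -> exists y (a b c : nat),
  [/\ generates y, (a < 2)%N, (b < 2)%N, (c < 2)%N & y ^+ 2 = (p1 ^ a * p2 ^ b * q ^ c)%:R].
Proof.
move=> /radicand_rv[y [v [u [gy uE e]]]]; have [yy y0 sy KE] := gy.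
have tauk' := @tauk L s i _ tau ii ss ts ti.
have tautauk z : z \in k -> tau (tau z) = z.
  apply: (fix_adjoin (E := G)); [exact: (sG i ss)|exact: (tautau ii ti)|by rewrite !ts].
have [gk ggx] := generates_cocycle gy tauk' tautauk.
have ck : y * tau y \in k by have -> : y * tau y = (tau y / y) * y ^+ 2 by [field]; mem.
have cE : (y * tau y) ^+ 2 = rv v * tau (rv v).
  have uN : u * tau u = 1 by case: uE => ->; rewrite ?rmorph1 ?mul1r // ti mulrN -expr2 ii opprK.
  by rewrite exprMn -rmorphXn /= e rmorphM /= mulrACA uN mul1r.
have [h1 h2] := norm_sqr_even ck cE.
pose a : nat := v 0 (inord 0); pose b : nat := v 0 (inord 2); pose c : nat := v 0 (inord 4).
have rvn : rv v = (p1 ^ a * p2 ^ b * q ^ c)%:R.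
  by rewrite rvE -h1 -h2 -exprMn -mulrA -mulrA [_ * (tau pi2 ^+ _ * _)]mulrA -exprMn pi1E pi2E !natrM !natrX mulrA.
have F2lt (f : 'F_2) : (f < 2)%N by case: f.
case: uE => ue; first by exists y, a, b, c; split; rewrite ?F2lt // e ue mul1r rvn.
exfalso; apply: (radicand_not_i ii ss d4 rs ri ti yy y0 sy KE sigk unr (n := (p1 ^ a * p2 ^ b * q ^ c)%N)).
  by rewrite !oddM !oddX; move: p1_4 p2_4 q_4; clear; rewrite -[(_ %% 4)%N]/(_ %% 4)%N => ? ? ?; rewrite (_ : odd p1) 1?(_ : odd p2) 1?(_ : odd q) ?orbT //; lia.
by rewrite e ue rvn.
Qed.

Lemma radicand_cases x : generates x -> exists y (m : nat),
  [/\ generates y, m \in [:: p1; p2; (p1 * p2)%N] & y ^+ 2 = m%:R].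
Proof.
move=> /radicand_nat[y [a [b [c [gy a2 b2 c2 e]]]]]; have [yy y0 sy KE] := gy.
have skk := sk s i; have s0 := s_neq0 ss d4.
have q0 : q%:R != 0 :> L by rewrite natL_eq0 -lt0n prime_gt0.
have p10 : p1%:R != 0 :> L by rewrite natL_eq0 -lt0n prime_gt0.
have p20 : p2%:R != 0 :> L by rewrite natL_eq0 -lt0n prime_gt0.
have [z [a' [b' [gz a2' b2' ez]]]] : exists z (a b : nat), [/\ generates z, (a < 2)%N, (b < 2)%N & z ^+ 2 = (p1 ^ a * p2 ^ b)%:R].
  (* If [q] occurs, pass to [s / y], with square [d / y ^+ 2]: this removes [q] and complements the
     other two exponents. *)
  case: c c2 e => [|[|//]] _ e; first by exists y, a, b; split=> //; rewrite e expn0 muln1.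
  exists (s / y ^+ 2 * y), (1 - a)%N, (1 - b)%N; split.
  - apply: generates_scale => //; first by mem.
    by rewrite mulf_neq0 ?invr_eq0 ?expf_neq0.
  - by clear; lia.
  - by clear; lia.
  have -> : (s / y ^+ 2 * y) ^+ 2 = s ^+ 2 / y ^+ 2 by field.
  rewrite e ss; apply: (canLR (mulfK _)); first by rewrite -e expf_neq0.
  rewrite -natrM; congr (_%:R).
  by case: a a2 {e} => [|[|//]] _; case: b b2 => [|[|//]] _; rewrite ?subn0 ?subnn ?expn0 ?expn1; ring.
have zn := generates_notin gz.
case: a' a2' ez => [|[|//]] _; case: b' b2' => [|[|//]] _; rewrite ?expn0 ?expn1 ?mul1n ?muln1 => ez.
- exfalso; case/negP: zn; have [->|->] : z = 1 \/ z = -1 by apply: sqr_opp_or; rewrite ez expr1n.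
    by mem.
  by mem.
- by exists z, p2; split=> //; rewrite !inE eqxx orbT.
- by exists z, p1; split=> //; rewrite !inE eqxx.
- by exists z, (p1 * p2)%N; split=> //; rewrite !inE eqxx !orbT.
Qed.

End Identify.
End Radicand.

(** [x] is [z - g z] for some [z] moved by the generator [g] of the Galois group; [sigma] extends
    its action to the ambient field. *)
Lemma quadratic_generator (L : splittingFieldType rat) (k K : {subfield L}) : galois k K -> \dim_k K = 2%N ->
  exists x (sigma : 'AEnd(L)), [/\ x ^+ 2 \in k, x != 0, sigma x = - x, K = <<k; x>>%AS
    & forall z, z \in k -> sigma z = z].
Proof.
move=> gkK dim2; have kK : (k <= K)%VS by case/and3P: gkK.
have card2 : #|'Gal(K / k)%g| = 2%N by rewrite -(galois_dim gkK).
have [g gG gn] : exists2 g, g \in 'Gal(K / k)%g & g != 1%g.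
  apply/exists_inP; apply: contraT; rewrite negb_exists_in => /forall_inP h.
  suff : (#|'Gal(K / k)%g| <= 1)%N by rewrite card2.
  rewrite -(cards1 (1%g : gal_of K)); apply: subset_leq_card; apply/fintype.subsetP => g /h.
  by rewrite negbK => /eqP ->; rewrite !inE.
have GE h : h \in 'Gal(K / k)%g -> h = 1%g \/ h = g.
  move=> hG; have [->|h1] := eqVneq h 1%g; [by left|right].
  apply/eqP; apply: contraT => hg; suff : (2 < #|'Gal(K / k)%g|)%N by rewrite card2.
  have <- : #|[set 1%g; g; h]%SET| = 3%N.
    by rewrite -finset.setUA cardsU1 cards2 !inE negb_or eq_sym gn eq_sym h1 eq_sym hg.
  apply: subset_leq_card; apply/fintype.subsetP => f; rewrite !inE => /orP[/orP[]|] /eqP -> //.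
have gg : (g * g = 1)%g.
  by have [//|e] := GE _ (groupM gG gG); move/eqP: e; rewrite -{3}[g]mulg1 (inj_eq (mulgI g)) (negbTE gn).
have fix_k x : x \in K -> g x = x -> x \in k.
  move=> xK gx; rewrite -(galois_fixedField gkK); apply/fixedFieldP => // h /GE[->|->] //.
  by rewrite gal_id.
have g2 x : x \in K -> g (g x) = x by move=> xK; rewrite -galM // gg gal_id.
have [z zK gz] : exists2 z, z \in K & g z != z.
  apply: contrapT => h; case/eqP: gn; apply/eqP/gal_eqP => x xK; rewrite gal_id.
  by apply/eqP; apply: contraT => gx; case: h; exists x.
pose x := z - g z.
have gK y : y \in K -> g y \in K by exact: memv_gal.
have gzK := gK _ zK.
have xK : x \in K by rewrite /x; mem.
have gx : g x = - x by rewrite /x rmorphB /= g2 // opprB.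
have x0 : x != 0 by rewrite subr_eq0 eq_sym.
have xx : x ^+ 2 \in k by apply: fix_k; [mem|rewrite rmorphXn /= gx sqrrN].
have t0 := two_neq0 L.
have xn : x \notin k.
  apply/negP => xk; have := fixed_gal kK gG xk; rewrite gx => /eqP.
  by rewrite -subr_eq0 -opprD oppr_eq0 -mulr2n -mulr_natr mulf_eq0 (negbTE x0) (negbTE t0).
have [sigma [sk sx]] := quad_aut xx xn.
exists x, sigma; split=> //; apply: val_inj => /=; apply/eqP; rewrite eqEsubv adj_sub // andbT.
apply/subvP => w wK; have gwK := gK _ wK.
have h1 : (w + g w) / 2%:R \in k.
  by apply: fix_k; [mem|rewrite fmorph_div rmorphD rmorph_nat /= g2 // addrC].
have h2 : (w - g w) / (2%:R * x) \in k.
  apply: fix_k; first by mem.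
  by rewrite fmorph_div rmorphB (rmorphM _ 2%:R x) rmorph_nat /= g2 // gx mulrN invrN; ring.
have -> : w = (w + g w) / 2%:R + (w - g w) / (2%:R * x) * x by field; rewrite t0 x0.
by apply: rpredD; [exact: mem_adj|apply: rpredM; [exact: mem_adj|exact: memv_adjoin]].
Qed.

(** * The genus field *)

Section BaseEmbedding.
Variables (F0 : fieldType) (F : fieldExtType F0) (E : fieldExtType F).

(** The inclusion of the middle field of a tower, with the top regarded as an extension of the
    bottom field. *)
Definition base_emb (x : F) : baseFieldType E := in_alg E x.

Fact base_emb_scalable (c : F0) x : base_emb (c *: x) = c *: base_emb x.
Proof. by rewrite /base_emb baseField_scaleE /= scalerA mulr_algl. Qed.
Fact base_emb_zmod : {morph base_emb : x y / x - y}.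
Proof. by move=> x y; rewrite /base_emb rmorphB. Qed.
Fact base_emb_monoid : monoid_morphism base_emb.
Proof. by split; [exact: (rmorph1 (in_alg E))|exact: (rmorphM (in_alg E))]. Qed.
HB.instance Definition _ := GRing.isZmodMorphism.Build F (baseFieldType E) base_emb base_emb_zmod.
HB.instance Definition _ := GRing.isMonoidMorphism.Build F (baseFieldType E) base_emb base_emb_monoid.
HB.instance Definition _ := GRing.isScalable.Build F0 F (baseFieldType E) *:%R base_emb base_emb_scalable.

Definition base_ahom : 'AHom(F, baseFieldType E) := linfun_ahom base_emb.

Lemma base_ahomE x : base_ahom x = in_alg E x. Proof. by rewrite /base_ahom /= lfunE. Qed.

End BaseEmbedding.

(** If [L] splits [p0] over Q, adjoining [z] splits [p0] times [X^2 - a]. *)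
Lemma sqrt_splitting (L : splittingFieldType rat) (E : fieldExtType L) (z : E) (a : nat) :
  z ^+ 2 = a%:R -> <<1; z>>%VS = fullv -> splitting_field_axiom (baseFieldType E).
Proof.
move=> zz zfull; set L' := baseFieldType E; pose f := base_ahom E.
have [p0 p0F [rs Dp gen]] := splittingFieldP L.
pose z' : L' := z.
pose rs' := map f rs ++ [:: z'; - z'].
exists (map_poly f p0 * ('X^2 - a%:R%:P)).
  rewrite rpredM //; last by rewrite rpredB ?rpredX ?polyOverX // polyOverC rpred_nat.
  apply/polyOverP => j; rewrite coef_map /= -(aimg1 f); apply: memv_img; exact: (polyOverP p0F).
exists rs'.
  rewrite big_cat /= !big_cons big_nil mulr1 big_map.
  have -> : \prod_(j <- rs) ('X - (f j)%:P) = map_poly f (\prod_(j <- rs) ('X - j%:P)).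
    by rewrite rmorph_prod; apply: eq_bigr => j _; rewrite /= map_polyXsubC.
  have -> : ('X - z'%:P) * ('X - (- z')%:P) = 'X^2 - a%:R%:P.
    have <- : z' ^+ 2 = a%:R by [].
    by rewrite polyCN opprK -subr_sqr rmorphXn.
  by rewrite eqp_mul2r ?eqp_map // -size_poly_eq0 size_XnsubC.
apply/eqP; rewrite eqEsubv subvf /=; apply/subvP => w _.
have fin x : f x \in <<1 & rs'>>%VS.
  have : f x \in (f @: <<1 & rs>>)%VS by rewrite gen memv_img ?memvf.
  rewrite aimg_adjoin_seq aimg1; apply: (subvP _ _); apply: adjoin_seqSr.
  by move=> y yr; rewrite mem_cat yr.
have z'in : z' \in <<1 & rs'>>%VS by apply: seqv_sub_adjoin; rewrite mem_cat !inE eqxx orbT.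
have : (w : E) \in <<1; z>>%VS by rewrite zfull (@memvf _ E).
case/Fadjoin_polyP => g gF wE.
have -> : w = (g : {poly L'}).[z'] by exact: wE.
apply: (rpred_horner (S := <<1 & rs'>>%AS)) => //; apply/polyOverP => j.
have /vlineP[c ce] := polyOverP gF j.
by have := fin c; rewrite base_ahomE /= -ce.
Qed.

(** A square root of [p1] or [p2] may be absent from [L]; maximality of the genus field in larger
    ambient fields is what brings it back. *)
Lemma exists_sqrt (L : splittingFieldType rat) (a : nat) :
  exists (L' : splittingFieldType rat) (f : 'AHom(L, L')) (r : L'), r ^+ 2 = a%:R.
Proof.
have [[r re]|nr] := pselect (exists r : L, r ^+ 2 = a%:R); first by exists L, \1%AF, r.
pose p : {poly L} := 'X^2 - a%:R%:P.
have sp : size p = 3%N by rewrite size_XnsubC.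
have irr : irreducible_poly p.
  apply: cubic_irreducible; first by rewrite sp.
  move=> x; apply/negP => /rootP; rewrite !hornerE => /eqP; rewrite subr_eq0 => /eqP xa.
  by case: nr; exists x.
have [E dE [z rz zfull]] := irredp_FAdjoin irr.
have zz : z ^+ 2 = a%:R.
  move: rz; rewrite /p rmorphB /= map_polyXn map_polyC /= => /rootP; rewrite !hornerE => /eqP.
  by rewrite subr_eq0 => /eqP ->; rewrite scaler_nat.
pose L' : splittingFieldType rat := HB.pack (baseFieldType E)
  (FieldExt_isSplittingField.Build rat (baseFieldType E) (sqrt_splitting zz zfull)).
by exists L', (base_ahom E), z.
Qed.

Lemma multiquadratic_abelian (L : splittingFieldType rat) (i s r : L) (d a : nat) : i ^+ 2 = -1 -> s ^+ 2 = d%:R -> r ^+ 2 = a%:R ->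
  abelian_over_Q <<kk s i; r>>%AS.
Proof.
move=> ii ss rr; set M := <<kk s i; r>>%AS.
have sgn (g : 'AEnd(L)) : [/\ g s = s \/ g s = - s, g r = r \/ g r = - r & g i = i \/ g i = - i].
  by split; apply: sqr_opp_or; rewrite -rmorphXn /= ?(ss, rr, ii) ?rmorphN ?rmorph1 ?rmorph_nat.
have rr1 : r ^+ 2 = (a * 1)%:R by rewrite muln1.
have comm (g h : 'AEnd(L)) z : z \in M -> g z \in M /\ g (h z) = h (g z).
  have [g1 g2 g3] := sgn g; have [h1 h2 h3] := sgn h.
  by move=> /(commK ss rr1 ii g1 g2 g3 h1 h2 h3)[].
split.
  apply/and3P; split; first exact: sub1v.
    by apply/separableP => x _; apply: pcharf0_separable; exact: pchar0.
  apply/forall_inP => g _; rewrite eqEdim limg_dim_eq ?leqnn ?andbT.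
    by apply/subvP => _ /memv_imgP[x xM ->]; have [] := comm g g _ xM.
  by apply/eqP; rewrite -subv0; apply: subv_trans (capvSr _ _) _; rewrite subv0 AEnd_lker0.
apply/centsP => g gG h hG; apply/eqP/gal_eqP => x xM.
by rewrite !galM //; have [_ ->] := comm h g x xM.
Qed.

(** In an ambient field containing a root [r] of [a], the field k(r) is unramified, with [s / r] as
    the second generator, and abelian over Q. Maximality puts [r] in the image of [G], from which it
    is pulled back. *)
Lemma genus_field_sqrt (L : splittingFieldType rat) (i s : L) (a b d' q : nat) (G : {subfield L}) : i ^+ 2 = -1 -> s ^+ 2 = (a * b)%:R ->
  prime a -> prime q -> (a * b = q * d')%N -> ~~ (q %| d')%N -> ~~ (q %| a)%N -> coprime a b ->
  (a %% 4 = 1)%N -> (b %% 4 = 3)%N ->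
  absolute_genus_field (kk s i) G -> exists2 r, r \in G & r ^+ 2 = a%:R.
Proof.
move=> ii ss pa pq dE qd' qa ab a4 b4 [_ _ gmax].
have [L' [f [r rr]]] := exists_sqrt L a.
have ii' : f i ^+ 2 = -1 by rewrite -rmorphXn ii rmorphN rmorph1.
have ss' : f s ^+ 2 = (a * b)%:R by rewrite -rmorphXn ss rmorph_nat.
have a1 : ~~ (a %| 1)%N by rewrite dvdn1; case: eqP pa => // ->.
have [sigma [rho [tau [[sx s_s si] [rx rs ri] [tx ts ti]]]]] :=
  three_signs ii' rr ss' pa (esym (muln1 a)) a1 pq dE qd' qa.
have kE : (f @: kk s i)%AS = kk (f s) (f i).
  by apply: val_inj; rewrite /= !aimg_adjoin aimg1.
pose M := <<kk (f s) (f i); r>>%AS.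
have a0 : a%:R != 0 :> L' by rewrite natL_eq0 -lt0n prime_gt0.
have r0 : r != 0 by rewrite -sqrf_eq0 rr.
have rM : r \in M by exact: memv_adjoin.
have sM : f s \in M by apply: mem_adj; exact: sk.
have unr : unramified_ext (kk (f s) (f i)) M.
  apply: (unramified_sqrt ii' ss' rs ri ti (sigma := sigma) rr (y := f s / r) _ ab a4 b4) => //.
  - by rewrite exprMn exprVn ss' rr natrM mulrC mulKf.
  - by mem.
  - by rewrite fmorph_div /= sx s_s invrN mulrN.
  - apply: fixQ2; rewrite ?ii' ?ss' //; mem.
have abM := multiquadratic_abelian ii' ss' rr.
rewrite -kE in unr.
have /subvP/(_ _ rM) := gmax L' f M unr abM.
case/memv_imgP => r1 r1G re; exists r1 => //.
by apply: (fmorph_inj f); rewrite rmorphXn rmorph_nat -rr re.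
Qed.

(** * Counting by subgroups of F_2^5, and elementary arithmetic *)

Lemma card_quotient_image (gT : finGroupType) (T : Type) (S R : {group gT}) (F : gT -> T) :
  R \subset S -> (forall x y, x \in S -> y \in S -> F x = F y <-> (R :* x = R :* y)%g) ->
  [set F x | x in [set x | x \in S]] #= `I_#|S : R|%g.
Proof.
move=> RS FE; pose A := enum (rcosets R S); pose h j := F (repr (nth finset.set0 A j)).
have sA : size A = #|S : R|%g by rewrite /A -cardE.
have hP x : x \in S -> F (repr (R :* x)%g) = F x.
  move=> xS; have xr : repr (R :* x)%g \in (R :* x)%g by exact: mem_repr (rcoset_refl _ _).
  have rS : repr (R :* x)%g \in S.
    by case/rcosetP: xr => y yR ->; rewrite groupM // (fintype.subsetP RS).
  exact/(FE _ _ rS xS)/rcoset_eqP.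
have nthP j : (j < #|S : R|%g)%N -> exists2 x, x \in S & nth finset.set0 A j = (R :* x)%g.
  move=> jn; have : nth finset.set0 A j \in A by rewrite mem_nth // sA.
  by rewrite mem_enum => /rcosetsP[x xS Ax]; exists x.
have -> : [set F x | x in [set x | x \in S]] = [set h j | j in `I_#|S : R|%g].
  apply/seteqP; split=> [_ [x xS <-]|_ [j jn <-]].
    have xA : (R :* x)%g \in A by rewrite mem_enum; apply/rcosetsP; exists x.
    exists (seq.index (R :* x)%g A); first by rewrite /= -sA seq.index_mem.
    by rewrite /h seq.nth_index // hP.
  by have [x xS e] := nthP _ jn; exists x => //; rewrite /h e hP.
apply: inj_card_eq => j l; rewrite !in_setE /= => jn ln; rewrite /h.
have [x xS ex] := nthP _ jn; have [y yS ey] := nthP _ ln.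
rewrite ex ey !hP // => /(FE _ _ xS yS); rewrite -ex -ey => e.
by apply/eqP; rewrite -(nth_uniq finset.set0 _ _ (enum_uniq (rcosets R S))) ?sA // e.
Qed.

(** The index is a power of 2, greater than 1, and at most 8 because [R] has at least 2 elements and
    the proper subgroup [S] at most 16. *)
Lemma index_2_4_8 (S R : {group 'rV['F_2]_5}) : R \proper S -> S \proper [set: 'rV['F_2]_5]%SET ->
  (exists2 v, v \in R & v != 1%g) -> #|S : R|%g \in [:: 2; 4; 8]%N.
Proof.
move=> RS SV [v vR v1]; have V32 : #|[set: 'rV['F_2]_5]%SET| = (2 ^ 5)%N by rewrite cardsT card_mx card_Fp.
have R1 : (1 < #|R|)%N by rewrite cardG_gt1; apply/trivgPn; exists v.
have cRS := proper_card RS; have cSV := proper_card SV; rewrite V32 in cSV.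
have dS : (#|S| %| 2 ^ 5)%N by rewrite -V32; apply: (cardSg (G := [group of [set: 'rV['F_2]_5]%SET])); exact: finset.subsetT.
have LR := Lagrange (proper_sub RS).
have [a a5 ea] := dvdn_pfactor _ 5 (isT : prime 2) dS.
have dR : (#|S : R|%g %| 2 ^ a)%N by rewrite -ea -LR dvdn_mull.
have [b ba eb] := dvdn_pfactor _ a (isT : prime 2) dR.
move: R1 cRS cSV LR; rewrite ea eb; move: (#|R|) => r.
case: b {ba eb dR} => [|[|[|[|b]]]] // R1 cRS cSV LR.
- by rewrite muln1 in LR; rewrite LR ltnn in cRS.
- exfalso; have : (2 * 2 ^ 4 <= r * 2 ^ b.+4)%N by apply: leq_mul => //; rewrite leq_pexp2l.
  by rewrite LR leqNgt cSV.
Qed.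

Lemma F2_opp (v : 'rV['F_2]_5) : - v = v.
Proof. by apply/matrixP => j l; rewrite mxE; case: (v j l) => [[|[|a]] ha] //; exact: val_inj. Qed.

Lemma nonsquare2 (a b : nat) : prime a -> prime b -> a != b -> forall c : nat, (a * b)%N != (c * c)%N.
Proof.
move=> pa pb ab c; apply/eqP => e; have : (a %| c * c)%N by rewrite -e dvdn_mulr.
rewrite Euclid_dvdM // orbb => /dvdnP[c' ce].
have : (a %| b)%N.
  have : (a * b = a * (a * c' * c'))%N by rewrite e ce; ring.
  move=> /eqP; rewrite eqn_pmul2l ?prime_gt0 // => /eqP ->; by rewrite -mulnA dvdn_mulr.
by rewrite dvdn_prime2 // (negbTE ab).
Qed.

Lemma factor_semiprime (a b g h : nat) : prime a -> prime b -> a != b -> (a * b = g * h)%N -> (1 < g)%N ->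
  [\/ g = (a * b)%N /\ h = 1%N, g = a /\ h = b | g = b /\ h = a].
Proof.
move=> pa pb ab e g1; have a0 := prime_gt0 pa; have b0 := prime_gt0 pb.
have cab : coprime a b by rewrite prime_coprime // dvdn_prime2.
have : (a %| g * h)%N by rewrite -e dvdn_mulr.
have : (b %| g * h)%N by rewrite -e dvdn_mull.
have key (a' b' g' h' : nat) : (0 < a')%N -> (0 < b')%N -> (a' * b' = g' * h')%N -> (a' %| g')%N -> (b' %| h')%N -> g' = a' /\ h' = b'.
  move=> a0' b0' e' /dvdnP[x gx] /dvdnP[y hy]; move: e'; rewrite gx hy => e'.
  have : ((x * y) * (a' * b') = 1 * (a' * b'))%N by rewrite mul1n [RHS]e'; ring.
  move/eqP; rewrite eqn_pmul2r ?muln_gt0 ?a0' // => /eqP/eqP; rewrite muln_eq1 => /andP[/eqP -> /eqP ->].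
  by rewrite !mul1n.
rewrite !Euclid_dvdM // => /orP[bg|bh] /orP[ag|ah].
- have : (a * b %| g)%N by rewrite Gauss_dvd // ag.
  move=> abg; constructor 1; apply: (key (a * b)%N 1%N) => //; by rewrite ?muln_gt0 ?a0 ?muln1.
- by constructor 3; apply: (key b a) => //; rewrite mulnC.
- by constructor 2; apply: (key a b).
- have : (a * b %| h)%N by rewrite Gauss_dvd // ah.
  move=> /dvdnP[y hy]; exfalso; move: e; rewrite hy => e.
  have : (1 < g * y)%N \/ (y = 0)%N by case: (y) => [|y']; [right|left; rewrite mulnS; move: g1; clear; lia].
  case=> [h2|y0]; last by move: e; rewrite y0 mul0n muln0 => /eqP; rewrite muln_eq0 !eqn0Ngt a0 b0.
  have : (a * b * 1 < a * b * (g * y))%N by rewrite ltn_pmul2l // muln_gt0 a0.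
  have -> : (a * b * (g * y) = a * b * 1)%N by rewrite muln1 [RHS]e; ring.
  by rewrite ltnn.
Qed.

Lemma split_gt4 (p : nat) : prime p -> (p %% 4 = 1)%N -> (4 < p)%N.
Proof. by move=> /prime_gt1; clear; lia. Qed.

Lemma mod4_odd (p : nat) : (p %% 4 = 1 \/ p %% 4 = 3)%N -> odd p.
Proof. by clear; lia. Qed.

(** * Units times squares produced by Pell solutions *)

Section SquareClassesAbove.
Variables (L : splittingFieldType rat) (i : L) (tau : 'AEnd(L)).
Hypotheses (ii : i ^+ 2 = -1) (ti : tau i = - i).
Local Notation OO := ring_of_integers.
Local Notation G := (Gi i).
Implicit Types (E : {subfield L}) (x y z w : L).

Lemma norm_vi (u v m : nat) : (m * u ^ 2 = v ^ 2 + 1)%N ->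
  OO G (v%:R + i) /\ (v%:R + i) * tau (v%:R + i) = (m * u ^ 2)%:R.
Proof.
move=> e; split; first by apply: OOD; [exact: nat_OO|exact: OOi].
rewrite rmorphD rmorph_nat /= ti e natrD natrX; apply: (lin_comb (c := -1) ii); ring.
Qed.

Lemma pell_gt0 (u v m : nat) : (m * u ^ 2 = v ^ 2 + 1)%N -> (0 < u)%N.
Proof. by case: u => // /eqP; rewrite muln0 addn1. Qed.

(** The solution of [p u ^ 2 = v ^ 2 + 1] handles whichever of [pi] and [tau pi] divides [v + i];
    the other follows because their product [p] is the square of [x]. *)
Lemma split_prime_sqclass E x pi (p : nat) : prime p -> (p %% 4 = 1)%N -> gprime i pi -> pi * tau pi = p%:R ->
  i \in E -> x \in E -> x ^+ 2 = p%:R -> sqclass E pi /\ sqclass E (tau pi).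
Proof.
move=> pp p4 ppi piE iE xE xx; have [u [v e]] := neg_pell pp p4.
have [vO vN] := norm_vi e.
have [mu [z [mupi zO vE muE zE]]] := gdvd_split ii ti ppi piE vO vN.
have [piO pi0 _ _] := ppi.
have muO : OO G mu by case: mupi => ->; [|exact: tauO].
have smu := neg_pell_sqclass ii ti iE xE xx e muO zO vE zE (pell_gt0 e).
have x0 : x != 0 by rewrite -sqrf_eq0 xx natL_eq0 -lt0n prime_gt0.
have tpi0 : tau pi != 0 by rewrite fmorph_eq0.
have sp : sqclass E (pi * tau pi) by rewrite piE -xx; exact: sqclassX.
case: mupi => me; rewrite me in smu; split=> //.
  by rewrite -[tau pi](mulKf pi0); apply: sqclassM => //; exact: sqclassV.
by rewrite -[pi](mulfK tpi0); apply: sqclassM => //; exact: sqclassV.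
Qed.

(* The square of a u + x v is a times the unit (a u^2 + b v^2) + 2 u v x. *)
Lemma pell_factor_sqclass E x (a b u v : nat) : x \in E -> x ^+ 2 = (a * b)%:R -> (0 < a)%N ->
  (a * u ^ 2 = b * v ^ 2 + 1)%N -> sqclass E a%:R.
Proof.
move=> xE xx a0 e; have xi : isint x by apply: isint_sqr; rewrite xx; isi.
have eL : a%:R * u%:R ^+ 2 = b%:R * v%:R ^+ 2 + 1 :> L by rewrite -!natrX -!natrM e natrD.
pose A : L := a%:R * u%:R ^+ 2 + b%:R * v%:R ^+ 2; pose B : L := 2%:R * u%:R * v%:R.
pose ep := A + B * x; pose Y := a%:R * u%:R + x * v%:R.
have Ai : isint A by rewrite /A; isi.
have Bi : isint B by rewrite /B; isi.
have xx' : x ^+ 2 = a%:R * b%:R by rewrite xx natrM.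
have AB : A ^+ 2 - B ^+ 2 * (a%:R * b%:R) = 1.
  have -> : A ^+ 2 - B ^+ 2 * (a%:R * b%:R) = (a%:R * u%:R ^+ 2 - b%:R * v%:R ^+ 2) ^+ 2 by rewrite /A /B; ring.
  by rewrite eL addrAC subrr add0r expr1n.
have epu : iunit ep.
  apply: (@iunit_mul1 _ _ (A - B * x)); [by rewrite /ep; isi|isi|].
  by rewrite /ep mulrC -subr_sqr exprMn xx' AB.
have YY : Y ^+ 2 = a%:R * ep.
  by rewrite /Y /ep /A /B; apply: (lin_comb (c := v%:R ^+ 2) xx'); ring.
have [ep0 _ _] := epu; have an0 : a%:R != 0 :> L by rewrite natL_eq0 -lt0n.
exists Y, ep^-1; split; first by rewrite /Y; mem.
- by rewrite -sqrf_eq0 YY mulf_neq0.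
- exact: iunitV.
- by rewrite YY mulrCA mulVf // mulr1.
Qed.

End SquareClassesAbove.

(** * The capitulation kernel *)

Section KernelCount.
Variables (L : splittingFieldType rat) (s i x : L) (sigma rho tau : 'AEnd(L)) (p1 p2 q m : nat).
Variables (K : {subfield L}) (pi1 pi2 : L).
Implicit Types (y z u w t r : L) (E : {subfield L}).
Local Notation OO := ring_of_integers.
Local Notation d := (p1 * p2 * q)%N.
Hypotheses (pr1 : prime p1) (pr2 : prime p2) (prq : prime q).
Hypotheses (p1_4 : (p1 %% 4 = 1)%N) (p2_4 : (p2 %% 4 = 1)%N) (q_4 : (q %% 4 = 3)%N).
Hypotheses (p12 : p1 != p2).
Hypotheses (ii : i ^+ 2 = -1) (ss : s ^+ 2 = d%:R) (xx : x ^+ 2 = m%:R).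
Hypotheses (sx : sigma x = - x) (s_s : sigma s = s) (si : sigma i = i).
Hypotheses (rx : rho x = x) (rs : rho s = - s) (ri : rho i = i).
Hypotheses (tx : tau x = x) (ts : tau s = s) (ti : tau i = - i).
Hypotheses (mE : m \in [:: p1; p2; (p1 * p2)%N]) (KE : K = <<kk s i; x>>%AS).
Hypotheses (pp1 : gprime i pi1) (pp1' : gprime i (tau pi1)) (pi1E : pi1 * tau pi1 = p1%:R)
  (pi1n : ~ gdvd i pi1 (tau pi1)).
Hypotheses (pp2 : gprime i pi2) (pp2' : gprime i (tau pi2)) (pi2E : pi2 * tau pi2 = p2%:R)
  (pi2n : ~ gdvd i pi2 (tau pi2)).
Local Notation k := (kk s i).
Local Notation G := (Gi i).
Local Notation V := 'rV['F_2]_5.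

Let ps := ps tau q pi1 pi2.
Local Notation rv := (rv ps).
Let d4 : (d %% 4 = 3)%N. Proof. exact: d_mod4. Qed.
Let psP : forall j, gprime i (ps j). Proof. exact: psP. Qed.
Let psd : forall j, exists b, [/\ OO G b, d%:R = ps j * b & ~ gdvd i (ps j) b]. Proof. exact: psd. Qed.
Let dprod : d%:R = \prod_j ps j. Proof. exact: prod_ps. Qed.
Let psE : [/\ ps (inord 0) = pi1, ps (inord 1) = tau pi1, ps (inord 2) = pi2, ps (inord 3) = tau pi2
  & ps (inord 4) = q%:R]. Proof. exact: psE. Qed.
Let p1q : p1 != q. Proof. exact: mod4_neq. Qed.
Let p2q : p2 != q. Proof. exact: mod4_neq. Qed.
Let o1 : odd p1. Proof. by apply: mod4_odd; left. Qed.
Let o2 : odd p2. Proof. by apply: mod4_odd; left. Qed.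
Let oq : odd q. Proof. by apply: mod4_odd; right. Qed.
Let g1 : (4 < p1)%N. Proof. exact: split_gt4. Qed.
Let g2 : (4 < p2)%N. Proof. exact: split_gt4. Qed.
Let nd12 : ~~ (p1 %| p2)%N. Proof. exact: prime_ndvd. Qed.
Let nd21 : ~~ (p2 %| p1)%N. Proof. by apply: prime_ndvd; rewrite // eq_sym. Qed.
Let nd1 : ~~ (p1 %| p2 * q)%N. Proof. exact: prime_ndvd2. Qed.
Let nd2 : ~~ (p2 %| p1 * q)%N. Proof. by apply: prime_ndvd2; rewrite // eq_sym. Qed.
Let ndq : ~~ (q %| p1 * p2)%N. Proof. by apply: prime_ndvd2; rewrite // eq_sym. Qed.
Let q1 : ~~ (q %| p1)%N. Proof. by apply: prime_ndvd; rewrite // eq_sym. Qed.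
Let q2 : ~~ (q %| p2)%N. Proof. by apply: prime_ndvd; rewrite // eq_sym. Qed.
Let E1 : d = (p1 * (p2 * q))%N. Proof. by rewrite mulnA. Qed.
Let E2 : d = (p2 * (p1 * q))%N. Proof. by rewrite mulnCA mulnA. Qed.
Let E3 : d = (q * (p1 * p2))%N. Proof. by rewrite mulnC. Qed.
Let kK : (k <= K)%VS. Proof. by rewrite KE; exact: subv_adjoin. Qed.
Let GK : (G <= K)%VS. Proof. exact: subv_trans (Gk s i) kK. Qed.
Let xK : x \in K. Proof. by rewrite KE; exact: memv_adjoin. Qed.
Let iK : i \in K. Proof. exact/(subvP kK)/ik. Qed.
Let sK : s \in K. Proof. exact/(subvP kK)/sk. Qed.
Let m0 : (0 < m)%N.
Proof. by move: mE; rewrite !inE => /or3P[] /eqP ->; rewrite ?muln_gt0 !prime_gt0. Qed.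
Let x0 : x != 0. Proof. by rewrite -sqrf_eq0 xx natL_eq0 -lt0n. Qed.

Lemma radicand_facts : (m %% 4 = 1)%N /\ exists p m', [/\ prime p, (4 < p)%N, m = (p * m')%N & ~~ (p %| m')%N].
Proof.
have n1 p : prime p -> ~~ (p %| 1)%N by rewrite dvdn1; case: eqP => // ->.
move: mE; rewrite !inE => /or3P[] /eqP ->; split=> //.
- by exists p1, 1%N; rewrite muln1; split=> //; exact: n1.
- by exists p2, 1%N; rewrite muln1; split=> //; exact: n1.
- by rewrite -modnMml p1_4 mul1n.
- by exists p1, p2.
Qed.

Lemma sqclass_rvD E (v w : V) : (G <= E)%VS -> sqclass E (rv (v + w)) <-> sqclass E (rv v * rv w).
Proof.
move=> GE; have [c [cG c0 ->]] := rvD psP v w; have cE := subvP GE _ cG; split.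
  by move=> h; apply: sqclassM => //; exact: sqclassX.
exact: sqclass_mulX.
Qed.

Lemma sqclass_pair E (j l : 'I_5) : (G <= E)%VS ->
  sqclass E (rv (delta_mx 0 j + delta_mx 0 l)) <-> sqclass E (ps j * ps l).
Proof. by move=> GE; rewrite sqclass_rvD // !rv_delta. Qed.

Lemma norm_not_sqclass_k r (p p' : nat) : prime p -> (4 < p)%N -> ~~ (p %| p')%N -> ~~ (q %| p * p')%N ->
  (exists d1, d = (p * d1)%N /\ ~~ (p %| d1)%N) ->
  r \in G -> r * tau r = (p * p')%:R -> ~ sqclass k r.
Proof.
move=> pp p4 pp' qm hd rG rN.
exact: (norm_not_sqclass ii ss rs ri ts ti pp p4 erefl pp' prq qm E3 ndq hd rG rN).
Qed.

Lemma squarefree_d (n : nat) : (d %| n ^ 2)%N -> (d %| n)%N.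
Proof.
have c12 : coprime p1 p2 by rewrite prime_coprime.
have c12q : coprime (p1 * p2) q by rewrite coprime_sym prime_coprime.
by rewrite !Gauss_dvd // !Euclid_dvdX // !andbT.
Qed.

Lemma capitulating_vector : exists v, sqclass K (rv v) /\ ~ sqclass k (rv v).
Proof.
have [e0 e1 e2 e3 e4] := psE; have ttau := tautau ii ti.
have pi1G : pi1 \in G by case: pp1 => -[].
have pi2G : pi2 \in G by case: pp2 => -[].
have h1 : exists d1, d = (p1 * d1)%N /\ ~~ (p1 %| d1)%N by exists (p2 * q)%N.
have h2 : exists d1, d = (p2 * d1)%N /\ ~~ (p2 %| d1)%N by exists (p1 * q)%N.
have one p : prime p -> ~~ (p %| 1)%N by rewrite dvdn1; case: eqP => // ->.
have sGk := Gk s i.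
(* When [p] is a square class in [K], so is [q = (s / x) ^+ 2]; as [k] cannot contain both square
   classes, one of them is new in [K]. *)
have both p p' : sqclass K p%:R -> d = (p * p' * q)%N -> prime p -> (4 < p)%N -> odd p -> prime p' -> odd p' ->
    p != p' -> p != q -> p' != q -> ~~ (p %| p' * q)%N -> m = (p * p')%N ->
    sqclass K q%:R /\ (~ sqclass k p%:R \/ ~ sqclass k q%:R).
  move=> sp dE pp p4 op pp' op' npp' npq np'q pd mm; split.
    have -> : q%:R = (s / x) ^+ 2.
      rewrite exprMn exprVn ss xx dE mm natrM mulrC mulKf //.
      by rewrite natL_eq0 -lt0n muln_gt0 !prime_gt0.
    by apply: sqclassX; [mem|rewrite mulf_neq0 ?invr_eq0 // (s_neq0 ss d4)].
  have [kp|] := pselect (sqclass k p%:R); last by left.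
  right=> kq; have dE1 : d = (p * (p' * q))%N by rewrite dE mulnA.
  exact: (not_both_sqclass ii ss d4 rs ri ts ti pp p4 dE1 pd prq q_4 E3 squarefree_d dE pp' op' op npp' npq np'q kp kq).
have q_vec : sqclass K q%:R -> ~ sqclass k q%:R -> exists v, sqclass K (rv v) /\ ~ sqclass k (rv v).
  by move=> a b; exists (delta_mx 0 (inord 4)); rewrite rv_delta e4.
move: mE; rewrite !inE => /or3P[] /eqP mm.
- exists (delta_mx 0 (inord 0)); rewrite rv_delta e0; split.
    by apply: (split_prime_sqclass ii ti pr1 p1_4 pp1 pi1E iK xK _).1; rewrite xx mm.
  by apply: (norm_not_sqclass_k pr1 g1 (one _ pr1) _ h1); rewrite ?muln1.
- exists (delta_mx 0 (inord 2)); rewrite rv_delta e2; split.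
    by apply: (split_prime_sqclass ii ti pr2 p2_4 pp2 pi2E iK xK _).1; rewrite xx mm.
  by apply: (norm_not_sqclass_k pr2 g2 (one _ pr2) _ h2); rewrite ?muln1.
have m4 : (p1 * p2 %% 4 = 1)%N by rewrite -modnMml p1_4 mul1n.
(* The three ways to split [p1 p2] with [g > 1]: the full product makes [v + i] divisible by a
   Gaussian integer of norm [p1 p2], which is new in [K]; the other two make [p1] or [p2] a unit
   times a square in [K]. *)
have [g [h [u [v [gh ggt1 e]]]]] := pell_half (nonsquare2 pr1 pr2 p12) m4.
case: (factor_semiprime pr1 pr2 p12 gh ggt1) => -[ge he]; rewrite ge he in e.
- rewrite mul1n in e; have [vO vN] := norm_vi ii ti e.
  rewrite -mulnA in vN.
  have [mu1 [z1 [mupi1 zO1 vE1 muE1 zE1]]] := gdvd_split ii ti pp1 pi1E vO vN.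
  have [mu2 [z2 [mupi2 zO2 vE2 muE2 zE2]]] := gdvd_split ii ti pp2 pi2E zO1 zE1.
  have [j je] : exists j, ps j = mu1 by case: mupi1 => ->; [exists (inord 0)|exists (inord 1)].
  have [l le] : exists l, ps l = mu2 by case: mupi2 => ->; [exists (inord 2)|exists (inord 3)].
  have muO : OO G (mu1 * mu2) by apply: OOM; [rewrite -je|rewrite -le]; exact: psO psP _.
  exists (delta_mx 0 j + delta_mx 0 l); rewrite !sqclass_pair // je le; split.
    apply: (neg_pell_sqclass ii ti iK xK _ e muO zO2 _ zE2 (pell_gt0 e)); first by rewrite xx mm.
    by rewrite vE1 vE2 mulrA.
  apply: (norm_not_sqclass_k pr1 g1 nd12 ndq h1); first by case: muO.
  by rewrite rmorphM /= mulrACA muE1 muE2 -natrM.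
- have sp : sqclass K p1%:R by apply: (pell_factor_sqclass xK _ (prime_gt0 pr1) e); rewrite xx mm.
  have [sq [nk|nk]] := both p1 p2 sp erefl pr1 g1 o1 pr2 o2 p12 p1q p2q nd1 mm; last exact: q_vec.
  by exists (delta_mx 0 (inord 0) + delta_mx 0 (inord 1)); rewrite !sqclass_pair // e0 e1 pi1E.
- have sp : sqclass K p2%:R by apply: (pell_factor_sqclass xK _ (prime_gt0 pr2) e); rewrite xx mm mulnC.
  have dE2 : d = (p2 * p1 * q)%N by rewrite [(p2 * p1)%N]mulnC.
  have p21 : p2 != p1 by rewrite eq_sym.
  have mm2 : m = (p2 * p1)%N by rewrite mm mulnC.
  have [sq [nk|nk]] := both p2 p1 sp dE2 pr2 g2 o2 pr1 o1 p21 p2q p1q nd2 mm2; last exact: q_vec.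
  by exists (delta_mx 0 (inord 2) + delta_mx 0 (inord 3)); rewrite !sqclass_pair // e2 e3 pi2E.
Qed.

(** [K] is Q(i, x, y) with [y = s / x] and [y ^+ 2 = d / m]. The obstruction is applied to a
    Gaussian prime over a factor of the radicand that is a product of two primes: [y ^+ 2] when [m]
    is prime, [x ^+ 2] when [m = p1 p2]. *)
Lemma noncapitulating_vector : exists v, ~ sqclass K (rv v).
Proof.
have [e0 e1 e2 e3 e4] := psE.
pose h : 'AEnd(L) := (sigma \o rho)%AF.
have hE z : h z = sigma (rho z) by rewrite /h comp_lfunE.
have s0 : s != 0 by exact: s_neq0 ss d4.
pose y := s / x.
have hy : h y = y by rewrite hE /y !fmorph_div /= rs rx rmorphN /= s_s sx invrN mulrNN.
have hx : h x = - x by rewrite hE rx sx.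
have hi : h i = i by rewrite hE ri si.
have ry : rho y = - y by rewrite /y fmorph_div /= rs rx mulNr.
have ty : tau y = y by rewrite /y fmorph_div /= ts tx.
have yy (n : nat) : d = (m * n)%N -> y ^+ 2 = n%:R.
  by move=> dE; rewrite /y exprMn exprVn ss xx dE natrM mulrC mulKf // natL_eq0 -lt0n.
have pi1G : pi1 \in G by case: pp1 => -[].
have pi2G : pi2 \in G by case: pp2 => -[].
have n1 p p' : ~~ (p %| p' * q)%N -> ~~ (p %| p')%N by apply: contra; exact: dvdn_mulr.
have sub1 : (K <= <<<<<<QQ L; i>>; x>>; y>>%AS)%VS.
  have xM : x \in <<<<<<QQ L; i>>; x>>; y>>%AS by apply: mem_adj; exact: memv_adjoin.
  have yM : y \in <<<<<<QQ L; i>>; x>>; y>>%AS by exact: memv_adjoin.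
  rewrite KE; apply: adjQ3_sub => //; first by do 2 apply: mem_adj; exact: memv_adjoin.
  by have -> : s = y * x by [rewrite /y divfK]; mem.
have sub2 : (K <= <<<<<<QQ L; i>>; y>>; x>>%AS)%VS.
  have yM : y \in <<<<<<QQ L; i>>; y>>; x>>%AS by apply: mem_adj; exact: memv_adjoin.
  have xM : x \in <<<<<<QQ L; i>>; y>>; x>>%AS by exact: memv_adjoin.
  rewrite KE; apply: adjQ3_sub => //; first by do 2 apply: mem_adj; exact: memv_adjoin.
  by have -> : s = y * x by [rewrite /y divfK]; mem.
move: mE; rewrite !inE => /or3P[] /eqP mm.
- exists (delta_mx 0 (inord 2)); rewrite rv_delta e2 => /(sqclassS sub1).
  apply: (prime_sqclass_obstruction (ga := h) (gb := rho) (gi := tau) (a := p1) (n := p2) (n' := q)) => //.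
  - by rewrite xx mm.
  - by apply: yy; rewrite mm mulnA.
- exists (delta_mx 0 (inord 0)); rewrite rv_delta e0 => /(sqclassS sub1).
  apply: (prime_sqclass_obstruction (ga := h) (gb := rho) (gi := tau) (a := p2) (n := p1) (n' := q)) => //.
  - by rewrite xx mm.
  - by apply: yy; rewrite mm mulnCA mulnA.
- exists (delta_mx 0 (inord 0)); rewrite rv_delta e0 => /(sqclassS sub2).
  apply: (prime_sqclass_obstruction (ga := rho) (gb := h) (gi := tau) (a := q) (n := p1) (n' := p2)) => //.
  - by apply: yy; rewrite mm.
  - by rewrite xx mm.
  - exact: prime_ndvd.
  - exact: prime_ndvd.
Qed.

(** The subgroup S of the count for [E = K], and R for [E = k]. *)
Definition sqvectors E : {set V} := [set v | `[< sqclass E (rv v) >]]%SET.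

Lemma mem_sqvectors E v : (v \in sqvectors E) <-> sqclass E (rv v).
Proof. by rewrite inE; split=> [/asboolP|h]; last exact/asboolP. Qed.

Lemma sqvectors_group E : (G <= E)%VS -> group_set (sqvectors E).
Proof.
move=> GE; apply/group_setP; split.
  by apply/mem_sqvectors; rewrite (_ : 1%g = 0 :> V) // rv0; apply: sqclassU; exact: iunit1.
move=> v w /mem_sqvectors hv /mem_sqvectors hw; apply/mem_sqvectors.
by rewrite (_ : (v * w)%g = v + w) // sqclass_rvD //; exact: sqclassM.
Qed.

Local Notation cl v := (ideal_class k (Jv s i ps v)).

Lemma kernel_strongly_ambiguous c : capitulation_kernel k K c -> strongly_ambiguous G k c.
Proof.
have [m4 [p [m' [pp p4 mm pm']]]] := radicand_facts.
exact: (capitulation_strongly_ambiguous ii ss d4 rs ri ti xx KE pp p4 mm pm' m4 rx tx sx si s_s).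
Qed.

Lemma kernel_image : capitulation_kernel k K = [set cl v | v in [set v | v \in sqvectors K]].
Proof.
apply/seteqP; split=> [c kc|_ [v /mem_sqvectors vK <-]].
  have [v ce] := strongly_ambiguousE ii ss d4 rs ri ti psP psd dprod (kernel_strongly_ambiguous kc).
  exists v => //; apply/mem_sqvectors/(Jv_capitulates ii ss ti psP psd v kK).
  by rewrite -ce.
exact/(Jv_capitulates ii ss ti psP psd v kK).
Qed.

Lemma kernel_card : exists2 n : nat, n \in [:: 2; 4; 8]%N & capitulation_kernel k K #= `I_n.
Proof.
pose S := Group (sqvectors_group GK); pose R := Group (sqvectors_group (Gk s i)).
have RS : R \subset S.
  by apply/fintype.subsetP => v /mem_sqvectors h; apply/mem_sqvectors; exact: sqclassS h.
exists #|S : R|%g; last first.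
  rewrite kernel_image; apply: (card_quotient_image (S := S) (R := R) (F := fun v : V => cl v) RS) => v w _ _.
  rewrite (Jv_classE ii ss ti psP psd v w) -(sqclass_rvD _ _ (Gk s i)) -mem_sqvectors.
  have -> : v + w = (v * w^-1)%g by rewrite -{1}[w]F2_opp.
  have -> : ((v * w^-1)%g \in sqvectors k) = (v \in (R :* w)%g) by rewrite mem_rcoset.
  by split=> h; apply/rcoset_eqP.
apply: index_2_4_8.
- apply/properP; split=> //; have [v [vK vk]] := capitulating_vector.
  by exists v; [exact/mem_sqvectors|apply/negP => /mem_sqvectors].
- apply/properP; split; first exact: finset.subsetT.
  by have [v vK] := noncapitulating_vector; exists v; [rewrite finset.in_setT|apply/negP => /mem_sqvectors].
- exists (const_mx 1).
    apply/mem_sqvectors; rewrite (rv_total dprod) -ss; apply: sqclassX; [exact: sk|exact: s_neq0 ss d4].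
  by apply/eqP => /matrixP/(_ 0 0); rewrite !mxE => /(congr1 val).
Qed.

(** Strictness: a vector outside S gives a strongly ambiguous class that does not capitulate. *)
Lemma kernel_proper : capitulation_kernel k K `<` Am_s G k.
Proof.
split=> [c /kernel_strongly_ambiguous h|].
  by move=> H [_ sH]; exact: sH.
have [v vK] := noncapitulating_vector; move=> /(_ (cl v)) sub; apply: vK.
apply/(Jv_capitulates ii ss ti psP psd v kK)/sub => H [_ sH]; apply: sH.
exact: (Jv_strongly_ambiguous ii ss rs ri ti psP psd).
Qed.

Lemma ambiguous_capitulate (H : {subfield L}) : absolute_genus_field k H ->
  Am_s G k `<=` capitulation_kernel k H.
Proof.
move=> gH; have [[kH _ _] _ _] := gH; have [e0 e1 e2 e3 e4] := psE.
have [r1 r1H r11] : exists2 r, r \in H & r ^+ 2 = p1%:R.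
  apply: (genus_field_sqrt (b := (p2 * q)%N) ii _ pr1 prq _ ndq q1 _ p1_4 _ gH); rewrite ?ss -?E1 //.
  - by rewrite prime_coprime.
  - by rewrite -modnMml p2_4 mul1n.
have [r2 r2H r22] : exists2 r, r \in H & r ^+ 2 = p2%:R.
  apply: (genus_field_sqrt (b := (p1 * q)%N) ii _ pr2 prq _ ndq q2 _ p2_4 _ gH); rewrite ?ss -?E2 //.
  - by rewrite prime_coprime.
  - by rewrite -modnMml p1_4 mul1n.
have iH : i \in H by exact/(subvP kH)/ik.
have sH : s \in H by exact/(subvP kH)/sk.
have s0 : s != 0 by exact: s_neq0 ss d4.
have r10 : r1 != 0 by rewrite -sqrf_eq0 r11 natL_eq0 -lt0n prime_gt0.
have r20 : r2 != 0 by rewrite -sqrf_eq0 r22 natL_eq0 -lt0n prime_gt0.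
have [h0 h1] := split_prime_sqclass ii ti pr1 p1_4 pp1 pi1E iH r1H r11.
have [h2 h3] := split_prime_sqclass ii ti pr2 p2_4 pp2 pi2E iH r2H r22.
have h4 : sqclass H q%:R.
  have -> : q%:R = (s / (r1 * r2)) ^+ 2.
    rewrite exprMn exprVn exprMn ss r11 r22 -natrM [X in _ = X / _]natrM mulrC mulKf //.
    by rewrite natL_eq0 -lt0n muln_gt0 !prime_gt0.
  by apply: sqclassX; [mem|rewrite mulf_neq0 ?invr_eq0 ?mulf_neq0].
have hps j : sqclass H (ps j).
  by move: j; apply: ordP5; rewrite ?(e0, e1, e2, e3, e4).
have hrv v : sqclass H (rv v).
  apply: (big_ind (sqclass H)); [exact: sqclassU (iunit1 L)|exact: sqclassM|] => j _.
  elim: (nat_of_ord _) => [|n IH]; first by rewrite expr0; exact: sqclassU (iunit1 L).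
  by rewrite exprS; exact: sqclassM.
apply: smallest_sub; first exact: capitulation_subgroup.
move=> c /(strongly_ambiguousE ii ss d4 rs ri ti psP psd dprod)[v ->].
exact/(Jv_capitulates ii ss ti psP psd v kH).
Qed.

End KernelCount.

(** * From an arbitrary unramified K to its radicand *)

Section Assembly.
Variables (L : splittingFieldType rat) (s i : L) (p1 p2 q : nat) (K : {subfield L}).
Hypotheses (pr1 : prime p1) (pr2 : prime p2) (prq : prime q).
Hypotheses (p1_4 : (p1 %% 4 = 1)%N) (p2_4 : (p2 %% 4 = 1)%N) (q_4 : (q %% 4 = 3)%N).
Hypotheses (p12 : p1 != p2).
Hypotheses (ii : i ^+ 2 = -1) (ss : s ^+ 2 = (p1 * p2 * q)%:R).
Local Notation k := (kk s i).

Lemma q_ndvd : ~~ (q %| p1 * p2)%N.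
Proof. by apply: prime_ndvd2; rewrite // eq_sym mod4_neq. Qed.

Lemma k_signs : exists rho tau : 'AEnd(L), [/\ rho s = - s, rho i = i, tau s = s & tau i = - i].
Proof.
have sQ : s ^+ 2 \in QQ L by rewrite ss; mem.
have iQ : i ^+ 2 \in QQ L by rewrite ii; mem.
have oQ : (1 : L) ^+ 2 \in QQ L by rewrite expr1n; mem.
have s1 : s \notin QQ L.
  apply: (@sqrt_notQ L s q (p1 * p2)%N%:Z) => //; first exact: q_ndvd.
  by rewrite ss -PoszM mulnC.
have s2 : s * i \notin QQ L.
  apply: (@sqrt_notQ L _ q (- (p1 * p2)%N%:Z)) => //; first by rewrite dvdzE abszN q_ndvd.
  by rewrite [in RHS]mulrN [RHS]rmorphN /= -PoszM -pmulrn exprMn ii ss mulrN1 mulnC.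
(* Only two radicals are present; 1 fills the third place of [sign_auts]. *)
have [rho [rs ri _]] : exists rho : 'AEnd(L), [/\ rho s = - s, rho i = i & rho 1 = 1].
  by apply: sign_auts => //; rewrite !mulr1.
have [tau [ti ts _]] : exists tau : 'AEnd(L), [/\ tau i = - i, tau s = s & tau 1 = 1].
  by apply: sign_auts => //; rewrite !mulr1 [i * s]mulrC; split=> //; exact: i_notQ ii.
by exists rho, tau.
Qed.

Lemma genus_radicand : unramified_ext k K -> \dim_k K = 2%N -> abelian_over_Q K ->
  exists x (m : nat), [/\ x ^+ 2 = m%:R, m \in [:: p1; p2; (p1 * p2)%N] & K = <<k; x>>%AS].
Proof.
move=> [kK unr _] dim2 [galK _]; have gkK : galois k K by apply: galoisS galK; rewrite sub1v.
have [x [sigma [xk x0 sx KE sigk]]] := quadratic_generator gkK dim2.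
have [rho [tau [rs ri ts ti]]] := k_signs.
have [pi1 [pp1 pp1' pi1E pi1n]] := split_prime ii ti pr1 p1_4.
have [pi2 [pp2 pp2' pi2E pi2n]] := split_prime ii ti pr2 p2_4.
have gx : generates s i K sigma x by [].
have [y [m [[_ _ _ KE'] mE yy]]] := radicand_cases pr1 pr2 prq p1_4 p2_4 q_4 p12 ii ss rs ri ts ti
  pp1 pp1' pi1E pi1n pp2 pp2' pi2E pi2n unr galK sigk gx.
by exists y, m.
Qed.

Lemma genus_kernel : unramified_ext k K -> \dim_k K = 2%N -> abelian_over_Q K ->
  [/\ exists2 n : nat, n \in [:: 2; 4; 8]%N & capitulation_kernel k K #= `I_n,
      capitulation_kernel k K `<` Am_s (Gi i) k
    & forall H : {subfield L}, absolute_genus_field k H ->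
        Am_s (Gi i) k `<=` capitulation_kernel k H].
Proof.
move=> unr dim2 abK; have [x [m [xx mE KE]]] := genus_radicand unr dim2 abK.
have [_ [p [m' [pp _ mm pm']]]] := radicand_facts pr1 pr2 p1_4 p2_4 p12 mE.
have qm : ~~ (q %| m)%N.
  have := q_ndvd; rewrite Euclid_dvdM // negb_or => /andP[h1 h2].
  by move: mE; rewrite !inE => /or3P[] /eqP -> //; exact: q_ndvd.
have dE : (p1 * p2 * q)%N = (q * (p1 * p2))%N by rewrite mulnC.
have [sigma [rho [tau [[sx s_s si] [rx rs ri] [tx ts ti]]]]] :=
  three_signs ii xx ss pp mm pm' prq dE q_ndvd qm.
have [pi1 [pp1 pp1' pi1E pi1n]] := split_prime ii ti pr1 p1_4.
have [pi2 [pp2 pp2' pi2E pi2n]] := split_prime ii ti pr2 p2_4.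
split.
- exact: (kernel_card pr1 pr2 prq p1_4 p2_4 q_4 p12 ii ss xx sx s_s si rx rs ri tx ts ti mE KE
    pp1 pp1' pi1E pi1n pp2 pp2' pi2E pi2n).
- exact: (kernel_proper pr1 pr2 prq p1_4 p2_4 q_4 p12 ii ss xx sx s_s si rx rs ri tx ts ti mE KE
    pp1 pp1' pi1E pi1n pp2 pp2' pi2E pi2n).
- exact: (ambiguous_capitulate pr1 pr2 prq p1_4 p2_4 q_4 p12 ii ss rs ri ti
    pp1 pp1' pi1E pi1n pp2 pp2' pi2E pi2n).
Qed.

End Assembly.

Theorem mainTheorem1 (p1 p2 q : nat)
  (p1_prime : prime p1) (p2_prime : prime p2) (q_prime : prime q)
  (distinct : uniq [:: p1; p2; q])
  (p1_mod4 : p1 = 1%N %[mod 4]) (p2_mod4 : p2 = 1%N %[mod 4])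
  (q_mod4 : (- q%:Z = 1 %[mod 4])%Z)
  (L : splittingFieldType rat) (s i : L)
  (s_sqr : s ^+ 2 = (p1 * p2 * q)%:R) (i_sqr : i ^+ 2 = -1)
  (Qi k K : {subfield L})
  (Qi_def : Qi = <<1; i>>%AS) (k_def : k = <<1 & [:: s; i]>>%AS)
  (K_unramified : unramified_ext k K)
  (K_quadratic : \dim_k K = 2%N)
  (K_abelian : abelian_over_Q K) :
  [/\ exists2 n : nat, n \in [:: 2; 4; 8]%N & capitulation_kernel k K #= `I_n,
      capitulation_kernel k K `<` Am_s Qi k
    & forall G : {subfield L}, absolute_genus_field k G ->
        Am_s Qi k `<=` capitulation_kernel k G].
Proof.
have p12 : p1 != p2 by move: distinct; rewrite /= !inE negb_or => /andP[/andP[]].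
have q_4 : (q %% 4 = 3)%N by move: q_mod4; clear; lia.
have QiE : Qi = Gi i by rewrite Qi_def; apply: val_inj.
have kE : k = kk s i.
  rewrite k_def; apply: val_inj => /=; rewrite adjoin_cons adjoin_seq1.
  apply/eqP; rewrite eqEsubv; apply/andP; split.
    by apply: (@adjQ2_sub L <<<<QQ L; i>>; s>>%AS s i); [exact: memv_adjoin|apply: mem_adj; exact: memv_adjoin].
  by apply: (@adjQ2_sub L <<<<QQ L; s>>; i>>%AS i s); [exact: memv_adjoin|apply: mem_adj; exact: memv_adjoin].
rewrite QiE kE in K_unramified K_quadratic *.
exact: (genus_kernel p1_prime p2_prime q_prime p1_mod4 p2_mod4 q_4 p12 i_sqr s_sqr K_unramified K_quadratic K_abelian).
Qed.
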